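(* Let $f_1,f_2:I\to\mathbb{R}^N$ be continuous piecewise linear functions whose square root velocity functions $q_1,q_2$ each vanish only on a set of measure $0$. Fix subdivisions $0=s_0<\dots<s_m=1$ and $0=t_0<\dots<t_n=1$ such that $f_1$ is linear on each $[s_{i-1},s_i]$ and $f_2$ is linear on each $[t_{j-1},t_j]$, and let $W_{i,j}$ be the associated weights. Then there exists an optimal matching $\gamma=(\gamma_1,\gamma_2):I\to I\times I$ of $f_1,f_2$ that has the following properties: (1) $\gamma$ is a sequence of P-segments and N-segments; i.e., there exists a partition $0=u_0<u_1<\dots<u_k=1$ such that for each $i=1,\dots,k$, $\gamma|_{[u_{i-1},u_i]}$ is either a P-segment or an N-segment. (2) $\gamma$ does not contain two consecutive N-segments (among the segments of this partition). (3) Suppose that $\gamma|_{[c_1,c_2]}$ and $\gamma|_{[c_3,c_4]}$ are both P-segments (with $c_1<c_2\le c_3<c_4$), and suppose that either $c_2=c_3$ or $\gamma|_{[c_2,c_3]}$ is an N-segment. Define $(i_1,j_1)$ and $(i_2,j_2)$ by $(s_{i_1},t_{j_1})=\gamma(c_2)$ and $(s_{i_2},t_{j_2})=\gamma(c_3)$. Let $A=W_{i_1,j_1}$, $B=W_{i_2+1,j_2+1}$, $C=W_{i_1,j_2+1}$, $D=W_{i_2+1,j_1}$. Then the final slope $H_{i_1,j_1}$ of $\gamma|_{[c_1,c_2]}$ and the initial slope $H_{i_2+1,j_2+1}$ of $\gamma|_{[c_3,c_4]}$ are related by $H_{i_2+1,j_2+1}=\mu^2H_{i_1,j_1}$, where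 $$\mu\in\begin{cases}\left[\frac{D^2}{AB},\frac{AB}{C^2}\right]&\text{if }C>0,\ D>0,\\ \left[0,\frac{AB}{C^2}\right]&\text{if }D\le 0,\ C>0,\\ \left[\frac{D^2}{AB},\infty\right]&\text{if }D>0,\ C\le 0,\\ [0,\infty]&\text{if }D\le 0,\ C\le 0.\end{cases}$$ (If $C,D>0$ and $CD>AB$, the prescribed interval is empty; in that case there cannot be an optimal matching with one P-segment ending at $(s_{i_1},t_{j_1})$ and the next P-segment, following it directly or after a single N-segment, beginning at $(s_{i_2},t_{j_2})$.)
   Context: $I=[0,1]$. $L^2(I,\mathbb{R}^N)$ has its standard inner product $\langle\cdot,\cdot\rangle$ and $d(q,w)=\|q-w\|_{L^2}$. The square root velocity function (SRVF) of an absolutely continuous $f:I\to\mathbb{R}^N$ is $q=V\circ f'\in L^2(I,\mathbb{R}^N)$, where $V(x)=x/\sqrt{|x|}$ for $x\ne0$ and $V(0)=0$. $\tilde\Gamma$ is the set of absolutely continuous $\gamma:I\to I$ with $\gamma(0)=0$, $\gamma(1)=1$, $\gamma'\ge0$ a.e.; $\Gamma\subset\tilde\Gamma$ is the subset (a group under composition) with $\gamma'>0$ a.e. These act on the right on $L^2(I,\mathbb{R}^N)$ by $(q*\gamma)(t)=q(\gamma(t))\sqrt{\gamma'(t)}$ (equal to $0$ where $\gamma'(t)=0$). $[q]$ denotes the $L^2$-closure of the orbit $q\Gamma=\{q*\gamma:\gamma\in\Gamma\}$, and $d([q],[w])=\inf_{\tilde q\in[q],\tilde w\in[w]}d(\tilde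 q,\tilde w)$. A matching of $f_1,f_2$ is a pair $\gamma_1,\gamma_2\in\tilde\Gamma$, regarded as one map $\gamma=(\gamma_1,\gamma_2):I\to I\times I$. It is optimal if $d(q_1*\gamma_1,q_2*\gamma_2)=d([q_1],[q_2])$, where $q_1,q_2$ are the SRVFs of $f_1,f_2$. Grid and weights. $q_1$ has a constant value $u_i$ on $(s_{i-1},s_i)$ ($1\le i\le m$) and $q_2$ has a constant value $v_j$ on $(t_{j-1},t_j)$ ($1\le j\le n$); the weights are $W_{i,j}=u_i\cdot v_j$. A vertex is a point $(s_i,t_j)$; horizontal gridlines are the lines $t=t_j$, vertical gridlines the lines $s=s_i$ (coordinates $(s,t)$ on $I\times I$); blocks are $G_{i,j}=[s_{i-1},s_i]\times[t_{j-1},t_j]$. $\gamma^{-1}(G_{i,j})$ is always a closed (possibly empty or degenerate) interval. If $\gamma$ is linear and non-constant on an interval, its slope there is $\gamma_2'/\gamma_1'\in[0,\infty]$. P-segment. A P-segment is a restriction of $\gamma$ to an interval $[a,b]\subset I$ such that: (P1) $\gamma|_{[a,b]}$ is piecewise linear and injective. (P2) $\gamma(a)=(s_{i_0-1},t_{j_0-1})$ and $\gamma(b)=(s_{i_1},t_{j_1})$ are vertices with $i_0\le i_1$, $j_0\le j_1$; for $z\in(a,b)$, $\gamma(z)$ is not a vertex; and $W_{i_0,j_0}>0$, $W_{i_1,j_1}>0$. (P3) For all blocks with $\gamma^{-1}(G_{i,j})\subset[a,b]$, the restriction of $\gamma$ to $\gamma^{-1}(G_{i,j})$ is linear; $H_{i,j}$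 denotes its slope there. (P4) Suppose $\gamma^{-1}(G_{i,j})=[c,d]\subset[a,b]$ with $c<d$. If $W_{i,j}\le0$ then $H_{i,j}=0$ if $\gamma$ enters $G_{i,j}$ through its left vertical edge, and $H_{i,j}=\infty$ if $\gamma$ enters through its lower horizontal edge. If $W_{i,j}>0$ then $H_{i,j}\notin\{0,\infty\}$. (P5) When the segment passes through a vertical gridline from $G_{i,j}$ to $G_{i+1,j}$: if $W_{i,j}>0$ and $W_{i+1,j}>0$ then $H_{i+1,j}/H_{i,j}=(W_{i+1,j}/W_{i,j})^2$; if $W_{i+1,j}\le0$ then $H_{i+1,j}=0$; if $W_{i,j}\le0$ and $W_{i+1,j}>0$, then, with $k\le i$ the largest index with $W_{k,j}>0$ (the last block $G_{k,j}$ the segment passed through with non-zero slope), $H_{i+1,j}/H_{k,j}=(W_{i+1,j}/W_{k,j})^2$. (P6) When the segment passes through a horizontal gridline from $G_{i,j}$ to $G_{i,j+1}$: if $W_{i,j}>0$ and $W_{i,j+1}>0$ then $H_{i,j+1}/H_{i,j}=(W_{i,j}/W_{i,j+1})^2$; if $W_{i,j+1}\le0$ then $H_{i,j+1}=\infty$; if $W_{i,j}\le0$ and $W_{i,j+1}>0$, then, with $k\le j$ the largest index with $W_{i,k}>0$ (the last block $G_{i,k}$ the segment passed through with non-infinite slope), $H_{i,j+1}/H_{i,k}=(W_{i,k}/W_{i,j+1})^2$. The initial slope of the P-segment is $H_{i_0,j_0}$ and its final slope is $H_{i_1,j_1}$. N-segment. An N-segment is a restriction of $\gamma$ to an interval $[a,b]\subset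 I$ such that: (N1) $\gamma(a)=(s_{i_0},t_{j_0})$ and $\gamma(b)=(s_{i_1},t_{j_1})$ are vertices with $i_0\le i_1$, $j_0\le j_1$. (N2) $\gamma|_{[a,(a+b)/2]}$ is linear and runs horizontally from $(s_{i_0},t_{j_0})$ to $(s_{i_1},t_{j_0})$, and $\gamma|_{[(a+b)/2,b]}$ is linear and runs vertically from $(s_{i_1},t_{j_0})$ to $(s_{i_1},t_{j_1})$; in the special cases $i_0=i_1$ or $j_0=j_1$ the entire segment is vertical or horizontal, respectively. (N3) $W_{i,j}\le0$ whenever $i\in\{i_0+1,\dots,i_1\}$ and $j\in\{j_0,\dots,j_1+1\}$, and whenever $i\in\{i_0,\dots,i_1+1\}$ and $j\in\{j_0+1,\dots,j_1\}$ (conditions on indices $(i,j)$ for which no block exists are vacuous). *)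

(* Defs.v *)
(* Functions on I = [0,1] are total functions on R of which only the values on
   [0,1] matter. *)
From HB Require Import structures.
From mathcomp Require Import all_boot all_order all_algebra.
From mathcomp Require Import all_classical all_reals all_analysis.

Set Implicit Arguments.
Unset Strict Implicit.
Unset Printing Implicit Defensive.

Import Order.TTheory GRing.Theory Num.Theory.
Import numFieldNormedType.Exports.

Local Open Scope classical_set_scope.
Local Open Scope ring_scope.

Section Euclidean.
Context {R : realType} {N : nat}.

Definition dot (x y : 'rV[R]_N) : R := \sum_i x ord0 i * y ord0 i.

(* The library norm on row vectors is the sup norm, hence this definition. *)
Definition enorm (x : 'rV[R]_N) : R := Num.sqrt (dot x x).

Definition V (x : 'rV[R]_N) : 'rV[R]_N :=
  if x == 0 then 0 else (Num.sqrt (enorm x))^-1 *: x.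

(* [derive1] is total; where [f] is not differentiable its value is junk.  For
   absolutely continuous [f] this only concerns a null set. *)
Definition srvf (f : R -> 'rV[R]_N) (x : R) : 'rV[R]_N := V (derive1 f x).

Definition weight (u v : nat -> 'rV[R]_N) (i j : nat) : R := dot (u i) (v j).

End Euclidean.

Section PiecewiseLinear.
Context {R : realType}.

Definition subdivision (a b : R) (k : nat) (p : nat -> R) : Prop :=
  [/\ p 0%N = a, p k = b & forall i, (i < k)%N -> p i < p i.+1].

Definition linear_on {E : lmodType R} (f : R -> E) (A : set R) : Prop :=
  exists p v : E, forall z, A z -> f z = p + z *: v.

Definition piecewise_linear {E : lmodType R} (f : R -> E) (a b : R) : Prop :=
  exists (k : nat) (p : nat -> R), subdivision a b k p /\
    forall i, (i < k)%N -> linear_on f `[p i, p i.+1].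

End PiecewiseLinear.

Section Reparametrization.
Context {R : realType}.

Definition absolutely_continuous (g : R -> R) : Prop :=
  forall e : R, 0 < e -> exists2 d : R, 0 < d &
    forall (k : nat) (a b : nat -> R),
      (forall i, (i < k)%N -> 0 <= a i /\ a i <= b i /\ b i <= 1) ->
      trivIset [set i | (i < k)%N] (fun i => `]a i, b i[%classic : set R) ->
      \sum_(i < k) (b i - a i) < d ->
      \sum_(i < k) `|g (b i) - g (a i)| < e.

Definition Gamma_tilde : set (R -> R) := [set g |
  [/\ absolutely_continuous g,
      (forall x, x \in `[0, 1] -> g x \in `[0, 1]),
      g 0 = 0, g 1 = 1 &
      {ae lebesgue_measure, forall x, x \in `[0, 1] -> 0 <= derive1 g x}]].

Definition Gamma : set (R -> R) := [set g | Gamma_tilde g /\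
  {ae lebesgue_measure, forall x, x \in `[0, 1] -> 0 < derive1 g x}].

End Reparametrization.

Section L2.
Context {R : realType} {N : nat}.
Implicit Types q w : R -> 'rV[R]_N.

Definition L2 : set (R -> 'rV[R]_N) := [set q : R -> 'rV[R]_N |
  (forall i, measurable_fun (`[0, 1]%classic : set R) (fun x => q x ord0 i)) /\
  (\int[lebesgue_measure]_(x in `[0%R, 1%R]) (enorm (q x) ^+ 2)%:E < +oo)%E].

Definition L2dist q w : R :=
  Num.sqrt (\int[lebesgue_measure]_(x in `[0, 1]) (enorm (q x - w x) ^+ 2))%R.

Definition act q (g : R -> R) (x : R) : 'rV[R]_N :=
  Num.sqrt (derive1 g x) *: q (g x).

(* [q], the closure in L^2 of the orbit of q under Gamma *)
Definition orbit_closure q : set (R -> 'rV[R]_N) := [set w | L2 w /\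
  forall e : R, 0 < e -> exists2 g, Gamma g & L2dist (act q g) w < e].

Definition orbit_dist q w : R :=
  inf [set L2dist q' w' | q' in orbit_closure q & w' in orbit_closure w].

Definition optimal_matching (f1 f2 : R -> 'rV[R]_N) (gam : R -> R * R) : Prop :=
  let g1 z := (gam z).1 in let g2 z := (gam z).2 in
  [/\ Gamma_tilde g1, Gamma_tilde g2 &
      L2dist (act (srvf f1) g1) (act (srvf f2) g2) =
      orbit_dist (srvf f1) (srvf f2)].

End L2.

(* Blocks and weights are indexed from 1: block (i, j), with 1 <= i <= m and
   1 <= j <= n, is [s_(i-1), s_i] x [t_(j-1), t_j]; vertices (s_i, t_j) are
   indexed by 0 <= i <= m and 0 <= j <= n.  [s], [t] and [W] are junk outside
   these ranges. *)
Section Segments.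
Context {R : realType}.
Variables (m n : nat) (s t : nat -> R) (W : nat -> nat -> R).
Variable gam : R -> R * R.

Definition block (i j : nat) : set (R * R) := [set p |
  [/\ s i.-1 <= p.1, p.1 <= s i, t j.-1 <= p.2 & p.2 <= t j]].

Definition is_block (i j : nat) : bool := [&& 1 <= i, i <= m, 1 <= j & j <= n]%N.

Definition block_preimage (i j : nat) : set R :=
  [set z | z \in `[0, 1] /\ block i j (gam z)].

(* For [gam] linear and non-constant on [c, d], this is gamma_2' / gamma_1'. *)
Definition slope (c d : R) : \bar R :=
  if (gam d).1 == (gam c).1 then +oo%E
  else (((gam d).2 - (gam c).2) / ((gam d).1 - (gam c).1))%:E.

(* H_(i,j): the preimage of a block is a closed interval, so that its end points
   are its infimum and its supremum.  The value is only meaningful when the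
   preimage is a non-degenerate interval on which [gam] is linear. *)
Definition H (i j : nat) : \bar R :=
  slope (inf (block_preimage i j)) (sup (block_preimage i j)).

Definition enters_left (c : R) (i j : nat) : Prop :=
  [/\ (gam c).1 = s i.-1, t j.-1 <= (gam c).2 & (gam c).2 <= t j].

Definition enters_below (c : R) (i j : nat) : Prop :=
  [/\ (gam c).2 = t j.-1, s i.-1 <= (gam c).1 & (gam c).1 <= s i].

(* On [a, b], [gam] goes from block (i, j) to block (i + 1, j). *)
Definition passes_right (a b : R) (i j : nat) : Prop :=
  [/\ is_block i j, is_block i.+1 j & exists x z y : R,
    [/\ a <= x /\ y <= b, x < z /\ z < y,
        forall w, w \in `[x, z] -> block i j (gam w),
        forall w, w \in `[z, y] -> block i.+1 j (gam w) &
        (gam x).1 < s i /\ s i < (gam y).1]].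

(* On [a, b], [gam] goes from block (i, j) to block (i, j + 1). *)
Definition passes_up (a b : R) (i j : nat) : Prop :=
  [/\ is_block i j, is_block i j.+1 & exists x z y : R,
    [/\ a <= x /\ y <= b, x < z /\ z < y,
        forall w, w \in `[x, z] -> block i j (gam w),
        forall w, w \in `[z, y] -> block i j.+1 (gam w) &
        (gam x).2 < t j /\ t j < (gam y).2]].

Record P_segment (a b : R) : Prop := {
  P_itv : [/\ 0 <= a, a < b & b <= 1];
  P1_linear : piecewise_linear gam a b;
  P1_injective :
    forall x y, x \in `[a, b] -> y \in `[a, b] -> gam x = gam y -> x = y;
  P2_ends : exists i0 j0 i1 j1 : nat,
    [/\ is_block i0 j0, is_block i1 j1, (i0 <= i1)%N /\ (j0 <= j1)%N,
        gam a = (s i0.-1, t j0.-1) /\ gam b = (s i1, t j1) &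
        0 < W i0 j0 /\ 0 < W i1 j1];
  P2_interior : forall z i j, z \in `]a, b[ -> (i <= m)%N -> (j <= n)%N ->
    gam z <> (s i, t j);
  P3 : forall i j, is_block i j -> block_preimage i j `<=` `[a, b]%classic ->
    linear_on gam (block_preimage i j);
  P4 : forall i j c d, is_block i j -> c < d ->
    block_preimage i j = `[c, d]%classic -> block_preimage i j `<=` `[a, b]%classic ->
    (W i j <= 0 -> (enters_left c i j -> H i j = 0%E) /\
                   (enters_below c i j -> H i j = +oo%E)) /\
    (0 < W i j -> H i j <> 0%E /\ H i j <> +oo%E);
  P5 : forall i j, passes_right a b i j ->
    [/\ 0 < W i j -> 0 < W i.+1 j ->
          (H i.+1 j / H i j)%E = ((W i.+1 j / W i j) ^+ 2)%:E,
        W i.+1 j <= 0 -> H i.+1 j = 0%E &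
        W i j <= 0 -> 0 < W i.+1 j ->
          exists k, [/\ (1 <= k <= i)%N, 0 < W k j,
            (forall l, (k < l <= i)%N -> W l j <= 0) &
            (H i.+1 j / H k j)%E = ((W i.+1 j / W k j) ^+ 2)%:E]];
  P6 : forall i j, passes_up a b i j ->
    [/\ 0 < W i j -> 0 < W i j.+1 ->
          (H i j.+1 / H i j)%E = ((W i j / W i j.+1) ^+ 2)%:E,
        W i j.+1 <= 0 -> H i j.+1 = +oo%E &
        W i j <= 0 -> 0 < W i j.+1 ->
          exists k, [/\ (1 <= k <= j)%N, 0 < W i k,
            (forall l, (k < l <= j)%N -> W i l <= 0) &
            (H i j.+1 / H i k)%E = ((W i k / W i j.+1) ^+ 2)%:E]]
}.

Definition N_segment (a b : R) : Prop :=
  [/\ 0 <= a, a < b, b <= 1 & exists i0 j0 i1 j1 : nat,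
    [/\ (i0 <= i1 <= m)%N /\ (j0 <= j1 <= n)%N,
        gam a = (s i0, t j0), gam b = (s i1, t j1),
        (if (i0 == i1) || (j0 == j1) then linear_on gam `[a, b]
         else [/\ linear_on gam `[a, (a + b) / 2],
                  linear_on gam `[(a + b) / 2, b] &
                  gam ((a + b) / 2) = (s i1, t j0)]) &
        forall i j, is_block i j ->
          ((i0 < i <= i1) && (j0 <= j <= j1.+1))%N ||
          ((i0 <= i <= i1.+1) && (j0 < j <= j1))%N -> W i j <= 0]].

(* P-segments on [c1, c2] and on [c3, c4], the second one following the first
   one directly or after a single N-segment, with gam c2 = (s_i1, t_j1) and
   gam c3 = (s_i2, t_j2). *)
Definition consecutive_P (c1 c2 c3 c4 : R) (i1 j1 i2 j2 : nat) : Prop :=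
  [/\ P_segment c1 c2, P_segment c3 c4, c2 = c3 \/ N_segment c2 c3,
      [/\ i1 <= m, j1 <= n, i2 <= m & j2 <= n]%N &
      gam c2 = (s i1, t j1) /\ gam c3 = (s i2, t j2)].

End Segments.

Definition mu_range {R : realType} (A B C D : R) : set (\bar R) :=
  if 0 < C then
    if 0 < D then `[(D ^+ 2 / (A * B))%:E, (A * B / C ^+ 2)%:E]%classic
    else `[0%E, (A * B / C ^+ 2)%:E]%classic
  else
    if 0 < D then `[(D ^+ 2 / (A * B))%:E, +oo%E]%classic
    else `[0%E, +oo%E]%classic.

(* Main.v *)
(* Expanding the square, || q1*gamma1 - q2*gamma2 ||^2 is a constant minus twice the
   sum over the blocks of W_ij times the integral of sqrt(gamma1' gamma2') over the
   preimage of the block.  By the Cauchy-Schwarz inequality this sum is at most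
   sum_ij max(0, W_ij) sqrt(x_ij y_ij), where x_ij and y_ij are the increments of
   gamma1 and gamma2 in the block.  In each row the y_ij add up to at most the height
   of the row, in each column the x_ij to at most its width, and the blocks that are
   used form a chain.  Maximising over all such (x, y) is a finite problem with a
   compact domain; within a row, a maximiser has y/x proportional to W^2, and within
   a column x/y proportional to W^2.  A maximiser is realised by a polygon that is
   straight in every used block: its maximal stretches without interior vertices are
   the P-segments, and the rest runs along gridlines between blocks with W <= 0.
   The maximum therefore equals the supremum of the correlations, and gamma is
   optimal if and only if its increments solve the finite problem.  The bounds on
   mu are the first order conditions of that problem for moving a little length into
   the blocks of weight C and D. *)

(* The work lies in passing between curves and allocations. Derivatives exist only almost
   everywhere, so each reparametrization gets an integrable density for which the change of
   variables is exact; times spent on gridlines then carry no density, and the values of the SRVFs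
   at gridpoints do not count. The optimal curve may lie outside [Gamma]: the infimum over orbit
   closures is bounded below by a weighted substitute for the triangle inequality, and approached
   from [Gamma] by mixing the identity into the curve. The bounds on mu are proved for every optimal
   curve, since the last claim is not about the polygon alone. Slopes come from closed preimages of
   blocks, whereas the correlation only sees open ones; hence increments are taken over arbitrary
   sets between the two. Finally, a maximiser may contain idle length. Once this is erased, the
   remaining active blocks form a chain that dictates the walk, and a column without active block
   has weight at most 0 wherever the chain would admit a block, since otherwise its whole width
   would be free to be used there. *)
Require Import Defs.
From HB Require Import structures.
From mathcomp Require Import all_boot all_order all_algebra.
From mathcomp Require Import all_classical all_reals all_analysis.
From mathcomp Require Import measurable_realfun ring lra zify.
Set Implicit Arguments.
Unset Strict Implicit.
Unset Printing Implicit Defensive.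

Import Order.TTheory GRing.Theory Num.Theory.
Import numFieldNormedType.Exports.

Local Open Scope classical_set_scope.
Local Open Scope ring_scope.

(** * Absolutely continuous functions *)

Section AbsolutelyContinuous.
Context {R : realType}.
Implicit Types (g F : R -> R) (l J : seq (R * R)).

Definition apart (p q : R * R) : bool := (p.2 <= q.1) || (q.2 <= p.1).

Definition disjoint_family l :=
  all (fun p => [&& 0 <= p.1, p.1 <= p.2 & p.2 <= 1]) l && pairwise apart l.

(** Lists of intervals instead of indexed families: below, single intervals are replaced by
    partitions, which for lists is concatenation. *)
Lemma ac_list g : absolutely_continuous g -> forall e : R, 0 < e ->
  exists2 d : R, 0 < d & forall l, disjoint_family l ->
    \sum_(p <- l) (p.2 - p.1) < d -> \sum_(p <- l) `|g p.2 - g p.1| < e.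
Proof.
move=> acg e e0; have [d d0 H] := acg e e0; exists d => // l /andP[al pl] ld.
have z : R * R := (0, 0).
rewrite (big_nth z) big_mkord.
apply: (H (size l) (fun i => (nth z l i).1) (fun i => (nth z l i).2)).
- by move=> i il; move/allP: al => /(_ _ (mem_nth z il)) /and3P[? ? ?].
- move=> i j /= il jl [x [/=]]; rewrite !in_itv/= => /andP[a1 b1] /andP[a2 b2].
  have key a b : (a < b)%N -> (b < size l)%N ->
     (nth z l a).1 < x -> x < (nth z l a).2 ->
     (nth z l b).1 < x -> x < (nth z l b).2 -> False.
    move=> ab bl h1 h2 h3 h4.
    move/(pairwiseP z): pl => /(_ a b); rewrite !inE => /(_ (ltn_trans ab bl) bl ab).
    by rewrite /apart => /orP[] h; lra.
  by case: (ltngtP i j) => // [ij|ji]; exfalso; [apply: (key i j)|apply: (key j i)].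
- by move: ld; rewrite (big_nth z) big_mkord.
Qed.

Lemma partition_pairs (a b : R) s : itv_partition a b s ->
  let l := [seq (x.2, x.1) | x <- zip s (a :: s)] in
  [/\ all (fun p => [&& a <= p.1, p.1 <= p.2 & p.2 <= b]) l, pairwise apart l,
      \sum_(p <- l) (p.2 - p.1) = b - a &
      forall f : R -> R, \sum_(p <- l) `|f p.2 - f p.1| = variation a b f s].
Proof.
elim: s a => [|x s IH] a abs /=.
  have -> := itv_partition_nil abs.
  by split=> //= [|f]; rewrite big_nil ?subrr// variation_nil.
have xbs := itv_partition_cons abs.
have [al pl sl vl] := IH x xbs.
have ax : a < x by case: abs => /= /andP[].
have xb : x <= b.
  have [_ /eqP lb] := xbs.
  case: (s) xbs lb => [|y s'] xbs lb; first by rewrite -lb.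
  by have [p1 _] := xbs; rewrite -lb; apply: ltW; have := order_path_min lt_trans p1;
   move=> /allP; apply; rewrite /= mem_last.
split.
- rewrite lexx (ltW ax) xb/=; apply/allP => p pl'.
  by move/allP: al => /(_ p pl')/and3P[h1 ->->]; rewrite (le_trans (ltW ax) h1).
- rewrite pl andbT; apply/allP => p pl'.
  by move/allP: al => /(_ p pl')/and3P[h1 h2 h3]; rewrite /apart/= h1.
- by rewrite big_cons sl/=; ring.
- move=> f; rewrite big_cons vl/= (variation_zip f abs)/= big_cons/=.
  by rewrite (variation_zip f xbs).
Qed.

Lemma all_sub_pairs (a b : R) l : 0 <= a -> b <= 1 ->
  all (fun p => [&& a <= p.1, p.1 <= p.2 & p.2 <= b]) l ->
  all (fun p => [&& 0 <= p.1, p.1 <= p.2 & p.2 <= 1]) l.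
Proof.
move=> a0 b1 /allP al; apply/allP => p /al /and3P[h1 h2 h3].
by apply/and3P; split; lra.
Qed.

Lemma TV_small g : absolutely_continuous g -> forall e : R, 0 < e ->
  exists2 d : R, 0 < d & forall a b, 0 <= a -> a <= b -> b <= 1 -> b - a < d ->
   (total_variation a b g <= e%:E)%E.
Proof.
move=> acg e e0; have [d d0 H] := ac_list acg e0; exists d => // a b a0 ab b1 bad.
apply: ge_ereal_sup => _ [_ [s abs <-] <-].
have [al pl sl vl] := partition_pairs abs.
rewrite lee_fin -vl; apply/ltW/H.
  by rewrite /disjoint_family pl andbT; exact: all_sub_pairs al.
by rewrite sl.
Qed.

(** Steps of length [e < d] have variation at most 1, and finitely many of them cover [0, 1]. *)
Lemma ac_bounded_variation g : absolutely_continuous g ->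
  bounded_variation 0 1 g.
Proof.
move=> acg; have [d d0 H] := TV_small acg (@ltr01 R).
apply/bounded_variationP => //.
pose e := Num.min (d / 2) 1.
have e0 : 0 < e by rewrite lt_min; apply/andP; split; lra.
have ed : e < d by rewrite gt_min; apply/orP; left; lra.
clearbody e.
have P k : forall x, 0 <= x -> x <= 1 -> x <= e * k%:R ->
    total_variation 0 x g \is a fin_num.
  elim: k => [|k IH] x x0 x1.
    rewrite mulr0 => xle; have -> : x = 0 by apply/le_anti; rewrite xle.
    by rewrite total_variationxx.
  rewrite -natr1 mulrDr mulr1 => xk.
  have [xe|ex] := leP x e.
    have xd : x - 0 < d by lra.
    have := H 0 x (lexx _) x0 x1 xd.
    rewrite ge0_fin_numE ?total_variation_ge0// => /le_lt_trans; apply.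
    exact: ltry.
  have := IH (x - e) ltac:(lra) ltac:(lra) ltac:(lra).
  rewrite (@total_variationD _ 0 x (x - e)); [|lra|lra].
  rewrite fin_numD => ->/=.
  have := H (x - e) x ltac:(lra) ltac:(lra) x1 ltac:(lra).
  rewrite ge0_fin_numE; last by apply: total_variation_ge0; lra.
  move=> /le_lt_trans; apply; exact: ltry.
pose k := Num.bound e^-1.
apply: (P k) => //.
have := @archi_boundP R e^-1; rewrite invr_ge0 => /(_ (ltW e0)) /ltW.
rewrite -(ler_pM2l e0) divff//. exact: lt0r_neq0.
Qed.

Let v g x := fine (total_variation 0 x g).

Lemma ac_TV_fin g a b : absolutely_continuous g -> 0 <= a -> a <= b -> b <= 1 ->
  total_variation a b g \is a fin_num.
Proof.
move=> acg a0 ab b1; have := ac_bounded_variation acg.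
move/(bounded_variationP g ler01).
rewrite (total_variationD g a0 (le_trans ab b1)) fin_numD => /andP[_].
by rewrite (total_variationD g ab b1) fin_numD => /andP[].
Qed.

Lemma vB g a b : absolutely_continuous g -> 0 <= a -> a <= b -> b <= 1 ->
  v g b - v g a = fine (total_variation a b g).
Proof.
move=> acg a0 ab b1; rewrite /v (total_variationD g a0 ab).
rewrite fineD ?(ac_TV_fin acg)//; last exact: le_trans b1.
by rewrite addrC addKr.
Qed.

Lemma ac_TV_list g : absolutely_continuous g -> forall e : R, 0 < e ->
  exists2 d : R, 0 < d & forall l, disjoint_family l ->
    \sum_(p <- l) (p.2 - p.1) < d -> \sum_(p <- l) (v g p.2 - v g p.1) <= e.
Proof.
move=> acg e e0; have [d d0 H] := ac_list acg e0; exists d => //.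
(* Intervals in [J] are already subdivided and measured by increments of [g], those in [l] still by
   variation. Subdividing one more interval keeps the family disjoint and its total length, so the
   same [d] works throughout; the supremum over the subdivisions then gives the variation. *)
suff K l J : disjoint_family (J ++ l) ->
    \sum_(p <- J ++ l) (p.2 - p.1) < d ->
    \sum_(p <- J) `|g p.2 - g p.1| + \sum_(p <- l) (v g p.2 - v g p.1) <= e.
  move=> l dl sl; have := K l [::] dl sl.
  by rewrite big_nil add0r.
elim: l J => [|p l IH] J; first by rewrite cats0 big_nil addr0 => dj sj; exact/ltW/H.
move=> /andP[ajl pjl]; rewrite big_cat big_cons/= => sjl.
rewrite big_cons.
have /and3P[p0 pp p1] : [&& 0 <= p.1, p.1 <= p.2 & p.2 <= 1].
  by move/allP: ajl; apply; rewrite mem_cat mem_head orbT.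
rewrite (vB acg p0 pp p1).
suff : (total_variation p.1 p.2 g <=
   (e - \sum_(p <- J) `|g p.2 - g p.1| - \sum_(p <- l) (v g p.2 - v g p.1))%:E)%E.
  rewrite -{1}(fineK (ac_TV_fin acg p0 pp p1)) lee_fin => h; lra.
apply: ge_ereal_sup => _ [_ [s abs <-] <-].
have [al pl sl vl] := partition_pairs abs.
set L := [seq _ | _ <- _] in al pl sl vl.
have := IH (J ++ L); rewrite !big_cat/= sl vl => K.
rewrite lee_fin; suff : \sum_(j <- J) `|g j.2 - g j.1| + variation p.1 p.2 g s +
   \sum_(p0 <- l) (v g p0.2 - v g p0.1) <= e by move=> ?; lra.
apply: K; last by lra.
move: ajl pjl; rewrite !all_cat /= => /and3P[aj _ al'].
rewrite pairwise_cat/= => /and3P[jp jj /andP[pl1 ll]].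
apply/andP; split; first by rewrite !all_cat aj al' (all_sub_pairs p0 p1 al).
rewrite !pairwise_cat jj pl ll/=.
move: jp => /allrelP jp; move/allP: al => al; move/allP: pl1 => pl1.
apply/and3P; split=> //.
- apply/allrelP => x y; rewrite mem_cat => /orP[xJ|xL] yl.
    by apply: jp => //; rewrite in_cons yl orbT.
  have /and3P[h1 h2 h3] := al _ xL; have := pl1 _ yl; rewrite /apart => /orP[]h.
    by rewrite (le_trans h3 h).
  by rewrite (le_trans h h1) orbT.
- rewrite andbT; apply/allrelP => x y xJ yL; have /and3P[h1 h2 h3] := al _ yL.
  have := jp x p xJ (mem_head _ _); rewrite /apart => /orP[]h.
    by rewrite (le_trans h h1).
  by rewrite (le_trans h3 h) orbT.
Qed.

Lemma v_homo g : absolutely_continuous g ->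
  {in `[0, 1] &, {homo v g : x y / x <= y}}.
Proof.
move=> acg x y; rewrite !in_itv/= => /andP[x0 x1] /andP[y0 y1] xy.
rewrite -subr_ge0 vB//; apply: fine_ge0; exact: total_variation_ge0.
Qed.

Lemma vB_ge g a b : absolutely_continuous g -> 0 <= a -> a <= b -> b <= 1 ->
  `|g b - g a| <= v g b - v g a.
Proof.
move=> acg a0 ab b1; rewrite vB//.
by rewrite -lee_fin fineK ?(ac_TV_fin acg)//; exact: total_variation_ge.
Qed.

(** Absolute continuity for nondecreasing functions, with [<= e] because the bounds come from
    suprema. *)
Definition ac_mono F := {in `[0, 1] &, {homo F : x y / x <= y}} /\
  forall e : R, 0 < e ->
  exists2 d : R, 0 < d & forall l, disjoint_family l ->
    \sum_(p <- l) (p.2 - p.1) < d -> \sum_(p <- l) (F p.2 - F p.1) <= e.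

(** Jordan decomposition with the variation of [g] as first part. Increments of the second part are
    at most twice those of the variation. *)
Lemma ac_mono_decomp g : absolutely_continuous g ->
  exists F1 F2, [/\ ac_mono F1, ac_mono F2 & g = F1 \- F2].
Proof.
move=> acg; exists (v g), (v g \- g); split.
- by split; [exact: v_homo|exact: ac_TV_list].
- split.
    move=> x y; rewrite !in_itv/= => /andP[x0 x1] /andP[y0 y1] xy.
    have := vB_ge acg x0 xy y1; rewrite ler_norml => /andP[_]; lra.
  move=> e e0; have e20 : 0 < e / 2 by lra.
  have [d1 d10 H1] := ac_TV_list acg e20.
  exists d1 => // l dl ld; have := H1 l dl ld.
  have : \sum_(p <- l) (v g p.2 - g p.2 - (v g p.1 - g p.1)) <=
         \sum_(p <- l) (v g p.2 - v g p.1) + \sum_(p <- l) (v g p.2 - v g p.1).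
    rewrite -big_split/= big_seq [leRHS]big_seq; apply: ler_sum => p pl.
    have /and3P[h1 h2 h3] : [&& 0 <= p.1, p.1 <= p.2 & p.2 <= 1].
      by case/andP: dl => /allP + _; apply.
    have := vB_ge acg h1 h2 h3; rewrite ler_norml => /andP[+ _]; lra.
  move=> ? ?; lra.
- by apply/funext => x /=; lra.
Qed.

End AbsolutelyContinuous.

(** * Stieltjes measures and the fundamental theorem of calculus *)

Section Stieltjes.
Context {R : realType}.
Implicit Types (g F : R -> R).
Local Notation mu := (@lebesgue_measure R).

(** Composition with this retraction onto [0, 1] extends a monotone function to the whole line, as a
    Stieltjes measure needs. It also provides the ramps of [pol]. *)
Definition clamp (x : R) : R := Num.max 0 (Num.min x 1).

Lemma clamp_ge0 x : 0 <= clamp x. Proof. by rewrite /clamp le_max lexx. Qed.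
Lemma clamp_le1 x : clamp x <= 1.
Proof. by rewrite /clamp ge_max ler01 ge_min lexx orbT. Qed.
Lemma clamp_homo : {homo clamp : x y / x <= y}.
Proof. by move=> x y xy; rewrite /clamp; apply: le_max2 => //; exact: le_min2. Qed.
Lemma clampE x : 0 <= x -> x <= 1 -> clamp x = x.
Proof. by move=> x0 x1; rewrite /clamp min_l// max_r. Qed.
Lemma clamp_lip x y : x <= y -> clamp y - clamp x <= y - x.
Proof.
rewrite /clamp; case: (leP x 1) => x1; case: (leP y 1) => y1;
  case: (leP 0 x) => x0; case: (leP 0 y) => y0; rewrite ?(max_r ler01); lra.
Qed.
Lemma clampN x : x <= 0 -> clamp x = 0.
Proof. by move=> x0; rewrite /clamp min_l ?max_l //; lra. Qed.
Lemma clamp1 x : 1 <= x -> clamp x = 1.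
Proof. by move=> x0; rewrite /clamp min_r ?max_r //; lra. Qed.
Lemma clamp_in x : clamp x \in `[0, 1].
Proof. by rewrite in_itv/= clamp_ge0 clamp_le1. Qed.

Lemma ls_measure_oc (f : cumulative R R) a b : a <= b ->
  lebesgue_stieltjes_measure f `]a, b]%classic = (f b - f a)%:E.
Proof.
move=> ab; rewrite /lebesgue_stieltjes_measure /measure_extension.
by rewrite measurable_mu_extE/= ?wlength_itv_bnd//; exact: is_ocitv.
Qed.

Lemma ac_mono_dist F : ac_mono F -> forall e, 0 < e -> exists2 d : R, 0 < d &
  forall x y, x <= y -> y - x < d -> F (clamp y) - F (clamp x) <= e.
Proof.
move=> [nd ac] e e0; have [d d0 H] := ac _ e0; exists d => // x y xy yxd.
have := H [:: (clamp x, clamp y)]; rewrite !big_seq1/=; apply.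
  by rewrite /disjoint_family/= clamp_ge0 clamp_le1 clamp_homo.
by apply: le_lt_trans yxd; exact: clamp_lip.
Qed.

Lemma ac_mono_ext_nd F : ac_mono F -> {homo (F \o clamp) : x y / x <= y}.
Proof. by move=> [nd _] x y xy /=; apply: nd; rewrite ?clamp_in// clamp_homo. Qed.

Lemma ac_mono_cont F : ac_mono F -> continuous (F \o clamp).
Proof.
move=> acF x; apply/cvgrPdist_le => e e0.
have [d d0 H] := ac_mono_dist acF e0.
near=> y.
have yd : `|x - y| < d by near: y; apply: cvgr_dist_lt => //; exact: cvg_id.
have [xy|/ltW yx] := leP x y.
  rewrite distrC ger0_norm ?subr_ge0; last exact: ac_mono_ext_nd.
  by apply: H => //; rewrite distrC ger0_norm ?subr_ge0// in yd.
rewrite ger0_norm ?subr_ge0; last exact: ac_mono_ext_nd.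
by apply: H => //; rewrite ger0_norm ?subr_ge0// in yd.
Unshelve. all: by end_near. Qed.

Lemma open_itv_finite (I : set R) : open I -> is_interval I ->
  (mu I < +oo)%E -> I = set0 \/ exists a b, a < b /\ I = `]a, b[%classic.
Proof.
move=> oI /is_intervalP; set i := Rhull I; move: i => i Ii muI.
have {Ii} IE : I = [set` i] by rewrite Ii; apply/seteqP; split.
have {}oI : I = [set` i]° by rewrite -IE; apply/esym/interior_id.
case: i IE oI => [[b x|[]] [c y|[]]] IE; rewrite ?interior_itv_bnd => oI.
- have [xy|yx] := ltP x y; first by right; exists x, y; split.
  by left; rewrite oI set_itv_ge// bnd_simp -leNgt.
- by left; rewrite IE; apply/seteqP; split => z //=; rewrite in_itv/= ?andbF.
- by move: muI; rewrite IE lebesgue_measure_itv/= ?ltry ?ltNyr /= ?ltxx.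
- by move: muI; rewrite IE lebesgue_measure_itv/= ?ltry ?ltNyr /= ?ltxx.
- by left; rewrite IE; apply/seteqP; split => z //=; rewrite in_itv/= ?andbF.
- by move: muI; rewrite IE lebesgue_measure_itv/= ?ltry ?ltNyr /= ?ltxx.
- by left; rewrite IE; apply/seteqP; split => z //=; rewrite in_itv/= ?andbF.
- by left; rewrite IE; apply/seteqP; split => z //=; rewrite in_itv/= ?andbF.
- by left; rewrite IE; apply/seteqP; split => z //=; rewrite in_itv/= ?andbF.
Qed.

(** Outer regularity puts a null set into an open set of length below [d], which is a disjoint union
    of intervals. Absolute continuity bounds the Stieltjes mass of any finitely many of them by [e],
    and the whole mass by passing to the limit. *)
Lemma ac_mono_null F (Fc : cumulative R R) : ac_mono F -> Fc =1 F \o clamp ->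
  forall A : set (measurableTypeR R), measurable A -> mu A = 0%E -> lebesgue_stieltjes_measure Fc A = 0%E.
Proof.
move=> acF FcE A mA A0.
have [nu nuE] : exists nu : {measure set (measurableTypeR R) -> \bar R},
    lebesgue_stieltjes_measure Fc = nu :> (set (measurableTypeR R) -> \bar R).
  by exists (lebesgue_stieltjes_measure Fc).
rewrite nuE.
apply/eqP; rewrite eq_le measure_ge0 andbT.
apply/lee_addgt0Pr => e e0; rewrite add0e.
have [nd H] := acF; have [d d0 {}H] := H e e0.
have muA : (mu A < +oo)%E by rewrite A0 ltry.
have [U [oU AU Ud]] := lebesgue_regularity_outer mA muA d0.
have mU : measurable (U : set R) := open_measurable oU.
have {}Ud : (mu U < d%:E)%E.
  have -> : U = (U `\` A) `|` A by rewrite setDKU.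
  apply: (le_lt_trans (measureU2 _ _ _)) => //; first exact: measurableD.
  by rewrite [X in (_ + X)%E]A0 adde0.
have UE := open_disjoint_itv_bigcup oU.
have tI := @open_disjoint_itv_trivIset _ _ oU.
have oI := @open_disjoint_itv_open _ _ oU.
have iI := @open_disjoint_itv_is_interval _ _ oU.
set I := open_disjoint_itv oU in UE tI oI iI.
have mI k : measurable (I k : set R) by exact: open_measurable.
(* Some members of the enumeration may be empty; the pair [(0, 0)] stands for these. *)
have /choice [ab abP] : forall k, exists p : R * R,
   [/\ p.1 <= p.2, I k = `]p.1, p.2[%classic & p = (0, 0) \/ p.1 < p.2].
  move=> k; have : (mu (I k) < +oo)%E.
    apply: le_lt_trans (lt_trans Ud (ltry _)).
    apply: le_measure; rewrite ?inE; [exact: mI|exact: mU|].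
    by move=> z Iz; rewrite UE; exists k.
  case/(open_itv_finite (oI k) (iI k)) => [->|[a [b [ab ->]]]].
    by exists (0, 0); split=> //=; [rewrite set_itv_ge// bnd_simp ltxx|left].
  by exists (a, b); split=> //=; [exact: ltW|right].
have muI k : mu (I k) = ((ab k).2 - (ab k).1)%:E.
  have [abk -> _] := abP k; rewrite lebesgue_measure_itv/= lte_fin.
  by case: ltgtP abk => // ->; rewrite ?subrr.
have nuI k : (nu (I k) <= (F (clamp (ab k).2) - F (clamp (ab k).1))%:E)%E.
  have [abk -> _] := abP k.
  apply: (@le_trans _ _ (nu `](ab k).1, (ab k).2]%classic)).
    apply: le_measure; rewrite ?inE//; by apply: subset_itvl; rewrite bnd_simp.
  by have := ls_measure_oc Fc abk; rewrite nuE !FcE /= => ->.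
have nuU : nu U = (\sum_(0 <= k <oo) nu (I k))%E.
  rewrite [in LHS]UE; have := @measure_bigcup _ _ _ nu setT I (fun k _ => mI k) tI.
  by move=> hU; apply: (etrans hU); apply: eq_eseriesl => i; rewrite in_setT.
have muU : mu U = (\sum_(0 <= k <oo) mu (I k))%E.
  rewrite [in LHS]UE; have := @measure_bigcup _ _ _ (lebesgue_measure) setT I (fun k _ => mI k) tI.
  by move=> hU; apply: (etrans hU); apply: eq_eseriesl => i; rewrite in_setT.
apply: (@le_trans _ _ (nu U)); first by apply: le_measure; rewrite ?inE.
rewrite nuU; apply: lime_le; first exact: is_cvg_nneseries.
apply: nearW => n; apply: (@le_trans _ _ (\sum_(0 <= k < n)
  (F (clamp (ab k).2) - F (clamp (ab k).1))%:E)%E); first exact: lee_sum.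
rewrite sumEFin lee_fin.
(* Components may reach outside [0, 1], where the extended [F] is constant; hence the clamped end
   points. *)
have := H [seq (clamp p.1, clamp p.2) | p <- map ab (index_iota 0 n)].
rewrite !big_map /=; apply.
  apply/andP; split.
    apply/allP => _ /mapP[_ /mapP[k _ ->] ->] /=.
    by rewrite clamp_ge0 clamp_le1 clamp_homo//; case: (abP k).
  rewrite -map_comp; apply/(pairwiseP (0, 0)) => i j.
  rewrite !inE size_map size_iota subn0 => ik jk ij.
  rewrite !(nth_map 0%N) ?size_iota ?subn0// !nth_iota ?subn0// !add0n /apart/=.
  have [_ Ii [->|ai]] := abP i; first by rewrite /= clampN// clamp_ge0.
  have [_ Ij [->|aj]] := abP j; first by rewrite /= (clampN (lexx _)) clamp_ge0 orbT.
  apply/orP; have [h|h] := leP (ab i).2 (ab j).1; first by left; exact: clamp_homo.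
  have [h'|h'] := leP (ab j).2 (ab i).1; first by right; exact: clamp_homo.
  exfalso; move/trivIsetP : tI => /(_ i j Logic.I Logic.I); rewrite ltn_eqF// => /(_ isT).
  rewrite -subset0 Ii Ij => /(_ ((Num.max (ab i).1 (ab j).1 + Num.min (ab i).2 (ab j).2) / 2)).
  clear -h h' ai aj; apply; rewrite /= !in_itv/=; split;
  case: (leP (ab i).1 (ab j).1) => ?; case: (leP (ab i).2 (ab j).2) => ?; apply/andP; split; lra.
rewrite -lte_fin; apply: le_lt_trans Ud.
rewrite muU; apply: le_trans (nneseries_lim_ge n _) => //.
rewrite -sumEFin; apply: lee_sum => k _; rewrite muI lee_fin.
by apply: clamp_lip; case: (abP k).
Qed.

End Stieltjes.

Section Density.
Context {R : realType}.
Implicit Types (g F : R -> R).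
Local Notation mu := (@lebesgue_measure R).

(** Radon-Nikodym derivative of the Stieltjes measure of [F], which is finite on ]0, 1] and charges
    no null set. *)
Lemma ac_mono_density F : ac_mono F -> exists h : R -> R,
  mu.-integrable setT (EFin \o h) /\
  forall a b, 0 <= a -> a <= b -> b <= 1 ->
    F b - F a = \int[mu]_(x in `]a, b]) h x.
Proof.
move=> acF.
have rc : right_continuous (F \o clamp).
  by apply: right_continuousW; exact: ac_mono_cont.
pose Fc : cumulative R R :=
  HB.pack (F \o clamp) (isCumulative.Build R _ R (F \o clamp) (ac_mono_ext_nd acF) rc).
have [nu nuE] : exists nu : {measure set (measurableTypeR R) -> \bar R},
    lebesgue_stieltjes_measure Fc = nu :> (set (measurableTypeR R) -> \bar R).
  by exists (lebesgue_stieltjes_measure Fc).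
have nuoc a b : a <= b -> nu `]a, b]%classic = (F (clamp b) - F (clamp a))%:E.
  by move=> ab; have := ls_measure_oc Fc ab; rewrite nuE.
have m01 : measurable (`]0, 1]%classic : set (measurableTypeR R)) by exact: measurable_itv.
have nufin : (nu `]0%R, 1%R]%classic < +oo)%E by rewrite nuoc// ltry.
pose nu' : {finite_measure set (measurableTypeR R) -> \bar R} := mfrestr m01 nufin.
have dom : nu' `<< (lebesgue_measure : {sigma_finite_measure set (measurableTypeR R) -> \bar R}).
  apply/null_content_dominatesP => A mA A0.
  have A0' : lebesgue_stieltjes_measure Fc A = 0%E by apply: (ac_mono_null acF).
  apply/eqP; rewrite eq_le measure_ge0 andbT -A0' nuE.
  by apply: le_measure; rewrite ?inE//; do ?[exact: measurableI|exact: subIsetl].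
have [h [h0 hfin hint hE]] := radon_nikodym_sigma_finite dom.
exists (fine \o h).
have hEF : EFin \o (fine \o h) = h.
  by apply/funext => x /=; rewrite fineK.
split; first by rewrite hEF.
move=> a b a0 ab b1.
rewrite /Rintegral; under eq_integral do rewrite /= fineK//.
have mab : measurable (`]a, b]%classic : set (measurableTypeR R)) by exact: measurable_itv.
rewrite -[X in fine X](hE _ mab) /nu'/= /mfrestr /mrestr.
rewrite setIidl; last first.
  by move=> z /=; rewrite !in_itv/= => /andP[? ?]; apply/andP; split; lra.
by rewrite nuoc//= !clampE//; lra.
Qed.

(** The density is kept beside [derive1 g], whose values are junk where [g] is not differentiable.
    Lebesgue differentiation makes the two agree almost everywhere. *)
Lemma ac_ftc g : absolutely_continuous g -> exists h : R -> R,
  [/\ mu.-integrable setT (EFin \o h),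
      forall a b, 0 <= a -> a <= b -> b <= 1 ->
        g b - g a = \int[mu]_(x in `]a, b]) h x &
      {ae mu, forall x, x \in `]0, 1[ -> derivable g x 1 /\ derive1 g x = h x}].
Proof.
move=> acg; have [F1 [F2 [ac1 ac2 gE]]] := ac_mono_decomp acg.
have [h1 [i1 H1]] := ac_mono_density ac1.
have [h2 [i2 H2]] := ac_mono_density ac2.
pose h x := h1 x - h2 x; exists h.
have ih : mu.-integrable setT (EFin \o h).
  by rewrite (_ : EFin \o h = (EFin \o h1) \- (EFin \o h2))%E//; exact: integrableB.
have gI a b : 0 <= a -> a <= b -> b <= 1 ->
    g b - g a = \int[mu]_(x in `]a, b]) h x.
  move=> a0 ab b1; rewrite /h RintegralB//; last 2 first.
    by apply: integrableS i1.
    by apply: integrableS i2.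
  by rewrite -H1// -H2// gE/=; ring.
split=> //.
have := @FTC1 R h (BRight 0).
have h1' : forall y : R, mu.-integrable [set` Interval (BRight (0:R)) (BRight y)] (EFin \o h).
  by move=> y; apply: integrableS ih.
have h2' : locally_integrable setT h by apply: open_integrable_locally => //; exact: openT.
move=> /(_ h1' h2') /=.
apply: filterS; first exact: (ae_filter_ringOfSetsType mu).
move=> x H; rewrite in_itv/= => /andP[x0 x1].
have [] := H x0.
move=> dG G'.
have E : \forall z \near x, g 0 + \int[mu]_(t in `]0, z]) h t = g z.
  near=> z; rewrite -gI//; first ring.
  - by apply: ltW; near: z; exact: lt_nbhsr.
  - by apply: ltW; near: z; exact: lt_nbhsl.
set G := (fun y : R => _) in dG G'.
have {}E : \forall z \near x, g 0 + G z = g z by exact: E.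
move: G dG G' E => G dG G' E.
have dG1 : is_derive x 1 (fun z => g 0 + G z) (h x).
  by have := is_deriveD (is_derive_cst (g 0) x 1) (derivableP dG); rewrite add0r -derive1E G'; exact.
have [d1 d2] := near_eq_is_derive E dG1.
by split=> //; rewrite derive1E d2.
Unshelve. all: by end_near. Qed.

End Density.

(** * The finite problem *)

Section Allocation.
Context {R : realType}.
Implicit Types (x y w : nat -> nat -> R) (ds dt : nat -> R) (m n : nat).

Definition cmp_block (i j i' j' : nat) : bool :=
  ((i <= i')%N && (j <= j')%N) || ((i' <= i)%N && (j' <= j)%N).

Lemma cmp_blockC i j i' j' : cmp_block i j i' j' = cmp_block i' j' i j.
Proof. by rewrite /cmp_block orbC. Qed.

(* [x i j] and [y i j] stand for the increments of gamma_1 and gamma_2 inside the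
   block (i, j); [chain] remembers only that gamma is monotone. *)
Definition chain x y := forall i j i' j',
  x i j * y i j != 0 -> x i' j' * y i' j' != 0 -> cmp_block i j i' j'.

(** Inequalities for the sums, because a curve also spends length on gridlines, outside all open
    blocks. *)
Definition feasible m n ds dt x y :=
  [/\ forall i j, 0 <= x i j /\ 0 <= y i j,
      forall i, (1 <= i <= m)%N -> \sum_(1 <= j < n.+1) x i j <= ds i,
      forall j, (1 <= j <= n)%N -> \sum_(1 <= i < m.+1) y i j <= dt j &
      chain x y].

Definition gain w x y i j : R := Num.max 0 (w i j) * Num.sqrt (x i j * y i j).

Definition value m n w x y : R :=
  \sum_(1 <= i < m.+1) \sum_(1 <= j < n.+1) gain w x y i j.

Definition maximal m n ds dt w x y := feasible m n ds dt x y /\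
  forall x' y', feasible m n ds dt x' y' -> value m n w x' y' <= value m n w x y.

(** Exchanges the roles of the two curves. With [x] and [y] exchanged as well, every statement about
    rows yields the one about columns. *)
Definition tr (T : Type) (x : nat -> nat -> T) i j := x j i.

Lemma feasible_tr m n ds dt x y :
  feasible m n ds dt x y -> feasible n m dt ds (tr y) (tr x).
Proof.
case=> [xy0 xs ys ch]; split=> //; first by move=> i j; have [] := xy0 j i.
move=> i j i' j'; rewrite /tr => h1 h2; have := ch j i j' i'.
by rewrite mulrC h1 mulrC h2 => /(_ isT isT); rewrite /cmp_block !(andbC (j <= _)%N) !(andbC (j' <= _)%N).
Qed.

Lemma value_tr m n w x y : value n m (tr w) (tr y) (tr x) = value m n w x y.
Proof.
rewrite /value exchange_big/=; apply: eq_bigr => i _; apply: eq_bigr => j _.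
by rewrite /gain /tr mulrC [y i j * _]mulrC mulrC.
Qed.

Lemma maximal_tr m n ds dt w x y :
  maximal m n ds dt w x y -> maximal n m dt ds (tr w) (tr y) (tr x).
Proof.
case=> [fxy mx]; split=> [|x' y' fx]; first exact: feasible_tr.
by rewrite value_tr -(value_tr n m (tr w) x' y'); apply: mx; exact: feasible_tr.
Qed.

Definition upd (T : Type) (x : nat -> nat -> T) a b v i j := if (i == a) && (j == b) then v else x i j.

Lemma sum_change (f f' : nat -> R) a n : (1 <= a <= n)%N ->
  (forall i, i != a -> f' i = f i) ->
  \sum_(1 <= i < n.+1) f' i = \sum_(1 <= i < n.+1) f i + (f' a - f a).
Proof.
move=> an ff; have am : a \in index_iota 1 n.+1 by rewrite mem_index_iota.
rewrite !(bigD1_seq a) ?iota_uniq//= (eq_bigr f); last by move=> i /ff.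
by ring.
Qed.

Lemma upd_same (T : Type) (x : nat -> nat -> T) a b v : upd x a b v a b = v.
Proof. by rewrite /upd !eqxx. Qed.

Lemma upd_other (T : Type) (x : nat -> nat -> T) a b v i j :
  (i, j) != (a, b) -> upd x a b v i j = x i j.
Proof. by rewrite /upd -[(i, j) == _]/((i == a) && (j == b)) => /negbTE ->. Qed.

Lemma feasible_upd m n ds dt x y a b X Y : is_block m n a b ->
  feasible m n ds dt x y -> 0 <= X -> 0 <= Y ->
  \sum_(1 <= j < n.+1) x a j - x a b + X <= ds a ->
  \sum_(1 <= i < m.+1) y i b - y a b + Y <= dt b ->
  (X * Y != 0 -> forall i j, x i j * y i j != 0 -> cmp_block i j a b) ->
  feasible m n ds dt (upd x a b X) (upd y a b Y).
Proof.
move=> /and4P[a1 am b1 bn] [xy0 xs ys ch] X0 Y0 sX sY cXY.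
have am' : (1 <= a <= m)%N by rewrite a1.
have bn' : (1 <= b <= n)%N by rewrite b1.
split.
- by move=> i j; rewrite /upd; case: ifP => // _; apply: xy0.
- move=> i im; have [->|ia] := eqVneq i a; last first.
    under eq_bigr do rewrite upd_other ?xpair_eqE ?(negbTE ia)//.
    exact: xs.
  rewrite (@sum_change (x a) _ b)//; last first.
    by move=> j jb; rewrite upd_other// xpair_eqE eqxx.
  by rewrite upd_same; lra.
- move=> j jn; have [->|jb] := eqVneq j b; last first.
    under eq_bigr do rewrite upd_other ?xpair_eqE ?(negbTE jb) ?andbF//.
    exact: ys.
  rewrite (@sum_change (y^~ b) _ a)//; last first.
    by move=> i ia; rewrite upd_other// xpair_eqE (negbTE ia).
  by rewrite upd_same; lra.
- move=> i j i' j'; rewrite /upd.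
  case: ifP => [/andP[/eqP-> /eqP->]|_]; case: ifP => [/andP[/eqP-> /eqP->]|_].
  + by move=> _ _; rewrite /cmp_block !leqnn.
  + by move=> h1 h2; rewrite cmp_blockC; exact: cXY.
  + by move=> h1 h2; exact: cXY.
  + exact: ch.
Qed.

Lemma value_upd m n w x y a b X Y : is_block m n a b ->
  value m n w (upd x a b X) (upd y a b Y) = value m n w x y +
    (Num.max 0 (w a b) * Num.sqrt (X * Y) - gain w x y a b).
Proof.
move=> /and4P[a1 am b1 bn].
rewrite /value (@sum_change (fun i => \sum_(1 <= j < n.+1) gain w x y i j) _ a) ?a1//; last first.
  move=> i ia; apply: eq_bigr => j _.
  by rewrite /gain !upd_other// xpair_eqE (negbTE ia).
congr (_ + _); rewrite (@sum_change (gain w x y a) _ b) ?b1//; last first.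
  by move=> j jb; rewrite /gain !upd_other// xpair_eqE (negbTE jb) andbF.
by rewrite /gain !upd_same; ring.
Qed.

Section Maximal.
Variables (m n : nat) (ds dt : nat -> R) (w x y : nat -> nat -> R).
Hypothesis mx : maximal m n ds dt w x y.

Let fxy : feasible m n ds dt x y. Proof. by case: mx. Qed.

Lemma maximal_upd a b X Y : is_block m n a b -> 0 <= X -> 0 <= Y ->
  \sum_(1 <= j < n.+1) x a j - x a b + X <= ds a ->
  \sum_(1 <= i < m.+1) y i b - y a b + Y <= dt b ->
  (X * Y != 0 -> forall i j, x i j * y i j != 0 -> cmp_block i j a b) ->
  Num.max 0 (w a b) * Num.sqrt (X * Y) <= gain w x y a b.
Proof.
move=> ab X0 Y0 sX sY cXY; have [_ H] := mx.
have := H _ _ (feasible_upd ab fxy X0 Y0 sX sY cXY).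
by rewrite value_upd//; lra.
Qed.

(* Splitting the total [y i b + y k b] in proportion to the squared weights is
   optimal, by the equality case of the Cauchy-Schwarz inequality. *)
Lemma maximal_split i k b X : is_block m n i b -> is_block m n k b -> i != k ->
  0 < w i b -> 0 < w k b -> 0 < x i b -> 0 < X ->
  0 < y i b ->
  x k b * y k b = X * y k b ->
  \sum_(1 <= j < n.+1) x k j - x k b + X <= ds k ->
  (forall i' j', x i' j' * y i' j' != 0 -> cmp_block i' j' k b) ->
  w i b ^+ 2 * x i b * y k b = w k b ^+ 2 * X * y i b.
Proof.
move=> ib kb ik wi wk xi X0 yi xX sX ck.
have [xy0 xs ys ch] := fxy.
(* For fixed [r + s] the sum [al * sqrt r + be * sqrt s] is largest when [r : s = al ^ 2 : be ^ 2].
   This split is the competitor. *)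
pose al := w i b * Num.sqrt (x i b); pose be := w k b * Num.sqrt X.
have al0 : 0 < al by rewrite mulr_gt0// sqrtr_gt0.
have be0 : 0 < be by rewrite mulr_gt0// sqrtr_gt0.
pose D := al ^+ 2 + be ^+ 2.
have D0 : 0 < D by rewrite addr_gt0// exprn_gt0.
pose p := Num.sqrt (y i b); pose q := Num.sqrt (y k b).
have p2 : p ^+ 2 = y i b by rewrite sqr_sqrtr//; case: (xy0 i b).
have q2 : q ^+ 2 = y k b by rewrite sqr_sqrtr//; case: (xy0 k b).
pose c := (y i b + y k b) / D.
have yk0 : 0 <= y k b by case: (xy0 k b).
have c0 : 0 <= c by apply: divr_ge0; [apply: addr_ge0 => //|]; exact: ltW.
have cD : c * D = y i b + y k b by rewrite divfK// lt0r_neq0.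
pose r := al ^+ 2 * c; pose s := be ^+ 2 * c.
have rs : r + s = y i b + y k b by rewrite -cD /D /r /s; ring.
have r0 : 0 <= r by rewrite mulr_ge0// sqr_ge0.
have s0 : 0 <= s by rewrite mulr_ge0// sqr_ge0.
pose lo := Num.min r (y i b).
(* The entry at (i, b) is lowered before the one at (k, b) is raised, so that the
   intermediate allocation is feasible. *)
have im : (1 <= i <= m)%N by case/and4P: ib => -> ->.
have km : (1 <= k <= m)%N by case/and4P: kb => -> ->.
have bn : (1 <= b <= n)%N by case/and4P: kb => _ _ -> ->.
have sumy : \sum_(1 <= l < m.+1) y l b <= dt b by exact: ys.
have sumx l : (1 <= l <= m)%N -> \sum_(1 <= j < n.+1) x l j <= ds l by exact: xs.
have ci i' j' : x i' j' * y i' j' != 0 -> cmp_block i' j' i b.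
  by move=> h; apply: ch => //; rewrite mulf_neq0// lt0r_neq0.
have : feasible m n ds dt (upd (upd x i b (x i b)) k b X) (upd (upd y i b 0) k b 0).
  apply: feasible_upd => //.
  - apply: feasible_upd => //; first exact: ltW.
    + by have := sumx i im; lra.
    + by lra.
  - exact: ltW.
  - rewrite [\sum_(_ <= j < _) _](eq_bigr (x k)); last first.
      by move=> j _; rewrite upd_other// xpair_eqE eq_sym (negbTE ik).
    by rewrite upd_other// xpair_eqE eq_sym (negbTE ik).
  - rewrite (@sum_change (y^~ b) ((upd y i b 0)^~ b) i)// ?upd_same.
      by rewrite upd_other ?xpair_eqE 1?eq_sym ?(negbTE ik)//; lra.
    by move=> l li; rewrite upd_other// xpair_eqE (negbTE li).
  - by rewrite mulr0 eqxx.
set x1 := upd _ k b X; set y1 := upd _ k b 0 => f1.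
have x1k : x1 k b = X by rewrite /x1 upd_same.
have x1i : x1 i b = x i b by rewrite /x1 upd_other ?xpair_eqE ?(negbTE ik)// upd_same.
have y1k : y1 k b = 0 by rewrite /y1 upd_same.
have y1i : y1 i b = 0 by rewrite /y1 upd_other ?xpair_eqE ?(negbTE ik)// upd_same.
have supp1 i' j' : x1 i' j' * y1 i' j' != 0 -> x i' j' * y i' j' != 0.
  rewrite /x1 /y1 /upd; case: ifP; first by rewrite mulr0 eqxx.
  by case: ifP; first by rewrite mulr0 eqxx.
have sy1 : \sum_(1 <= l < m.+1) y1 l b = \sum_(1 <= l < m.+1) y l b - y i b - y k b.
  rewrite (@sum_change ((upd y i b 0)^~ b) (y1^~ b) k)//; last first.
    by move=> l lk; rewrite /y1 upd_other// xpair_eqE (negbTE lk).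
  rewrite (@sum_change (y^~ b) ((upd y i b 0)^~ b) i)//; last first.
    by move=> l li; rewrite upd_other// xpair_eqE (negbTE li).
  rewrite y1k upd_same upd_other ?xpair_eqE 1?eq_sym ?(negbTE ik)//; ring.
have sx1 l : (1 <= l <= m)%N -> \sum_(1 <= j < n.+1) x1 l j <= ds l by case: f1 => _ + _ _; apply.
have v1 : value m n w x1 y1 = value m n w x y - gain w x y i b - gain w x y k b.
  rewrite /x1 /y1 !value_upd// !mulr0 sqrtr0 !mulr0 !add0r; congr (_ + _ - _).
  by rewrite /gain !upd_other// xpair_eqE eq_sym (negbTE ik).
clearbody x1 y1.
have f2 : feasible m n ds dt (upd x1 i b (x i b)) (upd y1 i b r).
  apply: feasible_upd => //; first exact: ltW.
  - by rewrite x1i; have := sx1 i im; lra.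
  - by rewrite sy1 y1i; lra.
  - by move=> _ i' j' /supp1; exact: ci.
have f3 : feasible m n ds dt (upd (upd x1 i b (x i b)) k b X) (upd (upd y1 i b r) k b s).
  apply: feasible_upd => //; first exact: ltW.
  - rewrite [\sum_(_ <= j < _) _](eq_bigr (x1 k)); last first.
      by move=> j _; rewrite upd_other// xpair_eqE eq_sym (negbTE ik).
    rewrite upd_other ?xpair_eqE 1?eq_sym ?(negbTE ik)// x1k.
    by have := sx1 k km; lra.
  - rewrite (@sum_change (y1^~ b) ((upd y1 i b r)^~ b) i)//; last first.
      by move=> l li; rewrite upd_other// xpair_eqE (negbTE li).
    by rewrite upd_same upd_other ?xpair_eqE 1?eq_sym ?(negbTE ik)// sy1 y1i y1k; lra.
  - move=> _ i' j'; rewrite {1 2}/upd; case: ifP => [/andP[/eqP-> /eqP->] _|_].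
      by apply: ck; rewrite mulf_neq0// lt0r_neq0.
    by move/supp1; exact: ck.
have [_ H] := mx; have := H _ _ f3.
rewrite !value_upd// v1 /gain.
rewrite !upd_other ?xpair_eqE 1?eq_sym ?(negbTE ik)//.
rewrite y1i y1k !mulr0 !sqrtr0 !max_r ?(ltW wi) ?(ltW wk)// !mulr0 !subr0.
(* [X] can differ from [x k b] only if [y k b] vanishes, so the old gain may be computed with [X].
   This freedom is what [no_dead_column] exploits. *)
rewrite xX.
have sqr1 : w i b * Num.sqrt (x i b * r) = al * (al * Num.sqrt c).
  rewrite sqrtrM ?ltW// /r sqrtrM ?sqr_ge0// sqrtr_sqr gtr0_norm// /al; ring.
have sqr2 : w k b * Num.sqrt (X * s) = be * (be * Num.sqrt c).
  rewrite sqrtrM ?ltW// /s sqrtrM ?sqr_ge0// sqrtr_sqr gtr0_norm// /be; ring.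
have sqr3 : w i b * Num.sqrt (x i b * y i b) = al * p.
  by rewrite sqrtrM ?ltW// mulrA.
have sqr4 : w k b * Num.sqrt (X * y k b) = be * q.
  by rewrite sqrtrM ?ltW// mulrA.
rewrite sqr1 sqr2 sqr3 sqr4 => Hv.
set sc := Num.sqrt c in Hv.
have sc2 : sc ^+ 2 = c by rewrite sqr_sqrtr.
have sc0 : 0 <= sc by exact: sqrtr_ge0.
have key1 : D * sc <= al * p + be * q by rewrite /D; lra.
have key2 : D * sc ^+ 2 = p ^+ 2 + q ^+ 2 by rewrite sc2 p2 q2 mulrC.
(* Lagrange's identity: by [key1] and [key2] its right side is at most 0, so (al, be) and (p, q) are
   proportional. *)
have key3 : (al * q - be * p) ^+ 2 <= 0.
  have -> : (al * q - be * p) ^+ 2 =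
     D * (p ^+ 2 + q ^+ 2) - (al * p + be * q) ^+ 2 by rewrite /D; ring.
  rewrite -key2 subr_le0.
  have -> : D * (D * sc ^+ 2) = (D * sc) ^+ 2 by ring.
  by rewrite ler_sqr// nnegrE; [rewrite mulr_ge0// ltW|apply: le_trans key1; rewrite mulr_ge0// ltW].
have key4 : al * q = be * p.
  by apply/eqP; rewrite -subr_eq0 -sqrf_eq0 eq_le key3 sqr_ge0.
have : (al * q) ^+ 2 = (be * p) ^+ 2 by rewrite key4.
by rewrite !exprMn p2 q2 !sqr_sqrtr// ltW.
Qed.

End Maximal.
End Allocation.

Section Allocation2.
Context {R : realType}.
Implicit Types (x y w : nat -> nat -> R) (ds dt : nat -> R) (m n : nat).

Definition active m n w x y i j : bool :=
  [&& is_block m n i j, 0 < w i j, 0 < x i j & 0 < y i j].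

Definition normalized m n w x y :=
  forall i j, ~~ active m n w x y i j -> x i j = 0 /\ y i j = 0.

Lemma active_tr m n w x y i j :
  active n m (tr w) (tr y) (tr x) i j = active m n w x y j i.
Proof.
rewrite /active /tr /is_block; apply/idP/idP => /and4P[/and4P[-> -> -> ->] -> -> ->] //.
Qed.

Lemma normalized_tr m n w x y :
  normalized m n w x y -> normalized n m (tr w) (tr y) (tr x).
Proof. by move=> H i j; rewrite active_tr => /H[]. Qed.

(** Only active blocks have positive gain, so the entries of all others can be erased without
    loss. *)
Lemma maximal_normalize m n ds dt w x y : maximal m n ds dt w x y ->
  exists x' y', maximal m n ds dt w x' y' /\ normalized m n w x' y'.
Proof.
case=> [[xy0 xs ys ch] H]; pose P := active m n w x y.
pose x' i j := if P i j then x i j else 0; pose y' i j := if P i j then y i j else 0.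
have P' i j : active m n w x' y' i j = P i j.
  rewrite {1}/active /x' /y'; case: ifP => [|_]; first by rewrite /P /active.
  by rewrite ltxx !andbF.
exists x', y'; split; last by move=> i j; rewrite P' /x' /y' => /negbTE ->.
split.
  split.
  - by move=> i j; rewrite /x' /y'; case: ifP.
  - move=> i im; apply: le_trans (xs i im); apply: ler_sum => j _.
    by rewrite /x'; case: ifP => // _; case: (xy0 i j).
  - move=> i im; apply: le_trans (ys i im); apply: ler_sum => j _.
    by rewrite /y'; case: ifP => // _; case: (xy0 j i).
  - move=> i j i' j'; rewrite /x' /y'.
    by case: ifP => [_|]; [case: ifP => [_|]; [exact: ch|]|]; rewrite mulr0 eqxx.
suff -> : value m n w x' y' = value m n w x y by [].
apply: eq_big_nat => i im; apply: eq_big_nat => j jn.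
rewrite /gain /x' /y' /P /active /is_block; case: ifPn => //.
case/andP: im => -> im; case/andP: jn => -> jn; rewrite -ltnS im -ltnS jn/=.
have [x0 y0] := xy0 i j.
have [wij|wij _] := ltP 0 (w i j); last by rewrite ?max_l// !mul0r.
rewrite /= mulr0 sqrtr0 mulr0 !lt_neqAle x0 y0 !andbT. rewrite negb_and !negbK.
by move=> /orP[/eqP<-|/eqP<-]; rewrite ?mul0r ?mulr0 sqrtr0 mulr0.
Qed.

Section Maximal.
Variables (m n : nat) (ds dt : nat -> R) (w x y : nat -> nat -> R).
Hypothesis mx : maximal m n ds dt w x y.
Local Notation act := (active m n w x y).

Lemma active_neq0 i j : act i j -> x i j * y i j != 0.
Proof. by case/and4P => _ _ x0 y0; rewrite mulf_neq0// lt0r_neq0. Qed.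

Lemma active_cmp i j i' j' : act i j -> act i' j' -> cmp_block i j i' j'.
Proof. by case: mx => [[_ _ _ ch] _] h h'; apply: ch; exact: active_neq0. Qed.

Lemma active_row_prop i k b : act i b -> act k b ->
  w i b ^+ 2 * x i b * y k b = w k b ^+ 2 * x k b * y i b.
Proof.
have [->|ik] := eqVneq i k; first by move=> _ _; ring.
move=> ai ak; case/and4P: (ai) => ib wi xi yi; case/and4P: (ak) => kb wk xk yk.
have [[xy0 xs ys ch] _] := mx.
apply: (maximal_split mx) => //.
  rewrite subrK; apply: xs; by case/and4P: kb => -> ->.
by move=> i' j' h; apply: ch => //; exact: active_neq0.
Qed.

Lemma active_row_full i b : act i b -> \sum_(1 <= k < m.+1) y k b = dt b.
Proof.
move=> ai; case/and4P: (ai) => ib wi xi yi.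
have [[xy0 xs ys ch] _] := mx.
have im : (1 <= i <= m)%N by case/and4P: ib => -> ->.
have bn : (1 <= b <= n)%N by case/and4P: ib => _ _ -> ->.
apply/eqP; rewrite eq_le ys//= leNgt; apply/negP => lt.
set S := \sum_(_ <= _ < _) _ in lt.
have : Num.max 0 (w i b) * Num.sqrt (x i b * (y i b + (dt b - S))) <= gain w x y i b.
  apply: (maximal_upd mx ib).
  - exact: ltW.
  - lra.
  - by rewrite subrK; exact: xs.
  - rewrite -/S; lra.
  - by move=> _ i' j' h; apply: ch => //; exact: active_neq0.
rewrite /gain (max_r (ltW wi)) ler_pM2l//.
rewrite ler_sqrt; last by apply: mulr_ge0; lra.
by rewrite ler_pM2l//; lra.
Qed.

(** The whole width of a dead column is free for the block (a, b). If row [b] is empty as well,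
    filling the block is an outright gain. Otherwise the proportionality of [maximal_split], applied
    with that width, would give the block a positive share of the row, whereas it has none. *)
Lemma no_dead_column a b : normalized m n w x y ->
  (forall i, (1 <= i <= m)%N -> 0 < ds i) -> (forall j, (1 <= j <= n)%N -> 0 < dt j) ->
  is_block m n a b -> 0 < w a b ->
  (forall j, ~~ act a j) -> (forall i j, act i j -> cmp_block i j a b) -> False.
Proof.
move=> nm ds0 dt0 ab wab dead cmp.
have am : (1 <= a <= m)%N by case/and4P: ab => -> ->.
have bn : (1 <= b <= n)%N by case/and4P: ab => _ _ -> ->.
have [[xy0 xs ys ch] _] := mx.
have xa j : x a j = 0 by have [] := nm _ _ (dead j).
have ya j : y a j = 0 by have [] := nm _ _ (dead j).
have cmp' i j : x i j * y i j != 0 -> cmp_block i j a b.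
  move=> h; apply: cmp; apply/negPn/negP => /nm[xij _].
  by move: h; rewrite xij mul0r eqxx.
have sx : \sum_(1 <= j < n.+1) x a j = 0 by rewrite big1.
have [[k ak]|nr] := pselect (exists k, act k b); last first.
  have yb : \sum_(1 <= i < m.+1) y i b = 0.
    rewrite big1// => i _; have [] // := nm i b.
    by apply/negP => aib; apply: nr; exists i.
  have dsa := ds0 a am; have dtb := dt0 b bn.
  have : Num.max 0 (w a b) * Num.sqrt (ds a * dt b) <= gain w x y a b.
    apply: (maximal_upd mx ab) => //; [exact: ltW|exact: ltW| |].
    - by rewrite sx xa; lra.
    - by rewrite yb ya; lra.
  rewrite /gain xa mul0r sqrtr0 mulr0 (max_r (ltW wab)).
  by apply/negP; rewrite -ltNge mulr_gt0// sqrtr_gt0 mulr_gt0.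
case/and4P: (ak) => kb wk xk yk.
have ka : k != a by apply: contraL ak => /eqP->; exact: dead.
(* Here [X] is the full width [ds a], although [x a b] is 0; this is allowed since [y a b] is 0. *)
have := @maximal_split _ m n ds dt w x y mx k a b (ds a) kb ab ka wk wab xk (ds0 a am) yk.
rewrite ya !mulr0 xa sx => /(_ erefl) H.
have : 0 = w a b ^+ 2 * ds a * y k b by apply: H => //; lra.
by apply/eqP; rewrite lt_eqF// !mulr_gt0// ?exprn_gt0// ds0.
Qed.

(** The polynomial factors as [(1 - r) * (1 + r / 2)], so its square is [1 - r] times a factor that
    is at most 1. *)
Lemma sqrt1B_ge (r : R) : 0 <= r -> r <= 1 -> 1 - r / 2 - r ^+ 2 / 2 <= Num.sqrt (1 - r).
Proof.
move=> r0 r1; apply: le_trans (ler_norm _) _; rewrite -sqrtr_sqr ler_sqrt; last first.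
  lra.
have -> : (1 - r / 2 - r ^+ 2 / 2) ^+ 2 = (1 - r) * ((1 - r) * (1 + r / 2) ^+ 2) by field.
rewrite -[leRHS]mulr1 ler_wpM2l ?subr_ge0//.
have : 0 <= r ^+ 2 by rewrite sqr_ge0.
have : 0 <= r ^+ 3 by rewrite exprn_ge0.
have -> : (1 - r) * (1 + r / 2) ^+ 2 = 1 - r ^+ 2 * (3 / 4) - r ^+ 3 / 4 by field.
lra.
Qed.

(** To first order, losing the fraction [r] of [X] costs the fraction [r / 2] of the root; the
    factor [1 + r] covers the remainder. *)
Lemma sqrt_drop (X r : R) : 0 < X -> 0 <= r -> r <= 1 ->
  Num.sqrt X - Num.sqrt (X - X * r) <= Num.sqrt X * (r / 2 * (1 + r)).
Proof.
move=> X0 r0 r1; have -> : X - X * r = X * (1 - r) by ring.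
rewrite (sqrtrM _ (ltW X0)); have := sqrt1B_ge r0 r1.
have : 0 < Num.sqrt X by rewrite sqrtr_gt0.
set s := Num.sqrt X => s0 h.
have -> : s - s * Num.sqrt (1 - r) = s * (1 - Num.sqrt (1 - r)) by ring.
rewrite ler_pM2l//.
by have -> : r / 2 * (1 + r) = r / 2 + r ^+ 2 / 2; [field|lra].
Qed.

(* First order optimality under moving [s]-length from block (i1, j1) and
   [t]-length from block (i2, j2) to the corner block (i1, j2). *)
Lemma maximal_exchange i1 j1 i2 j2 : act i1 j1 -> act i2 j2 ->
  (i1 < i2)%N -> (j1 < j2)%N -> 0 < w i1 j2 -> x i1 j2 = 0 -> y i1 j2 = 0 ->
  (forall i j, x i j * y i j != 0 -> cmp_block i j i1 j2) ->
  w i1 j2 ^+ 2 <= (w i1 j1 * Num.sqrt (y i1 j1 / x i1 j1)) *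
                  (w i2 j2 * Num.sqrt (x i2 j2 / y i2 j2)).
Proof.
move=> aA aB i12 j12 wC xC yC cmpC.
case/and4P: (aA) => bA wA xA yA; case/and4P: (aB) => bB wB xB yB.
have bC : is_block m n i1 j2.
  by case/and4P: bA => h1 h2 _ _; case/and4P: bB => _ _ h3 h4; apply/and4P.
(* [P / 2] and [Q / 2] are the marginal gains of horizontal length in (i1, j1) and of vertical
   length in (i2, j2). *)
set P := w i1 j1 * _; set Q := w i2 j2 * _.
have P0 : 0 < P by rewrite mulr_gt0// sqrtr_gt0 divr_gt0.
have Q0 : 0 < Q by rewrite mulr_gt0// sqrtr_gt0 divr_gt0.
set T := Num.sqrt (P * Q).
have T0 : 0 < T by rewrite sqrtr_gt0 mulr_gt0.
have T2 : T ^+ 2 = P * Q by rewrite sqr_sqrtr// mulr_ge0// ltW.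
have [[xy0 xs ys ch] Hmax] := mx.
(* The factor [1 + eta] absorbs the second order terms; [eta] is then sent to 0. *)
suff key eta : 0 < eta -> eta < 1 -> w i1 j2 * T <= T ^+ 2 * (1 + eta).
  rewrite -T2 ler_sqr ?nnegrE; [|exact: ltW|exact: ltW].
  apply/ler_addgt0Pr => e e0.
  pose eta := Num.min (e / T) (1 / 2).
  have eta0 : 0 < eta by rewrite lt_min divr_gt0//=; lra.
  have eta1 : eta < 1 by rewrite gt_min; apply/orP; right; lra.
  have := key eta eta0 eta1; move=> h.
  rewrite -(ler_pM2r T0); apply: le_trans h _.
  have -> : (T + e) * T = T ^+ 2 * (1 + e / T) by field; rewrite lt0r_neq0.
  by rewrite ler_pM2l ?exprn_gt0// lerD2l ge_min lexx.
move=> eta0 eta1.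
(* Moving the lengths [eps * Q] and [eps * P] makes both losses about [eps * P * Q / 2], against the
   gain [w i1 j2 * eps * T]. The minimum keeps the relative changes [r] and [r'] below [eta]. *)
pose eps := eta * Num.min (x i1 j1 / Q) (y i2 j2 / P).
have eps0 : 0 < eps by rewrite mulr_gt0// lt_min !divr_gt0.
pose d := eps * Q; pose d' := eps * P.
have d0 : 0 < d by rewrite mulr_gt0.
have d'0 : 0 < d' by rewrite mulr_gt0.
pose r := d / x i1 j1; pose r' := d' / y i2 j2.
have rE : d = x i1 j1 * r by rewrite /r mulrC divfK// lt0r_neq0.
have rE' : d' = y i2 j2 * r' by rewrite /r' mulrC divfK// lt0r_neq0.
have r0 : 0 < r by rewrite divr_gt0.
have r'0 : 0 < r' by rewrite divr_gt0.
have re : r <= eta.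
  rewrite ler_pdivrMr// /d /eps -mulrA ler_pM2l// -ler_pdivlMr//.
  by rewrite ge_min lexx.
have re' : r' <= eta.
  rewrite ler_pdivrMr// /d' /eps -mulrA ler_pM2l// -ler_pdivlMr//.
  by rewrite ge_min lexx orbT.
have dx : d <= x i1 j1 by rewrite rE -[leRHS]mulr1 ler_pM2l//; lra.
have dy : d' <= y i2 j2 by rewrite rE' -[leRHS]mulr1 ler_pM2l//; lra.
have nAB : (i1, j1) != (i2, j2) by rewrite xpair_eqE ltn_eqF.
have nAC : (i1, j1) != (i1, j2) by rewrite xpair_eqE (ltn_eqF j12) andbF.
have nBC : (i2, j2) != (i1, j2) by rewrite xpair_eqE (gtn_eqF i12).
have mA1 : (1 <= i1 <= m)%N by case/and4P: bA => -> ->.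
have mB2 : (1 <= j2 <= n)%N by case/and4P: bB => _ _ -> ->.
have mA2 : (1 <= j1 <= n)%N by case/and4P: bA => _ _ -> ->.
have mB1 : (1 <= i2 <= m)%N by case/and4P: bB => -> ->.
have cA i j : x i j * y i j != 0 -> cmp_block i j i1 j1.
  by move=> h; apply: ch => //; exact: active_neq0.
have cB i j : x i j * y i j != 0 -> cmp_block i j i2 j2.
  by move=> h; apply: ch => //; exact: active_neq0.
(* Both donors are reduced before the corner block is filled, so that every intermediate allocation
   is feasible. *)
have f1 : feasible m n ds dt (upd x i1 j1 (x i1 j1 - d)) (upd y i1 j1 (y i1 j1)).
  apply: feasible_upd => //; [lra|exact: ltW| |rewrite subrK; exact: ys].
  by have := xs i1 mA1; lra.
set x1 := upd x _ _ _ in f1; set y1 := upd y _ _ _ in f1.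
have v1 : value m n w x1 y1 = value m n w x y + (w i1 j1 * Num.sqrt ((x i1 j1 - d) * y i1 j1) - w i1 j1 * Num.sqrt (x i1 j1 * y i1 j1)).
  by rewrite value_upd// /gain (max_r (ltW wA)).
have x1o i j : (i, j) != (i1, j1) -> x1 i j = x i j by exact: upd_other.
have x1A : x1 i1 j1 = x i1 j1 - d by rewrite /x1 upd_same.
have y1o i j : y1 i j = y i j.
  by rewrite /y1 /upd; case: ifP => // /andP[/eqP-> /eqP->].
have s1 : \sum_(1 <= j < n.+1) x1 i1 j = \sum_(1 <= j < n.+1) x i1 j - d.
  rewrite (@sum_change _ (x i1) (x1 i1) j1)//; first by rewrite x1A; ring.
  by move=> j jj; rewrite x1o// xpair_eqE eqxx.
clearbody x1 y1.
have c1 i j : x1 i j * y1 i j != 0 -> x i j * y i j != 0.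
  rewrite y1o; have [[-> ->] _|/eqP h] := pselect ((i, j) = (i1, j1)); first exact: active_neq0.
  by rewrite x1o.
have f2 : feasible m n ds dt (upd x1 i2 j2 (x i2 j2)) (upd y1 i2 j2 (y i2 j2 - d')).
  apply: feasible_upd => //; [exact: ltW|lra| | |].
  - by rewrite x1o 1?eq_sym// subrK; case: f1 => _ + _ _; apply.
  - under eq_bigr do rewrite y1o.
    by rewrite y1o; have := ys j2 mB2; lra.
  - by move=> _ i j /c1; exact: cB.
set x2 := upd x1 _ _ _ in f2; set y2 := upd y1 _ _ _ in f2.
have v2 : value m n w x2 y2 = value m n w x1 y1 + (w i2 j2 * Num.sqrt (x i2 j2 * (y i2 j2 - d')) - w i2 j2 * Num.sqrt (x i2 j2 * y i2 j2)).
  by rewrite value_upd// /gain (max_r (ltW wB)) x1o 1?eq_sym// y1o.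
have x2o i j : x2 i j = x1 i j.
  rewrite /x2 /upd; case: ifP => // /andP[/eqP-> /eqP->].
  by rewrite x1o// eq_sym.
have y2o i j : (i, j) != (i2, j2) -> y2 i j = y1 i j by exact: upd_other.
have y2B : y2 i2 j2 = y i2 j2 - d' by rewrite /y2 upd_same.
have s2 : \sum_(1 <= i < m.+1) y2 i j2 = \sum_(1 <= i < m.+1) y i j2 - d'.
  rewrite (@sum_change _ (y^~ j2) (y2^~ j2) i2)//; first by rewrite y2B; ring.
  by move=> i ii; rewrite y2o ?y1o// xpair_eqE (negbTE ii).
clearbody x2 y2.
have c2 i j : x2 i j * y2 i j != 0 -> x i j * y i j != 0.
  rewrite x2o; have [[-> ->] _|/eqP h] := pselect ((i, j) = (i2, j2)); first exact: active_neq0.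
  by rewrite y2o// => /c1.
have f3 : feasible m n ds dt (upd x2 i1 j2 d) (upd y2 i1 j2 d').
  apply: feasible_upd => //; [exact: ltW|exact: ltW| | |].
  - under eq_bigr do rewrite x2o.
    rewrite s1 x2o x1o 1?eq_sym// xC; have := xs i1 mA1; lra.
  - by rewrite s2 y2o 1?eq_sym// y1o yC; have := ys j2 mB2; lra.
  - by move=> _ i j /c2; exact: cmpC.
have := Hmax _ _ f3; rewrite value_upd// v2 v1 /gain.
rewrite x2o x1o 1?eq_sym// xC mul0r sqrtr0 mulr0 (max_r (ltW wC)).
have -> : Num.sqrt (d * d') = eps * T.
  have -> : d * d' = eps ^+ 2 * (P * Q) by rewrite /d /d'; ring.
  by rewrite sqrtrM ?sqr_ge0// sqrtr_sqr gtr0_norm.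
have drop1 := sqrt_drop xA (ltW r0) (le_trans re (ltW eta1)).
have drop2 := sqrt_drop yB (ltW r'0) (le_trans re' (ltW eta1)).
rewrite -rE in drop1; rewrite -rE' in drop2.
have xd0 : 0 <= x i1 j1 - d by lra.
rewrite (sqrtrM _ xd0) !(sqrtrM _ (ltW xA)) !(sqrtrM _ (ltW xB)).
have L1 : w i1 j1 * (Num.sqrt (x i1 j1) * Num.sqrt (y i1 j1)) -
   w i1 j1 * (Num.sqrt (x i1 j1 - d) * Num.sqrt (y i1 j1)) <= d / 2 * P * (1 + eta).
  have -> : d / 2 * P * (1 + eta) = w i1 j1 * Num.sqrt (y i1 j1) * (Num.sqrt (x i1 j1) * (r / 2 * (1 + eta))).
    rewrite /P {1}rE sqrtrM ?ltW// sqrtrV ?ltW//.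
    rewrite -{1}(sqr_sqrtr (ltW xA)); field.
    by rewrite lt0r_neq0// sqrtr_gt0.
  have -> : w i1 j1 * (Num.sqrt (x i1 j1) * Num.sqrt (y i1 j1)) -
   w i1 j1 * (Num.sqrt (x i1 j1 - d) * Num.sqrt (y i1 j1)) =
   w i1 j1 * Num.sqrt (y i1 j1) * (Num.sqrt (x i1 j1) - Num.sqrt (x i1 j1 - d)) by ring.
  rewrite ler_pM2l; last by rewrite mulr_gt0// sqrtr_gt0.
  apply: le_trans drop1 _; rewrite ler_pM2l ?sqrtr_gt0// ler_pM2l; lra.
have L2 : w i2 j2 * (Num.sqrt (x i2 j2) * Num.sqrt (y i2 j2)) -
   w i2 j2 * (Num.sqrt (x i2 j2) * Num.sqrt (y i2 j2 - d')) <= d' / 2 * Q * (1 + eta).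
  have -> : d' / 2 * Q * (1 + eta) = w i2 j2 * Num.sqrt (x i2 j2) * (Num.sqrt (y i2 j2) * (r' / 2 * (1 + eta))).
    rewrite /Q {1}rE' sqrtrM ?ltW// sqrtrV ?ltW//.
    rewrite -{1}(sqr_sqrtr (ltW yB)); field.
    by rewrite lt0r_neq0// sqrtr_gt0.
  have -> : w i2 j2 * (Num.sqrt (x i2 j2) * Num.sqrt (y i2 j2)) -
   w i2 j2 * (Num.sqrt (x i2 j2) * Num.sqrt (y i2 j2 - d')) =
   w i2 j2 * Num.sqrt (x i2 j2) * (Num.sqrt (y i2 j2) - Num.sqrt (y i2 j2 - d')) by ring.
  rewrite ler_pM2l; last by rewrite mulr_gt0// sqrtr_gt0.
  apply: le_trans drop2 _; rewrite ler_pM2l ?sqrtr_gt0// ler_pM2l; lra.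
have -> : w i1 j2 * (eps * T) = eps * (w i1 j2 * T) by ring.
move=> Hf.
have E1 : d / 2 * P * (1 + eta) + d' / 2 * Q * (1 + eta) = eps * (T ^+ 2 * (1 + eta)).
  by rewrite T2 /d /d'; field.
rewrite -(ler_pM2l eps0); lra.
Qed.

End Maximal.
End Allocation2.

Lemma continuous_mul (R : realType) (T : topologicalType) (F G : T -> R) :
  continuous F -> continuous G -> continuous (fun f => F f * G f).
Proof. by move=> cF cG f; apply: cvgM; [exact: cF|exact: cG]. Qed.

Lemma continuous_cmul (R : realType) (T : topologicalType) (c : R) (G : T -> R) :
  continuous G -> continuous (fun f => c * G f).
Proof. by move=> cG f; apply: cvgM; [exact: cvg_cst|exact: cG]. Qed.

(** * Existence of a maximal allocation *)

Section Existence.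
Context {R : realType}.
Variables (m n : nat) (ds dt : nat -> R) (w : nat -> nat -> R).
Hypothesis ds1 : forall i, (1 <= i <= m)%N -> 0 <= ds i <= 1.
Hypothesis dt1 : forall j, (1 <= j <= n)%N -> 0 <= dt j <= 1.

(** An allocation is one point of a product of lines, the boolean selecting [x] or [y]. There are
    infinitely many indices, so compactness comes from Tychonoff's theorem. *)
Let I := (nat * nat * bool)%type.
Let T : topologicalType := prod_topology (fun _ : I => R).
Let X (f : T) i j := f (i, j, true).
Let Y (f : T) i j := f (i, j, false).

Let X_cont i j : continuous (fun f : T => X f i j).
Proof. exact: (@proj_continuous I (fun=> R) (i, j, true)). Qed.
Let Y_cont i j : continuous (fun f : T => Y f i j).
Proof. exact: (@proj_continuous I (fun=> R) (i, j, false)). Qed.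

Let sum_cont (a b : nat) (F : nat -> T -> R) : (forall i, continuous (F i)) ->
  continuous (fun f => \sum_(a <= i < b) F i f).
Proof.
move=> cF; apply: (@continuous_big _ _ +%R 0) => // x; exact: add_continuous.
Qed.

Let closed_le (F : T -> R) c : continuous F -> closed [set f | F f <= c].
Proof.
move=> cF; have -> : [set f | F f <= c] = F @^-1` [set z | z <= c] by [].
by apply: closed_comp => // f _; exact: cF.
Qed.

Let K : set T := [set f | (forall k, f k \in `[0, 1]) /\ feasible m n ds dt (X f) (Y f)].

(** The chain condition is closed: it says that for two incomparable blocks the product of their
    four entries vanishes ([S3]). *)
Lemma K_compact : compact K.
Proof.
have cT : compact [set f : T | forall k, `[0, 1]%classic (f k)].
  by apply: (@tychonoff I (fun=> R) (fun=> `[0, 1]%classic)) => _; exact: segment_compact.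
pose S1 := \bigcap_(i in [set i | (1 <= i <= m)%N]) [set f : T | \sum_(1 <= j < n.+1) X f i j <= ds i].
pose S2 := \bigcap_(j in [set j | (1 <= j <= n)%N]) [set f : T | \sum_(1 <= i < m.+1) Y f i j <= dt j].
pose S3 := \bigcap_(p in [set p : nat * nat * (nat * nat) | ~~ cmp_block p.1.1 p.1.2 p.2.1 p.2.2])
  [set f : T | X f p.1.1 p.1.2 * Y f p.1.1 p.1.2 * (X f p.2.1 p.2.2 * Y f p.2.1 p.2.2) = 0].
have -> : K = (S1 `&` S2 `&` S3) `&` [set f : T | forall k, `[0, 1]%classic (f k)].
  apply/seteqP; split=> f.
    move=> [fk [xy0 xs ys ch]]; split; last by move=> k; exact: fk.
    split; first by split=> [i /= im|j /= jn]; [exact: xs|exact: ys].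
    move=> [[i j] [i' j']] /= nc; apply/eqP/negPn/negP.
    by rewrite mulf_eq0 negb_or => /andP[h1 h2]; move: nc; rewrite ch.
  move=> [[[h1 h2] h3] fk]; split; first by move=> k; exact: fk.
  split.
  - by move=> i j; have := fk (i, j, true); have := fk (i, j, false); rewrite /= !in_itv/= => /andP[? _] /andP[? _].
  - by move=> i im; exact: h1.
  - by move=> j jn; exact: h2.
  - move=> i j i' j' p1 p2; apply/negPn/negP => nc.
    have /eqP := h3 ((i, j), (i', j')) nc.
    by rewrite /= mulf_eq0 (negbTE p1) (negbTE p2).
rewrite setIC; apply: compact_closedI => //.
apply: closedI; first apply: closedI.
- apply: closed_bigI => i _; apply: closed_le; apply: sum_cont => j; exact: X_cont.
- apply: closed_bigI => i _; apply: closed_le; apply: sum_cont => j; exact: Y_cont.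
- apply: closed_bigI => p _.
  set F := fun f : T => X f p.1.1 p.1.2 * Y f p.1.1 p.1.2 * (X f p.2.1 p.2.2 * Y f p.2.1 p.2.2).
  have -> : [set f | X f p.1.1 p.1.2 * Y f p.1.1 p.1.2 * (X f p.2.1 p.2.2 * Y f p.2.1 p.2.2) = 0] = F @^-1` [set 0] by [].
  apply: closed_comp; last exact: closed_eq.
  have cF : continuous F.
    by apply: continuous_mul; apply: continuous_mul; try exact: X_cont; exact: Y_cont.
  by move=> f _; exact: cF.
Qed.

Lemma maximal_exists : exists x y, maximal m n ds dt w x y /\ normalized m n w x y.
Proof.
pose v (f : T) := value m n w (X f) (Y f).
have cv : continuous v.
  apply: sum_cont => i; apply: sum_cont => j.
  pose F (f : T) : R := X f i j * Y f i j.
  have cF : continuous F by apply: continuous_mul; [exact: X_cont|exact: Y_cont].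
  pose G (f : T) : R := Num.sqrt (F f).
  have cG : continuous G.
    by move=> f; apply: (@continuous_comp _ _ _ F Num.sqrt); [exact: cF|exact: sqrt_continuous].
  exact: (@continuous_cmul R T (Num.max 0 (w i j)) G cG).
have K0 : K !=set0.
  exists (fun=> 0); split; first by move=> k; rewrite in_itv/= lexx ler01.
  split; rewrite /X/Y//.
  - by move=> i im; rewrite big1//; have /andP[] := ds1 im.
  - by move=> i im; rewrite big1//; have /andP[] := dt1 im.
  - by move=> i j i' j'; rewrite mul0r eqxx.
have [c cK cmax] := compact_EVT_max K0 K_compact (continuous_subspaceT cv).
rewrite inE in cK.
have Kf x y : feasible m n ds dt x y -> value m n w x y <= v c.
  move=> [xy0 xs ys ch].
  pose bl i j := is_block m n i j.
  (* [K] asks for entries in [0, 1] at all indices. Entries off the grid are unbounded but do not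
     enter the value, so they are replaced by 0. *)
  pose f : T := fun p => if bl p.1.1 p.1.2 then if p.2 then x p.1.1 p.1.2 else y p.1.1 p.1.2 else 0.
  have -> : value m n w x y = v f.
    apply: eq_big_nat => i im; apply: eq_big_nat => j jn.
    rewrite /gain /X /Y /f /= /bl /is_block.
    by case/andP: im => -> im; case/andP: jn => -> jn; rewrite -ltnS im -ltnS jn.
  apply: cmax; rewrite inE; split.
    move=> [[i j] b]; rewrite /f /=; case: ifPn => [ij|_]; last by rewrite in_itv/= lexx ler01.
    have im : (1 <= i <= m)%N by case/and4P: ij => -> ->.
    have jn : (1 <= j <= n)%N by case/and4P: ij => _ _ -> ->.
    have [x0 y0] := xy0 i j; have /andP[_ d1] := ds1 im; have /andP[_ d2] := dt1 jn.
    case: b; rewrite in_itv/= ?x0 ?y0/=.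
      apply: le_trans d1; apply: le_trans (xs _ im).
      rewrite (bigD1_seq j) ?mem_index_iota ?iota_uniq//= lerDl.
      by apply: sumr_ge0 => k _; case: (xy0 i k).
    apply: le_trans d2; apply: le_trans (ys _ jn).
    rewrite (bigD1_seq i) ?mem_index_iota ?iota_uniq//= lerDl.
    by apply: sumr_ge0 => k _; case: (xy0 k j).
  rewrite /X /Y /f /=; split.
  - by move=> i j; case: ifP => // _; exact: xy0.
  - move=> i im; apply: le_trans (xs i im); apply: ler_sum => j _.
    by case: ifP => // _; case: (xy0 i j).
  - move=> i im; apply: le_trans (ys i im); apply: ler_sum => j _.
    by case: ifP => // _; case: (xy0 j i).
  - by move=> i j i' j'; case: ifP; case: ifP => _ _; rewrite ?mul0r ?eqxx//; exact: ch.
apply: (@maximal_normalize _ m n ds dt w (X c) (Y c)).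
by split; [case: cK|exact: Kf].
Qed.

End Existence.

(** * Reparametrizations and their densities *)

Section LevelSets.
Context {R : realType}.
Implicit Types (g h : R -> R).
Local Notation mu := (@lebesgue_measure R).

(** A version of the derivative that is nonnegative everywhere and integrates back to [g] exactly;
    [derive1 g] is only controlled almost everywhere. *)
Definition density g h :=
  [/\ mu.-integrable setT (EFin \o h),
      forall x, 0 <= h x,
      forall a b, 0 <= a -> a <= b -> b <= 1 -> g b - g a = \int[mu]_(x in `]a, b]) h x &
      {ae mu, forall x, x \in `]0, 1[ -> derivable g x 1 /\ derive1 g x = h x}].

Lemma ae_itvoo (P : R -> Prop) : {ae mu, forall x, x \in `]0, 1[ -> P x} ->
  {ae mu, forall x, x \in `[0, 1] -> P x}.
Proof.
move=> H.
have H0 : {ae mu, forall x : R, x != 0}.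
  exists [set 0]; split=> //; first exact: lebesgue_measure_set1.
  by move=> x /= /negP; rewrite negbK => /eqP.
have H1 : {ae mu, forall x : R, x != 1}.
  exists [set 1]; split=> //; first exact: lebesgue_measure_set1.
  by move=> x /= /negP; rewrite negbK => /eqP.
apply: (@filterS3 _ _ (ae_filter_ringOfSetsType mu) _ _ _ _ _ H H0 H1) => x; rewrite !in_itv/= => Hx x0 x1 /andP[a0 a1].
by apply: Hx; rewrite !lt_neqAle a0 a1 eq_sym x0 x1.
Qed.

Lemma Gamma_tilde_density g : Gamma_tilde g -> exists h, density g h.
Proof.
move=> [acg _ _ _ d0]; have [h [ih hI hd]] := ac_ftc acg.
pose k x := Num.max (h x) 0; exists k.
have mh : measurable_fun setT h by move/integrableP: ih => [/measurable_EFinP].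
have hk : {ae mu, forall x, x \in `]0, 1[ -> h x = k x}.
  apply: (@filterS2 _ _ (ae_filter_ringOfSetsType mu) _ _ _ _ hd d0) => x H1 H2 x01; have [_ E] := H1 x01.
  rewrite /k max_l// -E; apply: H2; move: x01; rewrite !in_itv/= => /andP[? ?].
  by apply/andP; split; exact: ltW.
have mk : measurable_fun setT k by exact: measurable_maxr.
have ik : mu.-integrable setT (EFin \o k).
  apply: le_integrable ih => //; first exact/measurable_EFinP.
  move=> x _ /=; rewrite lee_fin /k; case: (leP (h x) 0) => // _.
  by rewrite normr0.
split=> //.
- by move=> x; rewrite /k le_max lexx orbT.
- move=> a b a0 ab b1; rewrite hI//; congr fine.
  apply: ae_eq_integral => //.
  + by apply/measurable_EFinP; exact: measurable_funTS.
  + by apply/measurable_EFinP; exact: measurable_funTS.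
  + have := ae_itvoo hk; apply: (@filterS _ _ (ae_filter_ringOfSetsType mu)) => x H /=; rewrite in_itv/= => /andP[ax xb].
    by rewrite H// in_itv/=; apply/andP; split; lra.
- apply: (@filterS2 _ _ (ae_filter_ringOfSetsType mu) _ _ _ _ hd hk) => x H1 H2 x01; have [? ?] := H1 x01.
  by rewrite -H2.
Qed.

Lemma density_mono g h : density g h -> forall a b, 0 <= a -> a <= b -> b <= 1 -> g a <= g b.
Proof.
move=> [_ h0 hI _] a b a0 ab b1; rewrite -subr_ge0 hI//.
by apply: Rintegral_ge0.
Qed.

Lemma ac_unif g : absolutely_continuous g -> forall e : R, 0 < e ->
  exists2 d : R, 0 < d & forall x y, 0 <= x -> x <= y -> y <= 1 -> y - x < d ->
    `|g y - g x| < e.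
Proof.
move=> acg e e0; have [d d0 H] := ac_list acg e0; exists d => // x y x0 xy y1 yx.
have := H [:: (x, y)]; rewrite !big_seq1/=; apply => //.
by rewrite /disjoint_family/= x0 xy y1.
Qed.

Section Level.
Variables (g h : R -> R).
Hypotheses (gG : Gamma_tilde g) (gh : density g h).

Definition preim01 (A : set R) : set R := [set x | x \in `[0, 1] /\ A (g x)].

Let g0 : g 0 = 0. Proof. by case: gG. Qed.
Let g1 : g 1 = 1. Proof. by case: gG. Qed.

Lemma density_ih A : measurable A -> mu.-integrable A (EFin \o h).
Proof. by move=> mA; case: gh => ih _ _ _; apply: integrableS ih. Qed.

Lemma preim_interval (A : set R) : is_interval A -> is_interval (preim01 A).
Proof.
move=> iA x y [x01 Ax] [y01 Ay] z /andP[xz zy].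
move: x01 y01; rewrite !in_itv/= => /andP[x0 x1] /andP[y0 y1].
split; first by rewrite in_itv/=; apply/andP; split; lra.
by apply: (iA (g x) (g y)) => //; rewrite !(density_mono gh)//; lra.
Qed.

Lemma measurable_preim (A : set R) : is_interval A -> measurable (preim01 A).
Proof. by move=> iA; apply: is_interval_measurable; exact: preim_interval. Qed.

Lemma Rint_subset (A B : set R) : measurable A -> measurable B -> A `<=` B ->
  \int[mu]_(x in A) h x <= \int[mu]_(x in B) h x.
Proof.
move=> mA mB AB; rewrite /Rintegral fine_le//.
- by apply: integrable_fin_num => //; exact: density_ih.
- by apply: integrable_fin_num => //; exact: density_ih.
- apply: ge0_subset_integral => //; last by move=> x _; rewrite lee_fin; case: gh.
  by apply: measurable_int; exact: density_ih.
Qed.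

Lemma Rint_co a : 0 <= a -> a <= 1 -> \int[mu]_(x in `[0, a[) h x = g a.
Proof.
move=> a0 a1; case: gh => _ _ hI _; have := hI 0 a (lexx _) a0 a1; rewrite g0 subr0 => ->.
rewrite [LHS](@Rintegral_itv_bndo_bndc R (BLeft 0) a h); last exact: density_ih.
by rewrite [RHS](@Rintegral_itv_obnd_cbnd R 0 (BRight a) h)//; exact: density_ih.
Qed.

Lemma Rint_cc a : 0 <= a -> a <= 1 -> \int[mu]_(x in `[0, a]) h x = g a.
Proof.
move=> a0 a1; rewrite -(Rint_co a0 a1).
by rewrite [RHS](@Rintegral_itv_bndo_bndc R (BLeft 0) a h)//; exact: density_ih.
Qed.

(** The set lies in [0, a] for its supremum [a], where [g a <= c] by continuity, and [h] has
    integral [g a] over [0, a]. Together with the opposite bound [level_lt] this gives the change of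
    variables without a substitution rule. *)
Lemma level_le c : 0 <= c -> \int[mu]_(x in preim01 `]-oo, c]) h x <= c.
Proof.
move=> c0; set A := preim01 _.
have A0 : A 0 by split; rewrite /= in_itv/= ?g0 ?lexx ?ler01.
have Aub : ubound A 1 by move=> x [+ _]; rewrite in_itv/= => /andP[].
have supA : has_sup A by split; [exists 0|exists 1].
pose a := sup A.
have a0 : 0 <= a by apply: (ub_le_sup supA.2).
have a1 : a <= 1 by apply: (ge_sup supA.1).
have ga : g a <= c.
  rewrite leNgt; apply/negP => ca.
  have e0 : 0 < g a - c by rewrite subr_gt0.
  have [d d0 H] := ac_unif (let: And5 p _ _ _ _ := gG in p) e0.
  have [x [x01 gx] xa] := sup_adherent d0 supA.
  move: (x01); rewrite in_itv/= => /andP[x0 x1].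
  have xla : x <= a by apply: (ub_le_sup supA.2).
  have := H x a x0 xla a1 ltac:(rewrite -/a in xa; lra).
  move: gx; rewrite /= in_itv/= => gx.
  by rewrite ltr_norml => /andP[_]; lra.
have mA : measurable A by apply: measurable_preim; exact: interval_is_interval.
apply: le_trans ga; rewrite -(Rint_cc a0 a1); apply: Rint_subset => //.
move=> x Ax; have [+ _] := Ax; rewrite /= !in_itv/= => /andP[x0 _].
by rewrite x0; apply: (ub_le_sup supA.2).
Qed.

(** The set contains [0, a[, where [a] is the first time at which [g] reaches [c]. *)
Lemma level_lt c : 0 <= c -> c <= 1 -> c <= \int[mu]_(x in preim01 `]-oo, c[) h x.
Proof.
move=> c0 c1; pose B := preim01 `[c, +oo[.
have B1 : B 1 by split; rewrite /= in_itv/= ?g1 ?lexx ?ler01 ?c1.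
have Blb : lbound B 0 by move=> x [+ _]; rewrite in_itv/= => /andP[].
have infB : has_inf B by split; [exists 1|exists 0].
pose a := inf B.
have a0 : 0 <= a by apply: (lb_le_inf infB.1).
have a1 : a <= 1 by apply: (ge_inf infB.2).
have ga : c <= g a.
  rewrite leNgt; apply/negP => ca.
  have e0 : 0 < c - g a by rewrite subr_gt0.
  have [d d0 H] := ac_unif (let: And5 p _ _ _ _ := gG in p) e0.
  have [x [x01 gx] xa] := inf_adherent d0 infB.
  move: (x01); rewrite in_itv/= => /andP[x0 x1].
  have xla : a <= x by apply: (ge_inf infB.2).
  have := H a x a0 xla x1 ltac:(rewrite -/a in xa; lra).
  move: gx; rewrite /= in_itv/= andbT => gx.
  by rewrite ltr_norml => /andP[_]; lra.
have mA : measurable (preim01 `]-oo, c[) by apply: measurable_preim; exact: interval_is_interval.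
apply: (le_trans ga); rewrite -(Rint_co a0 a1); apply: Rint_subset => //.
move=> x; rewrite /= !in_itv/= => /andP[x0 xa]; split; first by rewrite in_itv/= x0; lra.
rewrite /= in_itv/= ltNge; apply/negP => cx.
have : B x by split; rewrite /= in_itv/= ?x0 ?cx//; lra.
by move/(ge_inf infB.2); rewrite -/a; lra.
Qed.

Lemma level_ltE c : 0 <= c -> c <= 1 -> \int[mu]_(x in preim01 `]-oo, c[) h x = c.
Proof.
move=> c0 c1; apply/le_anti; rewrite level_lt// andbT.
apply: le_trans (level_le c0); apply: Rint_subset.
- by apply: measurable_preim; exact: interval_is_interval.
- by apply: measurable_preim; exact: interval_is_interval.
- by move=> x [x01]; rewrite /= !in_itv/= => /ltW ?; split => //; rewrite /= in_itv.
Qed.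

Lemma level_leE c : 0 <= c -> c <= 1 -> \int[mu]_(x in preim01 `]-oo, c]) h x = c.
Proof.
move=> c0 c1; apply/le_anti; rewrite level_le//=.
apply: (le_trans (level_lt c0 c1)); apply: Rint_subset.
- by apply: measurable_preim; exact: interval_is_interval.
- by apply: measurable_preim; exact: interval_is_interval.
- by move=> x [x01]; rewrite /= !in_itv/= => /ltW ?; split => //; rewrite /= in_itv.
Qed.

Lemma mpre (i : interval R) : measurable (preim01 [set` i]).
Proof. by apply: measurable_preim; exact: interval_is_interval. Qed.

Lemma level_oo c d : 0 <= c -> c < d -> d <= 1 ->
  \int[mu]_(x in preim01 `]c, d[) h x = d - c.
Proof.
move=> c0 cd d1.
have dE : preim01 `]-oo, d[ = preim01 `]-oo, c] `|` preim01 `]c, d[.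
  apply/seteqP; split=> x; rewrite /preim01/= !in_itv/=.
    by move=> [x01 gd]; have [gc|gc] := leP (g x) c; [left|right].
  by move=> [[x01 gc]|[x01 /andP[_ gd]]]; split => //; lra.
have := @Rintegral_setU _ _ R mu (preim01 `]-oo, c]) (preim01 `]c, d[) h (mpre _) (mpre _).
rewrite -dE level_ltE//; [|lra].
rewrite level_leE//; last lra.
move=> H; suff : d = c + \int[mu]_(x in preim01 `]c, d[) h x by lra.
apply: H; first by apply: density_ih; exact: mpre.
by apply/disj_setPS => x [] [_] /=; rewrite in_itv/= => h1 [_]; rewrite /= in_itv/= => /andP[h2 _]; lra.
Qed.

(** The preimages of ]-oo, c] and of ]-oo, c[ carry the same integral of [h >= 0], so [h] vanishes
    almost everywhere on the difference. *)
Lemma level_eq0 c : 0 <= c -> c <= 1 ->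
  {ae mu, forall x, x \in `[0, 1] -> g x = c -> h x = 0}.
Proof.
move=> c0 c1.
have dE : preim01 `]-oo, c] = preim01 `]-oo, c[ `|` preim01 [set c].
  apply/seteqP; split=> x; rewrite /preim01/= !in_itv/=.
    by move=> [x01]; rewrite le_eqVlt => /orP[/eqP gc|gc]; [right|left].
  by move=> [[x01 /ltW]|[x01 ->]].
have mc : measurable (preim01 [set c]).
  by rewrite -set_itv1; exact: mpre.
have := @Rintegral_setU _ _ R mu (preim01 `]-oo, c[) (preim01 [set c]) h (mpre _) mc.
rewrite -dE level_ltE// level_leE// => H.
have I0 : \int[mu]_(x in preim01 [set c]) h x = 0.
  have : c = c + \int[mu]_(x in preim01 [set c]) h x; last by lra.
  apply: H; first by apply: density_ih; exact: mpre.
  by apply/disj_setPS => x [] [_] /=; rewrite in_itv/= => h1 [_]; rewrite /= => h2; lra.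
have : (\int[mu]_(x in preim01 [set c]) `|(EFin \o h) x| = 0)%E.
  transitivity (\int[mu]_(x in preim01 [set c]) (h x)%:E)%E.
    by apply: eq_integral => x _ /=; rewrite ger0_norm//; case: gh.
  rewrite -[LHS]fineK; first by rewrite -[fine _]/(\int[mu]_(x in preim01 [set c]) h x) I0.
  by apply: integrable_fin_num => //; exact: density_ih.
move/(ae_eq_integral_abs mu mc (measurable_int _ (density_ih mc))).
by apply: (@filterS _ _ (ae_filter_ringOfSetsType mu)) => x H1 x01 gx; have := H1 (conj x01 gx) => -[].
Qed.

End Level.
End LevelSets.

Section AeIntegral.
Context d (T : measurableType d) (R : realType) (mu : {measure set T -> \bar R}).

Import HBNNSimple.

Let nnint (f : T -> \bar R) :=
  ereal_sup [set sintegral mu h | h in [set h : {nnsfun T >-> R} | forall x, ((h x)%:E <= f x)%E]].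

(** A simple function below [f1], cut off on a null set containing all points where [f1] and [f2]
    differ, lies below [f2] and keeps its integral. *)
Let nnintegral_ae_le (f1 f2 : T -> \bar R) :
  (forall x, 0 <= f2 x)%E -> {ae mu, forall x, f1 x = f2 x} ->
  (nnint f1 <= nnint f2)%E.
Proof.
move=> f20 [N [mN N0 H]].
apply: ge_ereal_sup => _ [h hf <-].
have mNc : measurable (~` N) by exact: measurableC.
pose h' := proj_nnsfun h mNc.
have -> : sintegral mu h = sintegral mu h'.
  rewrite -!integralT_nnsfun; apply: ge0_ae_eq_integral => //.
  - by apply/measurable_EFinP.
  - by apply/measurable_EFinP.
  - by move=> x _; rewrite lee_fin.
  - by move=> x _; rewrite lee_fin.
  - exists N; split=> // x /= hx; apply: contrapT => Nx; apply: hx => _.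
    by rewrite /h' /= /proj_nnsfun/= mindicE mem_set ?mulr1.
apply: ereal_sup_ubound; exists h' => //= x.
rewrite /h' /= mindicE; have [xN|xN] := boolP (x \in ~` N); last by rewrite mulr0.
rewrite mulr1; rewrite inE in xN; have <- : f1 x = f2 x; last exact: hf.
by apply: contrapT => ?; apply: xN; exact: H.
Qed.

(* No measurability: the integral of a nonnegative function is a supremum over
   the simple functions below it. *)
Lemma ae_eq_nnintegral (D : set T) (f1 f2 : T -> \bar R) :
  (forall x, 0 <= f1 x)%E -> (forall x, 0 <= f2 x)%E ->
  {ae mu, forall x, D x -> f1 x = f2 x} ->
  (\int[mu]_(x in D) f1 x = \int[mu]_(x in D) f2 x)%E.
Proof.
move=> f10 f20 H.
have p0 (f : T -> \bar R) : (forall x, 0 <= f x)%E -> forall x, (0 <= (f \_ D) x)%E.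
  by move=> f0 x; rewrite patchE; case: ifP.
rewrite !ge0_integralE//; apply/eqP; rewrite eq_le; apply/andP; split.
  apply: nnintegral_ae_le; first exact: p0.
  apply: (@filterS _ _ (ae_filter_ringOfSetsType mu)) H => x Hx.
  by rewrite !patchE; case: ifPn => // /[!inE] /Hx.
apply: nnintegral_ae_le; first exact: p0.
apply: (@filterS _ _ (ae_filter_ringOfSetsType mu)) H => x Hx.
by rewrite !patchE; case: ifPn => // /[!inE] /Hx.
Qed.

End AeIntegral.

(** * The correlation of two curves *)

Section Dot.
Context {R : realType} {N : nat}.
Implicit Types a b c : 'rV[R]_N.

Lemma dotC a b : dot a b = dot b a.
Proof. by apply: eq_bigr => i _; rewrite mulrC. Qed.
Lemma dotDl a b c : dot (a + b) c = dot a c + dot b c.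
Proof. by rewrite -big_split/=; apply: eq_bigr => i _; rewrite mxE mulrDl. Qed.
Lemma dotZl (k : R) a b : dot (k *: a) b = k * dot a b.
Proof. by rewrite mulr_sumr; apply: eq_bigr => i _; rewrite mxE mulrA. Qed.
Lemma dotDr a b c : dot c (a + b) = dot c a + dot c b.
Proof. by rewrite dotC dotDl !(dotC c). Qed.
Lemma dotZr (k : R) a b : dot a (k *: b) = k * dot a b.
Proof. by rewrite dotC dotZl dotC. Qed.
Lemma dotNl a b : dot (- a) b = - dot a b.
Proof. by rewrite -scaleN1r dotZl mulN1r. Qed.
Lemma dotNr a b : dot a (- b) = - dot a b.
Proof. by rewrite dotC dotNl dotC. Qed.
Lemma dot0l a : dot 0 a = 0.
Proof. by rewrite -(scale0r a) dotZl mul0r. Qed.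
Lemma dot_ge0 a : 0 <= dot a a.
Proof. by apply: sumr_ge0 => i _; rewrite -expr2 sqr_ge0. Qed.
Lemma dot_suml (r : seq nat) (F : nat -> 'rV[R]_N) b :
  dot (\sum_(i <- r) F i) b = \sum_(i <- r) dot (F i) b.
Proof. by elim: r => [|i r IH]; rewrite !(big_nil, big_cons) ?dot0l// dotDl IH. Qed.
Lemma dot_sumr (r : seq nat) (F : nat -> 'rV[R]_N) b :
  dot b (\sum_(i <- r) F i) = \sum_(i <- r) dot b (F i).
Proof. by rewrite dotC dot_suml; apply: eq_bigr => i _; rewrite dotC. Qed.
Lemma enorm_sqr a : enorm a ^+ 2 = dot a a.
Proof. by rewrite /enorm sqr_sqrtr// dot_ge0. Qed.
Lemma dotBB a b : dot (a - b) (a - b) = dot a a + dot b b - 2 * dot a b.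
Proof. by rewrite dotDl !dotDr !dotNl !dotNr (dotC b a); ring. Qed.

(** This is the nonnegativity of the squared norm of [l *: a - b]. It replaces Minkowski's
    inequality: let first [b] and then [l] tend to 0. *)
Lemma dot_weighted_le (l : R) a b : 0 < l ->
  dot (a + b) (a + b) <= (1 + l) * dot a a + (1 + l^-1) * dot b b.
Proof.
move=> l0; have := dot_ge0 (l *: a - b).
rewrite dotBB !(dotZl, dotZr) dotDl !dotDr (dotC b a) => H.
rewrite -(ler_pM2l l0).
have -> : l * ((1 + l) * dot a a + (1 + l^-1) * dot b b) =
  l * dot a a + l * l * dot a a + l * dot b b + dot b b by field; rewrite lt0r_neq0.
lra.
Qed.

End Dot.

Section Subdivision.
Context {R : realType} {N : nat}.
Variables (m : nat) (s : nat -> R).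
Hypothesis sub : subdivision 0 1 m s.

Lemma sub_lt i j : (i < j)%N -> (j <= m)%N -> s i < s j.
Proof.
case: sub => _ _ H; elim: j => // j IH; rewrite ltnS leq_eqVlt => /orP[/eqP->|ij] jm.
  exact: H.
by apply: lt_trans (IH ij (ltnW jm)) (H _ jm).
Qed.

Lemma sub_le i j : (i <= j)%N -> (j <= m)%N -> s i <= s j.
Proof. by rewrite leq_eqVlt => /orP[/eqP->//|ij] jm; exact/ltW/sub_lt. Qed.

Lemma sub_ge0 i : (i <= m)%N -> 0 <= s i.
Proof. by move=> im; case: (sub) => <- _ _; exact: sub_le. Qed.

Lemma sub_le1 i : (i <= m)%N -> s i <= 1.
Proof. by move=> im; case: (sub) => _ <- _; exact: sub_le. Qed.

Lemma sub_inj i j : (i <= m)%N -> (j <= m)%N -> s i = s j -> i = j.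
Proof.
move=> im jm; case: (ltngtP i j) => // ij e.
  by have := sub_lt ij jm; rewrite e ltxx.
by have := sub_lt ij im; rewrite e ltxx.
Qed.

Lemma sub_lt_idx i j : (i <= m)%N -> (j <= m)%N -> s i < s j -> (i < j)%N.
Proof. by move=> im jm; apply: contraTT; rewrite -leqNgt -leNgt => ji; exact: sub_le. Qed.

Lemma sub_le_idx i j : (i <= m)%N -> (j <= m)%N -> s i <= s j -> (i <= j)%N.
Proof. by move=> im jm; apply: contraTT; rewrite -ltnNge -ltNge => ji; exact: sub_lt. Qed.

Definition cell i (z : R) : bool := (s i.-1 < z) && (z < s i).

Lemma cell_exists z : 0 <= z -> z <= 1 ->
  (exists2 i, (i <= m)%N & z = s i) \/ (exists2 i, (1 <= i <= m)%N & cell i z).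
Proof.
move=> z0 z1; have [s0 sm _] := sub.
have ex : exists i, z <= s i by exists m; rewrite sm.
pose k := ex_minn ex; have [km kmin] : z <= s k /\ forall i, z <= s i -> (k <= i)%N.
  by rewrite /k; case: ex_minnP.
have kle : (k <= m)%N by apply: kmin; rewrite sm.
have [zk|nzk] := eqVneq z (s k); first by left; exists k.
have k0 : (0 < k)%N.
  rewrite lt0n; apply/eqP => k0; move: nzk km; rewrite k0 s0 => h1 h2.
  by move: h1; rewrite eq_le h2 z0.
right; exists k; first by rewrite k0.
apply/andP; split; last by rewrite lt_neqAle nzk km.
by rewrite ltNge; apply/negP => h; have := kmin _ h; lia.
Qed.

Lemma cell_uniq i j z : (1 <= i <= m)%N -> (1 <= j <= m)%N -> cell i z -> cell j z -> i = j.
Proof.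
move=> /andP[i1 im] /andP[j1 jm] /andP[h1 h2] /andP[h3 h4].
have a1 : (i.-1 < j)%N by apply: sub_lt_idx => //; [lia|lra].
have a2 : (j.-1 < i)%N by apply: sub_lt_idx => //; [lia|lra].
lia.
Qed.

Lemma cell_grid i k : (1 <= i <= m)%N -> (k <= m)%N -> cell i (s k) = false.
Proof.
move=> /andP[i1 im] km; apply/negP => /andP[h1 h2].
have a1 : (i.-1 < k)%N by apply: sub_lt_idx => //; lia.
have a2 : (k < i)%N by apply: sub_lt_idx => //; lia.
lia.
Qed.

(** A finite sum of indicators of open cells, so that measurability and inner products reduce to
    finite sums. *)
Definition pw (u : nat -> 'rV[R]_N) (z : R) : 'rV[R]_N :=
  \sum_(1 <= i < m.+1) (cell i z)%:R *: u i.

Lemma pw_cell u i z : (1 <= i <= m)%N -> cell i z -> pw u z = u i.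
Proof.
move=> im ci; rewrite /pw (bigD1_seq i) ?iota_uniq ?mem_index_iota//= ci scale1r.
rewrite big_seq_cond big1 ?addr0// => j; rewrite mem_index_iota => /andP[jm ji].
case: (boolP (cell j z)) => [cj|_]; last by rewrite scale0r.
by move: ji; rewrite (cell_uniq jm im cj ci) eqxx.
Qed.

End Subdivision.

Section PW2.
Context {R : realType} {N : nat}.
Variables (m n : nat) (s t : nat -> R) (u v : nat -> 'rV[R]_N).

Lemma dot_pw z z' : dot (pw m s u z) (pw n t v z') =
  \sum_(1 <= i < m.+1) \sum_(1 <= j < n.+1)
    weight u v i j * ((cell s i z)%:R * (cell t j z')%:R).
Proof.
rewrite /pw dot_suml; apply: eq_bigr => i _; rewrite dot_sumr; apply: eq_bigr => j _.
by rewrite dotZl dotZr /weight; ring.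
Qed.

Lemma dot_pw_diag (sub : subdivision 0 1 m s) z : dot (pw m s u z) (pw m s u z) =
  \sum_(1 <= i < m.+1) dot (u i) (u i) * (cell s i z)%:R.
Proof.
have [[i im ci]|H] := pselect (exists2 i, (1 <= i <= m)%N & cell s i z).
  rewrite (pw_cell sub _ im ci) (bigD1_seq i) ?iota_uniq ?mem_index_iota//= ci mulr1.
  rewrite big_seq_cond big1 ?addr0// => j; rewrite mem_index_iota => /andP[jm ji].
  case: (boolP (cell s j z)) => [cj|_]; last by rewrite mulr0.
  by move: ji; rewrite (cell_uniq sub jm im cj ci) eqxx.
have c0 i : (1 <= i <= m)%N -> cell s i z = false.
  by move=> im; apply/negP => ci; apply: H; exists i.
have -> : pw m s u z = 0.
  by rewrite /pw big_seq big1// => i; rewrite mem_index_iota => im; rewrite c0// scale0r.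
rewrite dot0l big_seq big1// => i; rewrite mem_index_iota => im; by rewrite c0// mulr0.
Qed.

End PW2.

Section RealIntegral.
Context {R : realType}.
Local Notation mu := (@lebesgue_measure R).
Local Notation D := (`[0, 1]%classic : set R).

Definition rint (k : R -> R) := mu.-integrable D (EFin \o k).

Let mD : measurable D. Proof. by []. Qed.

Lemma rint_meas (k : R -> R) : rint k -> measurable_fun D k.
Proof. by move/integrableP => [/measurable_EFinP]. Qed.

Lemma rintD (k l : R -> R) : rint k -> rint l -> rint (fun x => k x + l x).
Proof.
move=> hk hl; rewrite /rint (_ : EFin \o _ = (EFin \o k) \+ (EFin \o l))%E; first exact: integrableD.
by apply/funext => x.
Qed.

Lemma rintZ (c : R) (k : R -> R) : rint k -> rint (fun x => c * k x).
Proof.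
move=> hk; rewrite /rint (_ : EFin \o _ = (fun x => c%:E * (EFin \o k) x))%E; first exact: integrableZl.
by apply/funext => x.
Qed.

Lemma rint_le (k l : R -> R) : measurable_fun D k -> rint l -> (forall x, D x -> `|k x| <= l x) -> rint k.
Proof.
move=> mk il kl; apply: le_integrable il => //; first exact/measurable_EFinP.
by move=> x Dx /=; rewrite lee_fin; apply: le_trans (kl x Dx) (ler_norm _).
Qed.

Lemma rint0 : rint (fun=> 0).
Proof. exact: (@integrable0 _ _ R mu D). Qed.

Lemma RintD (k l : R -> R) : rint k -> rint l ->
  \int[mu]_(x in D) (k x + l x) = \int[mu]_(x in D) k x + \int[mu]_(x in D) l x.
Proof. by move=> hk hl; rewrite RintegralD. Qed.

Lemma RintZ (c : R) (k : R -> R) : rint k -> \int[mu]_(x in D) (c * k x) = c * \int[mu]_(x in D) k x.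
Proof. by move=> hk; rewrite RintegralZl. Qed.

Lemma Rint_sum (r : seq nat) (F : nat -> R -> R) : (forall i, rint (F i)) ->
  rint (fun x => \sum_(i <- r) F i x) /\
  \int[mu]_(x in D) (\sum_(i <- r) F i x) = \sum_(i <- r) \int[mu]_(x in D) F i x.
Proof.
move=> iF; elim: r => [|i r [IH1 IH2]].
  rewrite big_nil; under eq_fun do rewrite big_nil.
  by split; [exact: rint0|rewrite Rintegral_cst// mul0r].
rewrite big_cons; under eq_fun do rewrite big_cons.
by rewrite -IH2 -RintD//; split => //; exact: rintD.
Qed.

Lemma Rint_le (k l : R -> R) : rint k -> rint l -> (forall x, D x -> k x <= l x) ->
  \int[mu]_(x in D) k x <= \int[mu]_(x in D) l x.
Proof. by move=> hk hl kl; apply: le_Rintegral. Qed.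

Lemma Rint_indic (A : set R) (k : R -> R) : measurable A -> A `<=` D ->
  \int[mu]_(x in D) (\1_A x * k x) = \int[mu]_(x in A) k x.
Proof.
move=> mA AD; rewrite Rintegral_mkcond [RHS]Rintegral_mkcond.
congr Rintegral; apply/funext => x; rewrite !patchE indicE.
have [xA|xA] := boolP (x \in A); first by rewrite mul1r mem_set// ; apply: AD; rewrite inE in xA.
by rewrite mul0r; case: ifP.
Qed.

Lemma rint_indic (A : set R) (k : R -> R) : measurable A -> rint k -> rint (fun x => \1_A x * k x).
Proof.
move=> mA ik; apply: (@rint_le _ (fun x => `|k x|)).
- apply: measurable_funM; last exact: rint_meas.
  exact: measurable_funTS.
- by have := integrable_norm ik.
- move=> x Dx; rewrite indicE; case: (_ \in _); rewrite ?mul1r// mul0r normr0.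
  exact: normr_ge0.
Qed.

Lemma Rint_eq (k l : R -> R) : (forall x, D x -> k x = l x) ->
  \int[mu]_(x in D) k x = \int[mu]_(x in D) l x.
Proof. by move=> kl; apply: eq_Rintegral => x; rewrite inE => /kl. Qed.

Lemma rint_eq (k l : R -> R) : (forall x, D x -> k x = l x) -> rint k -> rint l.
Proof. by move=> kl; apply: (@eq_integrable _ _ R mu D mD (EFin \o k) (EFin \o l)) => x; rewrite inE => Dx /=; rewrite kl. Qed.

(* The lower bound [2 Z <= l X + Y / l], for all [l], is the arithmetic-geometric
   mean form of the Cauchy-Schwarz inequality. *)
Lemma amgm_sqrt (X Y Z : R) : 0 <= X -> 0 <= Y ->
  (forall l, 0 < l -> 2 * Z <= l * X + l^-1 * Y) -> Z <= Num.sqrt (X * Y).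
Proof.
move=> X0 Y0 H.
have [X1|X1] := eqVneq X 0.
  rewrite X1 mul0r sqrtr0; apply/ler_addgt0Pr => e e0; rewrite add0r.
  (* A large [l] is wanted, since only [Y / l] is left; this one makes it at most [e], also when [Y]
     is 0. *)
  have l0 : 0 < (Y + e) / e by apply: divr_gt0 => //; lra.
  have := H _ l0; rewrite X1 mulr0 add0r invf_div => h.
  have : e / (Y + e) * Y <= e.
    rewrite -mulrA ler_piMr//; first exact: ltW.
    by rewrite mulrC ler_pdivrMr; lra.
  lra.
have [Y1|Y1] := eqVneq Y 0.
  rewrite Y1 mulr0 sqrtr0; apply/ler_addgt0Pr => e e0; rewrite add0r.
  have l0 : 0 < e / (X + e) by apply: divr_gt0 => //; lra.
  have := H _ l0; rewrite Y1 mulr0 addr0 => h.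
  have : e / (X + e) * X <= e.
    rewrite -mulrA ler_piMr//; first exact: ltW.
    by rewrite mulrC ler_pdivrMr; lra.
  lra.
have {X1}X1 : 0 < X by rewrite lt_neqAle eq_sym X1.
have {Y1}Y1 : 0 < Y by rewrite lt_neqAle eq_sym Y1.
set p := Num.sqrt X; set q := Num.sqrt Y.
have p0 : 0 < p by rewrite sqrtr_gt0.
have q0 : 0 < q by rewrite sqrtr_gt0.
(* The minimiser of [l * X + Y / l]. *)
have := H (q / p) (divr_gt0 q0 p0).
rewrite sqrtrM// -/p -/q invf_div -{1}(sqr_sqrtr X0) -{1}(sqr_sqrtr Y0) -/p -/q.
have -> : q / p * p ^+ 2 + p / q * q ^+ 2 = 2 * (p * q).
  by field; rewrite !lt0r_neq0.
lra.
Qed.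

End RealIntegral.

Section Lift.
Context {R : realType} {N : nat}.
Local Notation mu := (@lebesgue_measure R).
Local Notation D := (`[0, 1]%classic : set R).
Variables (m : nat) (s : nat -> R) (u : nat -> 'rV[R]_N).
Hypothesis sub : subdivision 0 1 m s.
Variables (q : R -> 'rV[R]_N).
Hypothesis q_u : forall i, (1 <= i <= m)%N -> forall x, x \in `]s i.-1, s i[ -> q x = u i.
Variables (g h : R -> R).
Hypotheses (gG : Gamma_tilde g) (gh : density g h).

(* A measurable representative of [act q g]. *)
Definition act_step (x : R) : 'rV[R]_N := Num.sqrt (h x) *: pw m s u (g x).

(** The values of [q] at gridpoints are not prescribed. By [level_eq0] the density vanishes at
    almost every time spent there. *)
Lemma grid_ae : {ae mu, forall x, x \in `[0, 1] -> (exists2 k, (k <= m)%N & g x = s k) -> h x = 0}.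
Proof.
have H k : {ae mu, forall x, x \in `[0, 1] -> (k <= m)%N -> g x = s k -> h x = 0}.
  have [km|mk] := leqP k m; last first.
    by apply: (@filterE _ _ (ae_filter_ringOfSetsType mu)) => x _.
  have := level_eq0 gG gh (sub_ge0 sub km) (sub_le1 sub km).
  by apply: (@filterS _ _ (ae_filter_ringOfSetsType mu)) => x Hx x01 _; exact: Hx.
have := ae_foralln H.
apply: (@filterS _ _ (ae_filter_ringOfSetsType mu)) => x Hx x01 [k km gk].
exact: (Hx k).
Qed.

Lemma act_ae : {ae mu, forall x, x \in `[0, 1] -> act q g x = act_step x}.
Proof.
case: gh => _ _ _ /ae_itvoo H1; have H2 := grid_ae.
apply: (@filterS2 _ _ (ae_filter_ringOfSetsType mu) _ _ _ _ H1 H2) => x {}H1 {}H2 x01.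
have [_ dg] := H1 x01; rewrite /act /act_step dg.
have gx : g x \in `[0, 1] by case: gG => _ + _ _ _; apply.
move: gx; rewrite in_itv/= => /andP[g0 g1].
have [[k km gk]|[i im ci]] := cell_exists sub g0 g1.
  by rewrite H2//; [rewrite sqrtr0 !scale0r|exists k].
by rewrite (pw_cell sub _ im ci) (q_u im)// in_itv.
Qed.

Definition strip i := preim01 g `]s i.-1, s i[.

Lemma strip_sub i : strip i `<=` D. Proof. by move=> x []. Qed.
Lemma strip_meas i : measurable (strip i). Proof. exact: (mpre gh). Qed.

Lemma cell_indic i x : D x -> (cell s i (g x))%:R = \1_(strip i) x :> R.
Proof.
move=> Dx; rewrite indicE /strip /preim01; congr (_ %:R); congr nat_of_bool.
by apply/idP/idP => [c|]; rewrite inE/= in_itv/=; [split|case].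
Qed.

Lemma rint_h : rint h.
Proof. by case: gh => ih _ _ _; exact: integrableS ih. Qed.

Lemma h_meas : measurable_fun D h. Proof. exact: rint_meas rint_h. Qed.

Lemma sqrt_meas : measurable_fun D (fun x => Num.sqrt (h x)).
Proof.
apply: (@measurableT_comp _ _ _ _ _ _ (@Num.sqrt R)); last exact: h_meas.
by have := continuous_measurable_fun (@sqrt_continuous R).
Qed.

Lemma act_step_meas j : measurable_fun D (fun x => act_step x ord0 j).
Proof.
have -> : (fun x => act_step x ord0 j) = (fun x => Num.sqrt (h x) *
    \sum_(1 <= i < m.+1) (cell s i (g x))%:R * u i ord0 j).
  apply/funext => x; rewrite /act_step /pw mxE summxE.
  by congr (_ * _); apply: eq_bigr => i _; rewrite mxE.
apply: measurable_funM; first exact: sqrt_meas.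
apply: measurable_sum => i.
apply: (eq_measurable_fun (fun x => \1_(strip i) x * u i ord0 j)).
  by move=> x; rewrite inE => Dx; rewrite cell_indic.
apply: measurable_funM => //.
by apply: measurable_funTS; apply: measurable_indic; exact: strip_meas.
Qed.

Lemma dot_act_stepE x : D x -> dot (act_step x) (act_step x) =
  \sum_(1 <= i < m.+1) dot (u i) (u i) * (\1_(strip i) x * h x).
Proof.
move=> Dx; rewrite /act_step dotZl dotZr mulrA -expr2 sqr_sqrtr; last by case: gh.
rewrite dot_pw_diag// mulr_sumr; apply: eq_bigr => i _.
by rewrite cell_indic//; ring.
Qed.

(** By [level_oo] the density of the time spent in a cell integrates to the length of the cell.
    Hence reparametrization preserves the L2 norm, and the distance depends on the correlation
    alone. *)
Lemma rint_act_step : rint (fun x => dot (act_step x) (act_step x)) /\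
  \int[mu]_(x in D) dot (act_step x) (act_step x) =
  \sum_(1 <= i < m.+1) dot (u i) (u i) * (s i - s i.-1).
Proof.
have := @Rint_sum R (index_iota 1 m.+1) (fun i x => dot (u i) (u i) * (\1_(strip i) x * h x)).
case.
  by move=> i; apply: rintZ; apply: rint_indic; [exact: strip_meas|exact: rint_h].
move=> H1 H2; split.
  by apply: rint_eq H1 => x Dx; rewrite dot_act_stepE.
rewrite (Rint_eq dot_act_stepE) H2; apply: eq_big_nat => i im.
have im' : (1 <= i <= m)%N by lia.
rewrite RintZ; last by apply: rint_indic; [exact: strip_meas|exact: rint_h].
rewrite Rint_indic; [|exact: strip_meas|exact: strip_sub].
rewrite (level_oo gG gh)//.
- by apply: (sub_ge0 sub); lia.
- by apply: (sub_lt sub); lia.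
- by apply: (sub_le1 sub); lia.
Qed.

Lemma act_step_L2 : L2 act_step.
Proof.
split; first exact: act_step_meas.
have [/integrableP[_ H] _] := rint_act_step.
rewrite (_ : integral _ _ _ = \int[mu]_(x in `[0%R, 1%R]) `|(EFin \o (fun x => dot (act_step x) (act_step x))) x|)%E//.
by apply: eq_integral => x _ /=; rewrite enorm_sqr ger0_norm// dot_ge0.
Qed.

Lemma level_cc i : (1 <= i <= m)%N ->
  \int[mu]_(x in preim01 g `[s i.-1, s i]) h x = s i - s i.-1.
Proof.
move=> im; have h0 : 0 <= s i.-1 by apply: (sub_ge0 sub); lia.
have h1 : s i <= 1 by apply: (sub_le1 sub); lia.
have h2 : s i.-1 < s i by apply: (sub_lt sub); lia.
set c := s i.-1 in h0 h2 *; set d := s i in h1 h2 *.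
have dE : preim01 g `]-oo, d] = preim01 g `]-oo, c[ `|` preim01 g `[c, d].
  apply/seteqP; split=> x; rewrite /preim01/= !in_itv/=.
    by move=> [x01 gd]; have [gc|gc] := leP c (g x); [right|left].
  by move=> [[x01 gc]|[x01 /andP[_ gd]]]; split => //; lra.
have := @Rintegral_setU _ _ R mu (preim01 g `]-oo, c[) (preim01 g `[c, d]) h (mpre gh _) (mpre gh _).
rewrite -dE (level_ltE gG gh)//; [|lra].
rewrite (level_leE gG gh)//; last lra.
move=> H; suff : d = c + \int[mu]_(x in preim01 g `[c, d]) h x by lra.
apply: H; first by apply: (density_ih gh); exact: (mpre gh).
by apply/disj_setPS => x [] [_] /=; rewrite in_itv/= => H1 [_]; rewrite /= in_itv/= => /andP[H2 _]; lra.
Qed.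

End Lift.

Section L2Distance.
Context {R : realType} {N : nat}.
Local Notation mu := (@lebesgue_measure R).
Local Notation D := (`[0, 1]%classic : set R).
Implicit Types p q w : R -> 'rV[R]_N.

(** Applied to [act q g], which is not known to be measurable; this is why [ae_eq_nnintegral] is
    used. *)
Lemma L2dist_ae q q' w w' :
  {ae mu, forall x, x \in `[0, 1] -> q x = q' x} ->
  {ae mu, forall x, x \in `[0, 1] -> w x = w' x} ->
  L2dist q w = L2dist q' w'.
Proof.
move=> H1 H2; rewrite /L2dist /Rintegral; congr (Num.sqrt (fine _)).
apply: ae_eq_nnintegral => [x|x|]; [by rewrite lee_fin sqr_ge0|by rewrite lee_fin sqr_ge0|].
apply: (@filterS2 _ _ (ae_filter_ringOfSetsType mu) _ _ _ _ H1 H2) => x E1 E2 Dx.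
by rewrite E1// E2.
Qed.

Lemma L2_rint_dot q : L2 q -> rint (fun x => dot (q x) (q x)).
Proof.
move=> [mq iq]; apply/integrableP; split.
  apply/measurable_EFinP; rewrite /dot.
  by apply: measurable_sum => i; apply: measurable_funM; exact: mq.
rewrite (_ : integral _ _ _ = \int[mu]_(x in `[0%R, 1%R]) (enorm (q x) ^+ 2)%:E)%E//.
by apply: eq_integral => x _ /=; rewrite enorm_sqr ger0_norm// dot_ge0.
Qed.

Lemma dot_meas p q : L2 p -> L2 q -> measurable_fun D (fun x => dot (p x) (q x)).
Proof.
move=> [mp _] [mq _]; apply: measurable_sum => i.
by apply: measurable_funM; [exact: mp|exact: mq].
Qed.

Lemma dot_abs (a b : 'rV[R]_N) : `|dot a b| <= dot a a + dot b b.
Proof.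
have h1 := dot_ge0 a; have h2 := dot_ge0 b.
have h3 := dot_ge0 (a - b); rewrite dotBB in h3.
have h4 := dot_ge0 (a - - b); rewrite dotBB dotNr dotNl dotNr in h4.
by rewrite ler_norml; apply/andP; split; lra.
Qed.

Lemma L2_rint p q : L2 p -> L2 q -> rint (fun x => dot (p x) (q x)).
Proof.
move=> hp hq; apply: (@rint_le _ _ (fun x => dot (p x) (p x) + dot (q x) (q x))).
- exact: dot_meas.
- by apply: rintD; exact: L2_rint_dot.
- by move=> x _; exact: dot_abs.
Qed.

Lemma L2B p q : L2 p -> L2 q -> L2 (fun x => p x - q x).
Proof.
move=> hp hq; have [mp _] := hp; have [mq _] := hq.
have : rint (fun x => dot (p x - q x) (p x - q x)).
  apply: (@rint_eq _ (fun x => dot (p x) (p x) + dot (q x) (q x) + (- 2) * dot (p x) (q x))).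
    by move=> x _; rewrite dotBB; ring.
  apply: rintD; first by apply: rintD; exact: L2_rint_dot.
  by apply: rintZ; exact: L2_rint.
move=> /integrableP[_ H]; split.
  move=> i; rewrite (_ : (fun x => _) = (fun x => p x ord0 i - q x ord0 i)).
    by apply: measurable_funB; [exact: mp|exact: mq].
  by apply/funext => x; rewrite !mxE.
rewrite (_ : integral _ _ _ = \int[mu]_(x in `[0%R, 1%R]) `|(EFin \o (fun x => dot (p x - q x) (p x - q x))) x|)%E//.
by apply: eq_integral => x _ /=; rewrite enorm_sqr ger0_norm// dot_ge0.
Qed.

Lemma L2dist_sqr p q :
  L2dist p q ^+ 2 = \int[mu]_(x in D) dot (p x - q x) (p x - q x).
Proof.
rewrite /L2dist sqr_sqrtr; last by apply: Rintegral_ge0 => x _; rewrite sqr_ge0.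
by apply: Rint_eq => x _; rewrite enorm_sqr.
Qed.

Lemma L2dist_ge0 p q : 0 <= L2dist p q. Proof. exact: sqrtr_ge0. Qed.

Lemma L2dist_expand p q : L2 p -> L2 q -> L2dist p q ^+ 2 =
  \int[mu]_(x in D) dot (p x) (p x) + \int[mu]_(x in D) dot (q x) (q x)
  - 2 * \int[mu]_(x in D) dot (p x) (q x).
Proof.
move=> hp hq; rewrite L2dist_sqr.
transitivity (\int[mu]_(x in D) (dot (p x) (p x) + dot (q x) (q x) + (- 2) * dot (p x) (q x))).
  by apply: Rint_eq => x _; rewrite dotBB; ring.
have h1 := L2_rint_dot hp; have h2 := L2_rint_dot hq; have h3 := L2_rint hp hq.
by rewrite RintD ?RintD ?RintZ//; [ring|exact: rintD|exact: rintZ].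
Qed.

(** The inequality [dot_weighted_le], integrated, with [p1 - p2] written as [w1 - w2] plus the
    difference of the two errors. *)
Lemma L2dist_triangle p1 p2 w1 w2 l : L2 p1 -> L2 p2 -> L2 w1 -> L2 w2 -> 0 < l ->
  L2dist p1 p2 ^+ 2 <= (1 + l) * L2dist w1 w2 ^+ 2 +
    (1 + l^-1) * (2 * (L2dist p1 w1 ^+ 2 + L2dist p2 w2 ^+ 2)).
Proof.
move=> h1 h2 k1 k2 l0.
have subst (A B C E A' B' C' E' : R) : A = A' -> B = B' -> C = C' -> E = E' ->
    A' <= (1 + l) * B' + (1 + l^-1) * (2 * (C' + E')) ->
    A <= (1 + l) * B + (1 + l^-1) * (2 * (C + E)) by move=> -> -> -> ->.
apply: (subst _ _ _ _ _ _ _ _ (L2dist_sqr p1 p2) (L2dist_sqr w1 w2) (L2dist_sqr p1 w1) (L2dist_sqr p2 w2)).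
pose a x := dot (w1 x - w2 x) (w1 x - w2 x).
pose b x := dot (p1 x - w1 x) (p1 x - w1 x).
pose c x := dot (p2 x - w2 x) (p2 x - w2 x).
have ia : rint a by apply: (L2_rint_dot (L2B k1 k2)).
have ib : rint b by apply: (L2_rint_dot (L2B h1 k1)).
have ic : rint c by apply: (L2_rint_dot (L2B h2 k2)).
rewrite -(RintD ib ic) -(RintZ 2 (rintD ib ic)) -(RintZ _ ia).
have i2 := rintZ 2 (rintD ib ic).
rewrite -(RintZ _ i2) -RintD; [|exact: rintZ|exact: rintZ].
apply: Rint_le.
- exact: (L2_rint_dot (L2B h1 h2)).
- by apply: rintD; exact: rintZ.
move=> x _.
have -> : p1 x - p2 x = (w1 x - w2 x) + ((p1 x - w1 x) - (p2 x - w2 x)).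
  by rewrite opprB [in RHS]addrCA !addrA subrK addrAC; apply/eqP; rewrite -subr_eq0; apply/eqP/rowP => i; rewrite !mxE; ring.
apply: le_trans (dot_weighted_le _ _ l0) _.
rewrite lerD2l ler_wpM2l//; first by rewrite addr_ge0// invr_ge0 ltW.
rewrite dotBB /b /c.
have := dot_ge0 (p1 x - w1 x - - (p2 x - w2 x)).
rewrite dotBB !(dotNr, dotNl); lra.
Qed.

End L2Distance.

Section SumOverSets.
Context {R : realType}.
Local Notation mu := (@lebesgue_measure R).
Local Notation D := (`[0, 1]%classic : set R).

Lemma Rint_sub_mono (A B : set R) (k : R -> R) : measurable A -> measurable B -> A `<=` B -> B `<=` D ->
  rint k -> (forall x, 0 <= k x) -> \int[mu]_(x in A) k x <= \int[mu]_(x in B) k x.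
Proof.
move=> mA mB AB BD ik k0.
rewrite -(Rint_indic k mA (subset_trans AB BD)) -(Rint_indic k mB BD).
apply: Rint_le; [exact: rint_indic|exact: rint_indic|].
move=> x _; rewrite ler_wpM2r// !indicE ler_nat.
by case: (boolP (x \in A)) => //; rewrite inE => /AB; rewrite -in_setE => ->.
Qed.

Lemma Rint_disjoint_sum (r : seq nat) (S : nat -> set R) (B : set R) (k : R -> R) :
  uniq r -> (forall i, measurable (S i)) -> measurable B ->
  (forall i, i \in r -> S i `<=` B) -> B `<=` D ->
  (forall i j x, i \in r -> j \in r -> S i x -> S j x -> i = j) ->
  rint k -> (forall x, 0 <= k x) ->
  \sum_(i <- r) \int[mu]_(x in S i) k x <= \int[mu]_(x in B) k x.
Proof.
move=> ur mS mB SB BD dis ik k0.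
have [] := @Rint_sum R r (fun i x => \1_(S i) x * k x).
  by move=> i; apply: rint_indic.
move=> H1 H2.
rewrite (eq_big_seq (fun i => \int[mu]_(x in D) (\1_(S i) x * k x))); last first.
  by move=> i ir; rewrite Rint_indic// => x /(SB _ ir) /BD.
rewrite -H2 -(Rint_indic k mB BD); apply: Rint_le => //; first exact: rint_indic.
move=> x _; rewrite -mulr_suml ler_wpM2r//.
have [[i ir Si]|H] := pselect (exists2 i, i \in r & S i x).
  rewrite (bigD1_seq i)//= big_seq_cond big1; last first.
    move=> j /andP[jr ji]; rewrite indicE; case: (boolP (x \in S j)) => //; rewrite inE => Sj.
    by move: ji; rewrite (dis _ _ _ jr ir Sj Si) eqxx.
  by rewrite addr0 !indicE mem_set// mem_set//; exact: SB Si.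
rewrite big_seq big1; first by rewrite indicE.
move=> i ir; rewrite indicE; case: (boolP (x \in S i)) => //; rewrite inE => Si.
by exfalso; apply: H; exists i.
Qed.

(** The pointwise arithmetic-geometric mean inequality with weight [l] is integrated and then
    optimised by [amgm_sqrt]. *)
Lemma cauchy_schwarz (A : set R) (h1 h2 : R -> R) : measurable A -> A `<=` D ->
  rint h1 -> rint h2 -> (forall x, 0 <= h1 x) -> (forall x, 0 <= h2 x) ->
  rint (fun x => Num.sqrt (h1 x) * Num.sqrt (h2 x)) ->
  \int[mu]_(x in A) (Num.sqrt (h1 x) * Num.sqrt (h2 x)) <=
  Num.sqrt (\int[mu]_(x in A) h1 x * \int[mu]_(x in A) h2 x).
Proof.
move=> mA AD i1 i2 h10 h20 iK.
apply: amgm_sqrt; [by apply: Rintegral_ge0|by apply: Rintegral_ge0|].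
move=> l l0; rewrite -(Rint_indic h1 mA AD) -(Rint_indic h2 mA AD).
rewrite -(Rint_indic (fun x => Num.sqrt (h1 x) * Num.sqrt (h2 x)) mA AD).
have j1 := rint_indic mA i1; have j2 := rint_indic mA i2; have jK := rint_indic mA iK.
rewrite -!RintZ// -RintD; [|exact: rintZ|exact: rintZ].
apply: Rint_le; [exact: rintZ|by apply: rintD; exact: rintZ|].
move=> x _; rewrite !mulrA ![_ * \1_A x]mulrC -!mulrA -mulrDr.
rewrite ler_wpM2l//.
have e1 := sqr_sqrtr (h10 x); have e2 := sqr_sqrtr (h20 x).
rewrite -{2}e1 -{2}e2.
set a := Num.sqrt (h1 x); set b := Num.sqrt (h2 x).
rewrite -(ler_pM2l l0).
have -> : l * (l * a ^+ 2 + l^-1 * b ^+ 2) = (l * a) ^+ 2 + b ^+ 2 by field; rewrite lt0r_neq0.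
have := sqr_ge0 (l * a - b); rewrite sqrrB; lra.
Qed.

End SumOverSets.

Section Pair.
Context {R : realType} {N : nat}.
Local Notation mu := (@lebesgue_measure R).
Local Notation D := (`[0, 1]%classic : set R).
Variables (m n : nat) (s t : nat -> R) (u v : nat -> 'rV[R]_N).
Hypotheses (ssub : subdivision 0 1 m s) (tsub : subdivision 0 1 n t).
Variables (g1 g2 h1 h2 : R -> R).
Hypotheses (gG1 : Gamma_tilde g1) (gh1 : density g1 h1).
Hypotheses (gG2 : Gamma_tilde g2) (gh2 : density g2 h2).

Local Notation W := (weight u v).
Local Notation L1 := (act_step m s u g1 h1).
Local Notation L2' := (act_step n t v g2 h2).

Definition speed x := Num.sqrt (h1 x) * Num.sqrt (h2 x).
Definition openblock i j := strip s g1 i `&` strip t g2 j.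
Definition closedblock i j := preim01 g1 `[s i.-1, s i] `&` preim01 g2 `[t j.-1, t j].
Definition correlation := \int[mu]_(x in D) dot (L1 x) (L2' x).
Definition ds i := s i - s i.-1.
Definition dt j := t j - t j.-1.
Definition incr_s (S : nat -> nat -> set R) i j := \int[mu]_(x in S i j) h1 x.
Definition incr_t (S : nat -> nat -> set R) i j := \int[mu]_(x in S i j) h2 x.

Lemma h1_ge0 x : 0 <= h1 x. Proof. by case: gh1. Qed.
Lemma h2_ge0 x : 0 <= h2 x. Proof. by case: gh2. Qed.

Lemma speed_rint : rint speed.
Proof.
apply: (@rint_le _ _ (fun x => h1 x + h2 x)).
- by apply: measurable_funM; [exact: sqrt_meas gh1|exact: sqrt_meas gh2].
- by apply: rintD; [exact: rint_h gh1|exact: rint_h gh2].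
move=> x _; rewrite ger0_norm; last by rewrite mulr_ge0// sqrtr_ge0.
rewrite -(sqr_sqrtr (h1_ge0 x)) -(sqr_sqrtr (h2_ge0 x)) /speed.
set a := Num.sqrt (h1 x); set b := Num.sqrt (h2 x).
have := sqr_ge0 (a - b); have := sqr_ge0 a; have := sqr_ge0 b; rewrite sqrrB; lra.
Qed.

Lemma speed_ge0 x : 0 <= speed x.
Proof. by rewrite mulr_ge0// sqrtr_ge0. Qed.

Lemma openblock_meas i j : measurable (openblock i j).
Proof. by apply: measurableI; [exact: strip_meas gh1 _|exact: strip_meas gh2 _]. Qed.

Lemma openblock_sub i j : openblock i j `<=` D.
Proof. by move=> x [[]]. Qed.

Lemma correlationE : correlation =
  \sum_(1 <= i < m.+1) \sum_(1 <= j < n.+1) W i j * \int[mu]_(x in openblock i j) speed x.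
Proof.
pose F i x := \sum_(1 <= j < n.+1) W i j * (\1_(openblock i j) x * speed x).
have iF i j : rint (fun x => W i j * (\1_(openblock i j) x * speed x)).
  by apply: rintZ; apply: rint_indic; [exact: openblock_meas|exact: speed_rint].
have sF i : rint (F i) /\ \int[mu]_(x in D) F i x =
    \sum_(1 <= j < n.+1) \int[mu]_(x in D) (W i j * (\1_(openblock i j) x * speed x)).
  exact: (@Rint_sum R (index_iota 1 n.+1) (fun j x => W i j * (\1_(openblock i j) x * speed x)) (iF i)).
have [_ H] := @Rint_sum R (index_iota 1 m.+1) F (fun i => (sF i).1).
rewrite /correlation.
transitivity (\int[mu]_(x in D) (\sum_(1 <= i < m.+1) F i x)).
  apply: Rint_eq => x Dx; rewrite /act_step dotZl dotZr mulrA dot_pw mulr_sumr.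
  apply: eq_bigr => i _; rewrite mulr_sumr; apply: eq_bigr => j _.
  rewrite (cell_indic s g1)// (cell_indic t g2)// /openblock indicI /speed /=; ring.
rewrite H; apply: eq_bigr => i _; rewrite (sF i).2; apply: eq_bigr => j _.
rewrite RintZ; last by apply: rint_indic; [exact: openblock_meas|exact: speed_rint].
by rewrite Rint_indic//; [exact: openblock_meas|exact: openblock_sub].
Qed.

Variable S : nat -> nat -> set R.
Hypothesis S_meas : forall i j, measurable (S i j).
Hypothesis S_closed : forall i j, is_block m n i j -> S i j `<=` closedblock i j.
Hypothesis S_row : forall i j j' x, is_block m n i j -> is_block m n i j' ->
  S i j x -> S i j' x -> j = j'.
Hypothesis S_col : forall i i' j x, is_block m n i j -> is_block m n i' j ->
  S i j x -> S i' j x -> i = i'.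
Hypothesis S_chain : forall i j i' j' x x', S i j x -> S i' j' x' -> cmp_block i j i' j'.

(** The sets [S] are left free because two choices are needed: the open preimages, which bound the
    correlation of every curve, and later a mixture in which two preimages are closed. *)
Lemma feasible_sets : feasible m n ds dt (incr_s S) (incr_t S).
Proof.
split.
- move=> i j; split; apply: Rintegral_ge0 => x _; [exact: h1_ge0|exact: h2_ge0].
- move=> i im; rewrite /incr_s /ds -(level_cc ssub gG1 gh1)//.
  have B j : j \in index_iota 1 n.+1 -> is_block m n i j.
    by rewrite mem_index_iota => jn; rewrite /is_block; lia.
  apply: Rint_disjoint_sum.
  + exact: iota_uniq.
  + by move=> j; exact: S_meas.
  + exact: (mpre gh1).
  + by move=> j /B Bj x /(S_closed Bj) [].
  + by move=> x [].
  + by move=> j j' x /B Bj /B Bj'; exact: S_row.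
  + exact: rint_h gh1.
  + exact: h1_ge0.
- move=> j jn; rewrite /incr_t /dt -(level_cc tsub gG2 gh2)//.
  have B i : i \in index_iota 1 m.+1 -> is_block m n i j.
    by rewrite mem_index_iota => im; rewrite /is_block; lia.
  apply: (@Rint_disjoint_sum _ _ (fun i => S i j)).
  + exact: iota_uniq.
  + by move=> i; exact: S_meas.
  + exact: (mpre gh2).
  + by move=> i /B Bi x /(S_closed Bi) [].
  + by move=> x [].
  + by move=> i i' x /B Bi /B Bi'; exact: S_col.
  + exact: rint_h gh2.
  + exact: h2_ge0.
- move=> i j i' j' p1 p2.
  have ne a b : incr_s S a b * incr_t S a b != 0 -> exists x, S a b x.
    move=> H; apply: contrapT => nex; move: H; rewrite /incr_s.
    have -> : S a b = set0 by apply/seteqP; split => x // Sx; apply: nex; exists x.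
    by rewrite Rintegral_set0 mul0r eqxx.
  have [x Sx] := ne _ _ p1; have [x' Sx'] := ne _ _ p2.
  exact: S_chain Sx Sx'.
Qed.

Lemma correlation_le_value : (forall i j, is_block m n i j -> openblock i j `<=` S i j) ->
  correlation <= value m n W (incr_s S) (incr_t S).
Proof.
move=> OS; rewrite correlationE; apply: ler_sum_nat => i im; apply: ler_sum_nat => j jn.
have B : is_block m n i j by rewrite /is_block; lia.
have SD : S i j `<=` D by move=> x /(S_closed B) [[]].
have Z0 : 0 <= \int[mu]_(x in openblock i j) speed x.
  by apply: Rintegral_ge0 => x _; exact: speed_ge0.
apply: (@le_trans _ _ (Num.max 0 (W i j) * \int[mu]_(x in openblock i j) speed x)).
  by rewrite ler_wpM2r// le_max lexx orbT.
rewrite /gain ler_wpM2l ?le_max ?lexx//.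
apply: (@le_trans _ _ (\int[mu]_(x in S i j) speed x)).
  apply: Rint_sub_mono => //; [exact: openblock_meas|exact: OS|exact: speed_rint|exact: speed_ge0].
apply: cauchy_schwarz => //.
- exact: rint_h gh1.
- exact: rint_h gh2.
- exact: h1_ge0.
- exact: h2_ge0.
- exact: speed_rint.
Qed.

End Pair.

(** * The orbit distance *)

Section Perturb.
Context {R : realType}.
Local Notation mu := (@lebesgue_measure R).
Variables (g h : R -> R).
Hypotheses (gG : Gamma_tilde g) (gh : density g h).
Variable e : R.
Hypotheses (e0 : 0 < e) (e1 : e < 1).

(** Mixing in the identity makes the derivative at least [e] almost everywhere, which carries an
    element of [Gamma_tilde] into [Gamma]. *)
Definition pert (x : R) := (1 - e) * g x + e * x.
Definition dpert (x : R) := (1 - e) * h x + e.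

Lemma pert_derive x : derivable g x 1 -> derivable pert x 1 /\
  derive1 pert x = (1 - e) * derive1 g x + e.
Proof.
move=> dg; rewrite /pert.
have d1 : is_derive x 1 (fun x => (1 - e) * g x) ((1 - e) * 'D_1 g x).
  have := @is_deriveZ _ _ _ g (1 - e) x 1 ('D_1 g x) (DeriveDef dg erefl); exact.
have d2 : is_derive x 1 (fun x => e * x) (e * 1).
  have := @is_deriveZ _ _ _ id e x 1 1 (is_derive_id _ _); exact.
have [d3 d4] := is_deriveD d1 d2.
by split => //; rewrite !derive1E d4 mulr1.
Qed.

Lemma pert_ae : {ae mu, forall x, x \in `]0, 1[ -> derivable pert x 1 /\ derive1 pert x = dpert x}.
Proof.
case: gh => _ _ _; apply: (@filterS _ _ (ae_filter_ringOfSetsType mu)) => x H x01.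
have [dg dh] := H x01; have [dp ->] := pert_derive dg; split => //.
by rewrite dh.
Qed.

Lemma pert_ac : absolutely_continuous pert.
Proof.
have [acg _ _ _ _] := gG.
move=> r r0; have r20 : 0 < r / 2 by lra.
have [d d0 H] := acg _ r20; exists (Num.min d (r / 2)); first by rewrite lt_min d0.
move=> k a b ab tab; rewrite lt_min => /andP[s1 s2].
have := H k a b ab tab s1.
suff : \sum_(i < k) `|pert (b i) - pert (a i)| <=
  \sum_(i < k) `|g (b i) - g (a i)| + \sum_(i < k) (b i - a i) by lra.
rewrite -big_split/=; apply: ler_sum => i _; rewrite /pert.
have [a0 [aib b1]] := ab i (ltn_ord i).
have -> : (1 - e) * g (b i) + e * b i - ((1 - e) * g (a i) + e * a i) =
   (1 - e) * (g (b i) - g (a i)) + e * (b i - a i) by ring.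
apply: le_trans (ler_normD _ _) _; rewrite !normrM.
have p1 : 0 <= 1 - e by rewrite subr_ge0 ltW.
have p2 : 0 <= b i - a i by lra.
rewrite (ger0_norm p1) (ger0_norm (ltW e0)) (ger0_norm p2).
have h1 : (1 - e) * `|g (b i) - g (a i)| <= 1 * `|g (b i) - g (a i)|.
  by rewrite ler_wpM2r// gerBl ltW.
have h2 : e * (b i - a i) <= 1 * (b i - a i).
  by rewrite ler_wpM2r// ltW.
lra.
Qed.

Lemma pert_Gamma : Gamma pert.
Proof.
have [acg rg g00 g11 _] := gG; have [_ h0 _ _] := gh.
have e0' := e0; have e1' := e1.
have := ae_itvoo pert_ae => H.
split; last first.
  apply: (@filterS _ _ (ae_filter_ringOfSetsType mu)) H => x H x01.
  have [_ ->] := H x01; rewrite /dpert; have : 0 <= (1 - e) * h x by rewrite mulr_ge0//; lra.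
  lra.
split; first exact: pert_ac.
- move=> x x01; have := rg x x01; move: x01; rewrite !in_itv/= /pert => /andP[x0 x1] /andP[y0 y1].
  have a1 : 0 <= (1 - e) * g x by rewrite mulr_ge0//; lra.
  have a2 : 0 <= e * x by rewrite mulr_ge0//; lra.
  have a3 : 0 <= (1 - e) * (1 - g x) by rewrite mulr_ge0//; lra.
  have a4 : 0 <= e * (1 - x) by rewrite mulr_ge0//; lra.
  by apply/andP; split; lra.
- by rewrite /pert g00; ring.
- by rewrite /pert g11; ring.
- apply: (@filterS _ _ (ae_filter_ringOfSetsType mu)) H => x H x01.
  have [_ ->] := H x01; rewrite /dpert; have : 0 <= (1 - e) * h x by rewrite mulr_ge0//; lra.
  lra.
Qed.

Lemma pert_density k : density pert k ->
  {ae mu, forall x, x \in `[0, 1] -> k x = dpert x}.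
Proof.
move=> [_ _ _ /ae_itvoo H1]; have H2 := ae_itvoo pert_ae.
apply: (@filterS2 _ _ (ae_filter_ringOfSetsType mu) _ _ _ _ H1 H2) => x {}H1 {}H2 x01.
by have [_ <-] := H1 x01; have [_ ->] := H2 x01.
Qed.

End Perturb.

Section Approximation.
Context {R : realType} {N : nat}.
Local Notation mu := (@lebesgue_measure R).
Local Notation D := (`[0, 1]%classic : set R).
Variables (m n : nat) (s t : nat -> R) (u v : nat -> 'rV[R]_N).
Hypotheses (ssub : subdivision 0 1 m s) (tsub : subdivision 0 1 n t).
Variables (g1 g2 h1 h2 : R -> R).
Hypotheses (gG1 : Gamma_tilde g1) (gh1 : density g1 h1).
Hypotheses (gG2 : Gamma_tilde g2) (gh2 : density g2 h2).

(** The shift by 2 gives [e k < 1] from [k = 0] on. *)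
Let e (k : nat) : R := k.+2%:R^-1.
Let e0 k : 0 < e k. Proof. by rewrite invr_gt0. Qed.
Let e1 k : e k < 1. Proof. by rewrite invf_lt1// ltr1n. Qed.
Let e_cvg : e @ \oo --> (0 : R).
Proof.
rewrite -[e]/(fun k => (@harmonic R) k.+1).
by rewrite (cvg_shiftS (@harmonic R)); exact: cvg_harmonic.
Qed.

Variables (k1 k2 : nat -> R -> R).
Hypothesis dk1 : forall k, density (pert g1 (e k)) (k1 k).
Hypothesis dk2 : forall k, density (pert g2 (e k)) (k2 k).

Let C := \sum_(1 <= i < m.+1) \sum_(1 <= j < n.+1) `|weight u v i j|.

Lemma dot_pw_bound z z' : `|dot (pw m s u z) (pw n t v z')| <= C.
Proof.
rewrite dot_pw; apply: le_trans (ler_norm_sum _ _ _) _; apply: ler_sum => i _.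
apply: le_trans (ler_norm_sum _ _ _) _; apply: ler_sum => j _.
rewrite normrM ler_piMr// -natrM normr_nat.
by rewrite -[leRHS]/(1%:R) ler_nat; case: (cell _ _ _); case: (cell _ _ _).
Qed.

Lemma cell_cvg (c : nat -> R) (i : nat) (z : nat -> R) (l : R) :
  z @ \oo --> l -> cell c i l -> \forall k \near \oo, cell c i (z k).
Proof.
move=> zl /andP[h1' h2']; near=> k; apply/andP; split.
  by near: k; exact: (cvgr_gt _ zl).
by near: k; exact: (cvgr_lt _ zl).
Unshelve. all: by end_near. Qed.

Let pert_cvg (a b : R) : (fun k => (1 - e k) * a + e k * b) @ \oo --> a.
Proof.
have -> : (fun k => (1 - e k) * a + e k * b) = (fun k => a + e k * (b - a)).
  by apply/funext => k; ring.
rewrite -[X in _ --> X]addr0; apply: cvgD; first exact: cvg_cst.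
by rewrite -(mul0r (b - a)); apply: cvgM; [exact: e_cvg|exact: cvg_cst].
Qed.

Let sqrt_cvg (z : nat -> R) l : z @ \oo --> l -> (fun k => Num.sqrt (z k)) @ \oo --> Num.sqrt l.
Proof. by move=> zl; apply: (cvg_comp z Num.sqrt zl); exact: sqrt_continuous. Qed.

(** Inside open cells the step functions are eventually constant along the sequence. On a gridline
    they may jump, but they stay bounded while the factor coming from the density tends to 0. *)
Lemma dot_act_step_cvg x : D x ->
  (forall k, k1 k x = dpert h1 (e k) x) -> (forall k, k2 k x = dpert h2 (e k) x) ->
  ((exists2 k, (k <= m)%N & g1 x = s k) -> h1 x = 0) ->
  ((exists2 k, (k <= n)%N & g2 x = t k) -> h2 x = 0) ->
  (fun k => dot (act_step m s u (pert g1 (e k)) (k1 k) x)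
                (act_step n t v (pert g2 (e k)) (k2 k) x)) @ \oo -->
  dot (act_step m s u g1 h1 x) (act_step n t v g2 h2 x).
Proof.
move=> Dx K1 K2 Z1 Z2.
have c1 : (fun k => k1 k x) @ \oo --> h1 x.
  rewrite (_ : (fun k => _) = (fun k => (1 - e k) * h1 x + e k * 1)); first exact: pert_cvg.
  by apply/funext => k; rewrite K1 /dpert mulr1.
have c2 : (fun k => k2 k x) @ \oo --> h2 x.
  rewrite (_ : (fun k => _) = (fun k => (1 - e k) * h2 x + e k * 1)); first exact: pert_cvg.
  by apply/funext => k; rewrite K2 /dpert mulr1.
have cS : (fun k => Num.sqrt (k1 k x) * Num.sqrt (k2 k x)) @ \oo --> Num.sqrt (h1 x) * Num.sqrt (h2 x).
  by apply: cvgM; exact: sqrt_cvg.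
have p1 : (fun k => pert g1 (e k) x) @ \oo --> g1 x by exact: pert_cvg.
have p2 : (fun k => pert g2 (e k) x) @ \oo --> g2 x by exact: pert_cvg.
have G1 : g1 x \in `[0, 1] by case: gG1 => _ + _ _ _; apply.
have G2 : g2 x \in `[0, 1] by case: gG2 => _ + _ _ _; apply.
move: G1 G2; rewrite !in_itv/= => /andP[y0 y1] /andP[z0 z1].
have degenerate : h1 x = 0 \/ h2 x = 0 -> (fun k => dot (act_step m s u (pert g1 (e k)) (k1 k) x)
                (act_step n t v (pert g2 (e k)) (k2 k) x)) @ \oo -->
    dot (act_step m s u g1 h1 x) (act_step n t v g2 h2 x).
  move=> h120.
  have hh : Num.sqrt (h1 x) * Num.sqrt (h2 x) = 0.
    by case: h120 => ->; rewrite sqrtr0 ?mul0r ?mulr0.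
  rewrite /act_step dotZl dotZr mulrA hh mul0r.
  rewrite hh in cS.
  apply: (@squeeze_cvgr _ _ _ _ (fun k => - C * (Num.sqrt (k1 k x) * Num.sqrt (k2 k x)))
            (fun k => C * (Num.sqrt (k1 k x) * Num.sqrt (k2 k x)))).
  - apply: nearW => k; rewrite dotZl dotZr mulrA.
    have S0 : 0 <= Num.sqrt (k1 k x) * Num.sqrt (k2 k x) by rewrite mulr_ge0// sqrtr_ge0.
    have := dot_pw_bound (pert g1 (e k) x) (pert g2 (e k) x); rewrite ler_norml => /andP[b1 b2].
    by rewrite ![_ * dot _ _]mulrC !ler_wpM2r.
  - by rewrite -(mulr0 (- C)); apply: cvgM; [exact: cvg_cst|exact: cS].
  - by rewrite -(mulr0 C); apply: cvgM; [exact: cvg_cst|exact: cS].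
have [G1|[i im ci]] := cell_exists ssub y0 y1; first by apply: degenerate; left; exact: Z1.
have [G2|[j jn cj]] := cell_exists tsub z0 z1; first by apply: degenerate; right; exact: Z2.
rewrite /act_step dotZl dotZr mulrA (pw_cell ssub u im ci) (pw_cell tsub v jn cj).
apply: (@cvg_trans _ ((fun k => Num.sqrt (k1 k x) * Num.sqrt (k2 k x) * dot (u i) (v j)) @ \oo)); last first.
  by apply: cvgM; [exact: cS|exact: cvg_cst].
apply: near_eq_cvg; near=> k.
rewrite dotZl dotZr mulrA (pw_cell ssub u im) ?(pw_cell tsub v jn)//.
- by near: k; exact: (cell_cvg p2 cj).
- by near: k; exact: (cell_cvg p1 ci).
Unshelve. all: by end_near. Qed.

Lemma correlation_cvg :
  (fun k => correlation m n s t u v (pert g1 (e k)) (pert g2 (e k)) (k1 k) (k2 k)) @ \oo -->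
  correlation m n s t u v g1 g2 h1 h2.
Proof.
pose f k x := dot (act_step m s u (pert g1 (e k)) (k1 k) x) (act_step n t v (pert g2 (e k)) (k2 k) x).
pose f0 x := dot (act_step m s u g1 h1 x) (act_step n t v g2 h2 x).
have pG1 k := pert_Gamma gG1 gh1 (e0 k) (e1 k).
have pG2 k := pert_Gamma gG2 gh2 (e0 k) (e1 k).
have mf k : rint (f k).
  apply: L2_rint; first exact: (act_step_L2 u ssub (pG1 k).1 (dk1 k)).
  exact: (act_step_L2 v tsub (pG2 k).1 (dk2 k)).
have mf0 : rint f0.
  apply: L2_rint; first exact: (act_step_L2 u ssub gG1 gh1).
  exact: (act_step_L2 v tsub gG2 gh2).
(* [C] bounds the inner product of the step functions. The speed is at most [k1 k x + k2 k x], and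
   each summand exceeds [h1 x], respectively [h2 x], by at most 1 almost everywhere. *)
pose G x := C * (h1 x + h2 x + 2).
have iG : rint G.
  apply: rintZ; apply: rintD.
    by apply: rintD; [exact: rint_h gh1|exact: rint_h gh2].
  apply/integrableP; split; first exact: measurable_cst.
  rewrite integral_cst//= ger0_norm// lebesgue_measure_itv/= lte_fin ltr01.
  by rewrite -EFinB -EFinM ltry.
have A1 : {ae mu, forall x, forall k, x \in `[0, 1] -> k1 k x = dpert h1 (e k) x}.
  by apply: ae_foralln => k; exact: (pert_density gh1 (dk1 k)).
have A2 : {ae mu, forall x, forall k, x \in `[0, 1] -> k2 k x = dpert h2 (e k) x}.
  by apply: ae_foralln => k; exact: (pert_density gh2 (dk2 k)).
have B1 := grid_ae ssub gG1 gh1.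
have B2 := grid_ae tsub gG2 gh2.
have A12 := @filterI _ _ (ae_filter_ringOfSetsType mu) _ _ A1 A2.
have B12 := @filterI _ _ (ae_filter_ringOfSetsType mu) _ _ B1 B2.
have [] := @dominated_convergence _ _ R mu D (measurable_itv _)
  (fun k => EFin \o f k) (EFin \o f0) (EFin \o G).
- by move=> k; apply: measurable_int (mf k).
- exact: measurable_int mf0.
- apply: (@filterS2 _ _ (ae_filter_ringOfSetsType mu) _ _ _ _ A12 B12) => x [a1 a2] [b1 b2] Dx.
  apply: cvg_EFin; first by apply: nearW => k.
  apply: dot_act_step_cvg => //.
  + by move=> k; exact: a1.
  + by move=> k; exact: a2.
  + exact: b1.
  + exact: b2.
- exact: iG.
- apply: (@filterS _ _ (ae_filter_ringOfSetsType mu)) A12 => x [a1 a2] k Dx.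
  rewrite /= lee_fin /f /act_step dotZl dotZr mulrA normrM mulrC /G.
  have e0' := e0 k; have e1' := e1 k.
  have x0 := h1_ge0 gh1 x; have y0 := h2_ge0 gh2 x.
  have K10 : 0 <= k1 k x by exact: h1_ge0 (dk1 k) x.
  have K20 : 0 <= k2 k x by exact: h1_ge0 (dk2 k) x.
  apply: ler_pM => //; first exact: dot_pw_bound.
  rewrite ger0_norm; last by rewrite mulr_ge0// sqrtr_ge0.
  have e3 := sqr_sqrtr K10; have e4 := sqr_sqrtr K20.
  have b1 : k1 k x <= h1 x + 1.
    rewrite a1// /dpert; have : (1 - e k) * h1 x <= 1 * h1 x by rewrite ler_wpM2r//; lra.
    lra.
  have b2 : k2 k x <= h2 x + 1.
    rewrite a2// /dpert; have : (1 - e k) * h2 x <= 1 * h2 x by rewrite ler_wpM2r//; lra.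
    lra.
  set a := Num.sqrt (k1 k x) in e3 *; set b := Num.sqrt (k2 k x) in e4 *.
  have := sqr_ge0 (a - b); have := sqr_ge0 a; have := sqr_ge0 b; rewrite sqrrB; lra.
move=> _ _ H; apply: fine_cvg.
rewrite /correlation fineK; first exact: H.
by apply: integrable_fin_num.
Qed.

End Approximation.

Lemma ler_sqrW (R : realDomainType) (a b : R) : 0 <= a -> a <= b -> a ^+ 2 <= b ^+ 2.
Proof. by move=> a0 ab; rewrite ler_sqr ?nnegrE// (le_trans a0). Qed.

Lemma ler_of_sqr (R : rcfType) (a b : R) : 0 <= b -> a <= b ^+ 2 -> Num.sqrt a <= b.
Proof. by move=> b0 ab; rewrite -[leRHS]ger0_norm// -sqrtr_sqr ler_wsqrtr. Qed.

Lemma triangle_energy (R : realFieldType) (l d w a b e E C M : R) : 0 < l ->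
  d <= (1 + l) * w + (1 + l^-1) * (2 * (a + b)) -> d = E - 2 * C -> C <= M ->
  a <= e -> b <= e -> E - 2 * M <= (1 + l) * w + (1 + l^-1) * (2 * (e + e)).
Proof.
move=> l0 tri dE CM ae be.
have li : 0 <= 1 + l^-1 by rewrite addr_ge0// invr_ge0 ltW.
have : (1 + l^-1) * (2 * (a + b)) <= (1 + l^-1) * (2 * (e + e)) by rewrite ler_wpM2l//; lra.
lra.
Qed.

Lemma cell_chain (R : realType) (m n : nat) (s t : nat -> R) (g1 g2 h1 h2 : R -> R) i j i' j' (x x' : R) :
  density g1 h1 -> density g2 h2 -> subdivision 0 1 m s -> subdivision 0 1 n t ->
  is_block m n i j -> is_block m n i' j' -> x \in `[0, 1] -> x' \in `[0, 1] ->
  cell s i (g1 x) -> cell t j (g2 x) -> cell s i' (g1 x') -> cell t j' (g2 x') ->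
  cmp_block i j i' j'.
Proof.
move=> d1 d2 ssub tsub.
wlog xx : i j i' j' x x' / x <= x'.
  move=> H; have [xx|/ltW xx] := leP x x'; first exact: (H _ _ _ _ x x').
  by move=> ij ij' x01 x01' a b a' b'; rewrite cmp_blockC; apply: (H _ _ _ _ x' x).
move=> /and4P[i0 im j0 jn] /and4P[_ i'm _ j'n].
rewrite !in_itv/= => /andP[x0 _] /andP[_ x1'] /andP[a1 _] /andP[b1 _] /andP[_ a2'] /andP[_ b2'].
have m1 := density_mono d1 x0 xx x1'; have m2 := density_mono d2 x0 xx x1'.
have i1 := sub_lt_idx ssub (leq_trans (leq_pred _) im) i'm (lt_trans a1 (le_lt_trans m1 a2')).
have j1 := sub_lt_idx tsub (leq_trans (leq_pred _) jn) j'n (lt_trans b1 (le_lt_trans m2 b2')).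
by case: (i) (j) i0 j0 i1 j1 => [|k] [|l] // _ _ i1 j1; rewrite /cmp_block i1 j1.
Qed.

(** [o] is the squared orbit distance, [a] the correlation of a curve attaining the maximum [M], and
    [c] that of the curve under test. The first three hypotheses force [o = E - 2 * M]. *)
Lemma energy_pinch (R : realFieldType) (o E M a c : R) :
  E - 2 * M <= o -> o <= E - 2 * a -> M <= a -> c <= M -> o = E - 2 * c <-> M <= c.
Proof. by move=> h1 h2 h3 h4; split=> h; lra. Qed.

Section OrbitDistance.
Context {R : realType} {N : nat}.
Local Notation mu := (@lebesgue_measure R).
Local Notation D := (`[0, 1]%classic : set R).
Variables (m n : nat) (s t : nat -> R) (u v : nat -> 'rV[R]_N).
Hypotheses (ssub : subdivision 0 1 m s) (tsub : subdivision 0 1 n t).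
Variables (q1 q2 : R -> 'rV[R]_N).
Hypothesis q1_u : forall i, (1 <= i <= m)%N -> forall x, x \in `]s i.-1, s i[ -> q1 x = u i.
Hypothesis q2_v : forall j, (1 <= j <= n)%N -> forall x, x \in `]t j.-1, t j[ -> q2 x = v j.

Local Notation corr := (correlation m n s t u v).
Local Notation W := (weight u v).

Definition energy := \sum_(1 <= i < m.+1) dot (u i) (u i) * (s i - s i.-1) +
  \sum_(1 <= j < n.+1) dot (v j) (v j) * (t j - t j.-1).

Lemma act_dist_sqr g1 h1 g2 h2 : Gamma_tilde g1 -> density g1 h1 ->
  Gamma_tilde g2 -> density g2 h2 ->
  L2dist (act q1 g1) (act q2 g2) ^+ 2 = energy - 2 * corr g1 g2 h1 h2.
Proof.
move=> G1 d1 G2 d2.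
rewrite (L2dist_ae (act_ae ssub q1_u G1 d1) (act_ae tsub q2_v G2 d2)).
rewrite L2dist_expand; [|exact: act_step_L2 d1|exact: act_step_L2 d2].
rewrite (rint_act_step u ssub G1 d1).2 (rint_act_step v tsub G2 d2).2.
by rewrite /energy /correlation.
Qed.

Lemma openblock_feasible g1 h1 g2 h2 : Gamma_tilde g1 -> density g1 h1 ->
  Gamma_tilde g2 -> density g2 h2 ->
  exists x y, feasible m n (ds s) (dt t) x y /\ corr g1 g2 h1 h2 <= value m n W x y.
Proof.
move=> G1 d1 G2 d2.
(* Empty off the grid, because the chain condition ranges over all indices. *)
pose S i j := if is_block m n i j then openblock s t g1 g2 i j else set0.
have S_in i j x : S i j x -> [/\ is_block m n i j, x \in `[0, 1],
    cell s i (g1 x) & cell t j (g2 x)].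
  rewrite /S; case: (boolP (is_block m n i j)) => // ij [[x01 ha] [_ hb]].
  by split.
have bm i j : is_block m n i j -> (1 <= i <= m)%N by rewrite /is_block; lia.
have bn i j : is_block m n i j -> (1 <= j <= n)%N by rewrite /is_block; lia.
have S_meas i j : measurable (S i j).
  by rewrite /S; case: ifP => // _; exact: (openblock_meas _ _ d1 d2).
exists (incr_s h1 S), (incr_t h2 S); split.
- apply: (@feasible_sets _ m n s t ssub tsub g1 g2 h1 h2 G1 d1 G2 d2) => //.
  + move=> i j ij x /S_in[_ x01 /andP[a1 a2] /andP[b1 b2]].
    by split; split=> //=; rewrite in_itv/= !ltW.
  + by move=> i j j' x ij ij' /S_in[_ _ _ c] /S_in[_ _ _ c']; apply: (cell_uniq tsub (bn _ _ ij) (bn _ _ ij') c c').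
  + by move=> i i' j x ij ij' /S_in[_ _ c _] /S_in[_ _ c' _]; apply: (cell_uniq ssub (bm _ _ ij) (bm _ _ ij') c c').
  + move=> i j i' j' x x' /S_in[ij x01 a b] /S_in[ij' x01' a' b'].
    exact: (cell_chain d1 d2 ssub tsub ij ij' x01 x01' a b a' b').
- apply: (correlation_le_value u v d1 d2) => //.
  + move=> i j ij x /S_in[_ x01 /andP[a1 a2] /andP[b1 b2]].
    by split; split=> //=; rewrite in_itv/= !ltW.
  + by move=> i j ij; rewrite /S ij.
Qed.

Variables xM yM : nat -> nat -> R.
Hypothesis mx : maximal m n (ds s) (dt t) W xM yM.
Local Notation M := (value m n W xM yM).

Lemma corr_le g1 h1 g2 h2 : Gamma_tilde g1 -> density g1 h1 ->
  Gamma_tilde g2 -> density g2 h2 -> corr g1 g2 h1 h2 <= M.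
Proof.
move=> G1 d1 G2 d2; have [x [y [fxy le]]] := openblock_feasible G1 d1 G2 d2.
by apply: (le_trans le); case: mx => _; apply.
Qed.

(** Closure points are within [e] of orbit points, whose correlation is bounded by [corr_le]. For
    fixed [l] the error [e] tends to 0, and only then [l]. *)
Lemma orbit_lower w1 w2 : orbit_closure q1 w1 -> orbit_closure q2 w2 ->
  energy - 2 * M <= L2dist w1 w2 ^+ 2.
Proof.
move=> [l1 H1] [l2 H2].
have key l e : 0 < l -> 0 < e ->
    energy - 2 * M <= (1 + l) * L2dist w1 w2 ^+ 2 + (1 + l^-1) * (2 * (e ^+ 2 + e ^+ 2)).
  move=> l0 e0; have [g1 [G1 _] e1] := H1 e e0; have [g2 [G2 _] e2] := H2 e e0.
  have [h1 d1] := Gamma_tilde_density G1; have [h2 d2] := Gamma_tilde_density G2.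
  have a1 := act_ae ssub q1_u G1 d1; have a2 := act_ae tsub q2_v G2 d2.
  have refl w : {ae mu, forall x : R, x \in `[0, 1] -> w x = w x :> 'rV[R]_N}.
    by apply: (@filterE _ _ (ae_filter_ringOfSetsType mu)).
  have := corr_le G1 d1 G2 d2; have := act_dist_sqr G1 d1 G2 d2.
  rewrite (L2dist_ae a1 a2); rewrite (L2dist_ae a1 (refl w1)) in e1.
  rewrite (L2dist_ae a2 (refl w2)) in e2 => dE cM.
  have := L2dist_triangle (act_step_L2 u ssub G1 d1) (act_step_L2 v tsub G2 d2) l1 l2 l0 => tri.
  have q1' : L2dist (act_step m s u g1 h1) w1 ^+ 2 <= e ^+ 2.
    exact: ler_sqrW (L2dist_ge0 _ _) (ltW e1).
  have q2' : L2dist (act_step n t v g2 h2) w2 ^+ 2 <= e ^+ 2.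
    exact: ler_sqrW (L2dist_ge0 _ _) (ltW e2).
  exact: triangle_energy l0 tri dE cM q1' q2'.
have L0 := sqr_ge0 (L2dist w1 w2).
move: (L2dist w1 w2 ^+ 2) L0 key => L L0 key.
have key2 l : 0 < l -> energy - 2 * M <= (1 + l) * L.
  move=> l0; apply/ler_addgt0Pr => e e0.
  have c0 : 0 < 1 + l^-1 by rewrite addr_gt0// invr_gt0.
  have r0 : 0 < e / ((1 + l^-1) * 4) by rewrite divr_gt0// mulr_gt0.
  (* With this error the second term of [key] is exactly [e]. *)
  have := key l (Num.sqrt (e / ((1 + l^-1) * 4))) l0.
  rewrite sqrtr_gt0 => /(_ r0); rewrite sqr_sqrtr; last exact: ltW.
  suff -> : (1 + l^-1) * (2 * (e / ((1 + l^-1) * 4) + e / ((1 + l^-1) * 4))) = e by [].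
  by move: c0 => /lt0r_neq0; move: (1 + l^-1) => c c0; field.
apply/ler_addgt0Pr => e e0.
have l0 : 0 < e / (L + 1) by rewrite divr_gt0//; lra.
apply: (le_trans (key2 _ l0)); rewrite mulrDl mul1r lerD2l mulrAC ler_pdivrMr; last lra.
rewrite ler_pM2l//; lra.
Qed.

(** The closure consists of functions in [L2], so the measurable representative is used; it is at
    distance 0 from the orbit point [act q1 g]. *)
Lemma act_step_closure g h : Gamma g -> density g h ->
  orbit_closure q1 (act_step m s u g h).
Proof.
move=> [G G'] d; split; first exact: act_step_L2 d.
move=> e e0; exists g => //.
have refl : {ae mu, forall x : R, x \in `[0, 1] -> act_step m s u g h x = act_step m s u g h x}.
  by apply: (@filterE _ _ (ae_filter_ringOfSetsType mu)).
rewrite (L2dist_ae (act_ae ssub q1_u G d) refl).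
suff -> : L2dist (act_step m s u g h) (act_step m s u g h) = 0 by [].
apply/eqP; rewrite -sqrf_eq0 L2dist_sqr; apply/eqP.
transitivity (\int[mu]_(x in D) (0 : R)); last by rewrite Rintegral_cst// mul0r.
by apply: Rint_eq => x _; rewrite subrr dot0l.
Qed.

End OrbitDistance.

Section OrbitDistance2.
Context {R : realType} {N : nat}.
Local Notation mu := (@lebesgue_measure R).
Variables (m n : nat) (s t : nat -> R) (u v : nat -> 'rV[R]_N).
Hypotheses (ssub : subdivision 0 1 m s) (tsub : subdivision 0 1 n t).
Variables (q1 q2 : R -> 'rV[R]_N).
Hypothesis q1_u : forall i, (1 <= i <= m)%N -> forall x, x \in `]s i.-1, s i[ -> q1 x = u i.
Hypothesis q2_v : forall j, (1 <= j <= n)%N -> forall x, x \in `]t j.-1, t j[ -> q2 x = v j.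
Local Notation corr := (correlation m n s t u v).
Local Notation W := (weight u v).
Local Notation E := (energy m n s t u v).

Let S := [set L2dist q' w' | q' in orbit_closure q1 & w' in orbit_closure q2].

Lemma orbit_dist_ge0 : 0 <= orbit_dist q1 q2.
Proof.
rewrite /orbit_dist -/S; have [S0|S0] := pselect (S !=set0).
  by apply: lb_le_inf => // _ [w _ [w' _ <-]]; exact: L2dist_ge0.
(* The infimum of the empty set is 0 by convention. *)
by rewrite inf_out// => -[].
Qed.

(** [g1] and [g2] may lie outside [Gamma]; their perturbations lie in it, and by [correlation_cvg]
    they have nearly the same correlation. *)
Lemma orbit_upper g1 h1 g2 h2 : Gamma_tilde g1 -> density g1 h1 ->
  Gamma_tilde g2 -> density g2 h2 ->
  orbit_dist q1 q2 ^+ 2 <= E - 2 * corr g1 g2 h1 h2.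
Proof.
move=> G1 d1 G2 d2; apply/ler_addgt0Pr => r r0.
pose e (k : nat) : R := k.+2%:R^-1.
have e0 k : 0 < e k by rewrite invr_gt0.
have e1 k : e k < 1 by rewrite invf_lt1// ltr1n.
have pG1 k := pert_Gamma G1 d1 (e0 k) (e1 k).
have pG2 k := pert_Gamma G2 d2 (e0 k) (e1 k).
have /choice[k1 dk1] k := Gamma_tilde_density (pG1 k).1.
have /choice[k2 dk2] k := Gamma_tilde_density (pG2 k).1.
have := @correlation_cvg _ _ m n s t u v ssub tsub _ _ _ _ G1 d1 G2 d2 k1 k2 dk1 dk2.
move/cvgrPdist_lt => /(_ (r / 2)) H.
have r20 : 0 < r / 2 by lra.
have [k] := @filter_ex _ _ _ _ (H r20).
rewrite ltr_norml => /andP[lo hi].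
have c1 := act_step_closure ssub q1_u (pG1 k) (dk1 k).
have c2 := act_step_closure tsub q2_v (pG2 k) (dk2 k).
have le : orbit_dist q1 q2 <= L2dist (act_step m s u (pert g1 (e k)) (k1 k)) (act_step n t v (pert g2 (e k)) (k2 k)).
  apply: ge_inf.
    by exists 0 => _ [w _ [w' _ <-]]; exact: L2dist_ge0.
  by exists (act_step m s u (pert g1 (e k)) (k1 k)) => //; exists (act_step n t v (pert g2 (e k)) (k2 k)).
have dE := act_dist_sqr ssub tsub q1_u q2_v (pG1 k).1 (dk1 k) (pG2 k).1 (dk2 k).
rewrite (L2dist_ae (act_ae ssub q1_u (pG1 k).1 (dk1 k)) (act_ae tsub q2_v (pG2 k).1 (dk2 k))) in dE.
apply: (le_trans (ler_sqrW orbit_dist_ge0 le)); rewrite dE.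
by move: hi; move: (corr _ _ _ _) (corr _ _ _ _) E => c1' c2' E0; lra.
Qed.

Variables xM yM : nat -> nat -> R.
Hypothesis mx : maximal m n (ds s) (dt t) W xM yM.
Local Notation M := (value m n W xM yM).

(** An element of [Gamma] shows that both orbit closures are inhabited, so that the infimum is not
    the default value 0. *)
Lemma orbit_dist_ge : (exists g h, Gamma g /\ density (g : R -> R) h) -> E - 2 * M <= orbit_dist q1 q2 ^+ 2.
Proof.
move=> [g [h [G d]]].
have [E0|E0] := leP (E - 2 * M) 0; first by apply: (le_trans E0); rewrite sqr_ge0.
rewrite -[leLHS](sqr_sqrtr (ltW E0)); apply: ler_sqrW; first exact: sqrtr_ge0.
apply: lb_le_inf.
  exists (L2dist (act_step m s u g h) (act_step n t v g h)).
  exists (act_step m s u g h); first exact: (act_step_closure ssub q1_u).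
  by exists (act_step n t v g h) => //; exact: (act_step_closure tsub q2_v).
move=> _ [w1 H1 [w2 H2 <-]].
by apply: (ler_of_sqr (L2dist_ge0 _ _)); exact: (orbit_lower ssub tsub q1_u q2_v mx).
Qed.

Lemma optimal_iff g1 h1 g2 h2 a1 b1 a2 b2 :
  Gamma_tilde a1 -> density a1 b1 -> Gamma_tilde a2 -> density a2 b2 ->
  M <= corr a1 a2 b1 b2 ->
  Gamma_tilde g1 -> density g1 h1 -> Gamma_tilde g2 -> density g2 h2 ->
  L2dist (act q1 g1) (act q2 g2) = orbit_dist q1 q2 <-> M <= corr g1 g2 h1 h2.
Proof.
move=> A1 B1 A2 B2 att G1 d1 G2 d2.
have exG : exists g h, Gamma g /\ density (g : R -> R) h.
  have half0 : 0 < 2^-1 :> R by rewrite invr_gt0.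
  have half1 : 2^-1 < 1 :> R by rewrite invf_lt1// ltr1n.
  have PG := pert_Gamma G1 d1 half0 half1.
  have [k dk] := Gamma_tilde_density PG.1.
  by exists (pert g1 2^-1), k.
have lo := orbit_dist_ge exG.
have up := orbit_upper A1 B1 A2 B2.
have dE := act_dist_sqr ssub tsub q1_u q2_v G1 d1 G2 d2.
have cle := corr_le ssub tsub mx G1 d1 G2 d2.
have pinch := energy_pinch lo up att cle.
split=> [H|/pinch H]; first by apply/pinch; rewrite -dE H.
apply/eqP; rewrite -(@eqrXn2 _ 2)// ?L2dist_ge0 ?orbit_dist_ge0//.
by apply/eqP; rewrite dE H.
Qed.

End OrbitDistance2.

(** * Polygons *)

Section Polyline1.
Context {R : realType}.
Local Notation mu := (@lebesgue_measure R).
Implicit Types (P : nat -> R).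

(** A sum of ramps, the one of index [k] rising from 0 to 1 on [k, k + 1]. In this form monotonicity
    and the Lipschitz bound hold term by term. *)
Definition pol P (K : nat) (w : R) : R :=
  P 0%N + \sum_(0 <= k < K) clamp (w - k%:R) * (P k.+1 - P k).

Lemma pol_end P K w : K%:R <= w -> pol P K w = P K.
Proof.
rewrite /pol; elim: K => [|K IH] Kw; first by rewrite big_geq// addr0.
rewrite big_nat_recr//= addrA IH; last by move: Kw; rewrite -natr1; lra.
rewrite clamp1; [ring|move: Kw; rewrite -natr1; lra].
Qed.

Lemma pol_piece P K k w : (k < K)%N -> k%:R <= w -> w <= k.+1%:R ->
  pol P K w = P k + (w - k%:R) * (P k.+1 - P k).
Proof.
move=> kK kw wk; rewrite /pol; elim: K kK => // K IH; rewrite ltnS leq_eqVlt.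
move=> /orP[/eqP kK|kK].
  rewrite big_nat_recr//= addrA -/(pol P K w) -kK pol_end// clampE//.
    by rewrite subr_ge0.
  by rewrite -natr1 in wk; lra.
rewrite big_nat_recr//= addrA IH// clampN; first by rewrite mul0r addr0.
rewrite subr_le0 (le_trans wk)// ler_nat; exact: kK.
Qed.

Definition polyline P K (z : R) : R := pol P K (K%:R * z).

Section Mono.
Variables (P : nat -> R) (K : nat).
Hypothesis P_mono : forall k, (k < K)%N -> P k <= P k.+1.
Hypothesis K0 : (0 < K)%N.

Lemma polyline_homo : {homo polyline P K : x y / x <= y}.
Proof.
move=> x y xy; rewrite /polyline /pol lerD2l; apply: ler_sum_nat => k /andP[_ kK].
rewrite ler_wpM2r ?subr_ge0 ?P_mono//; apply: clamp_homo.
by rewrite lerD2r ler_wpM2l.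
Qed.

Lemma polyline_lip x y : x <= y ->
  polyline P K y - polyline P K x <= K%:R * (P K - P 0%N) * (y - x).
Proof.
move=> xy; rewrite /polyline /pol.
have -> : forall a b c : R, a + b - (a + c) = b - c by move=> *; ring.
rewrite -sumrB; apply: (@le_trans _ _ (\sum_(0 <= k < K) K%:R * (y - x) * (P k.+1 - P k))).
  apply: ler_sum_nat => k /andP[_ kK]; rewrite -mulrBl ler_wpM2r ?subr_ge0 ?P_mono//.
  have h : K%:R * x - k%:R <= K%:R * y - k%:R by rewrite lerD2r ler_wpM2l.
  have := clamp_lip h; lra.
rewrite -mulr_sumr telescope_sumr//; rewrite le_eqVlt; apply/orP; left; apply/eqP; ring.
Qed.

Lemma polyline0 : polyline P K 0 = P 0%N.
Proof. by rewrite /polyline mulr0 (@pol_piece _ _ 0%N)// subr0 mul0r addr0. Qed.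

Lemma polyline_node k : (k <= K)%N -> polyline P K (k%:R / K%:R) = P k.
Proof.
move=> kK; have K' : K%:R != 0 :> R by rewrite pnatr_eq0 -lt0n.
rewrite /polyline mulrC divfK//; move: kK; rewrite leq_eqVlt => /orP[/eqP->|kK].
  exact: pol_end.
by rewrite (@pol_piece _ _ k)// ?ler_nat// subrr mul0r addr0.
Qed.

Lemma polyline1 : polyline P K 1 = P K.
Proof. by rewrite -(polyline_node (leqnn K)) divff// pnatr_eq0 -lt0n. Qed.

Lemma polyline_ac : absolutely_continuous (polyline P K).
Proof.
(* The summand 1 keeps [C] positive when [P] is constant. *)
move=> e e0; pose C := K%:R * (P K - P 0%N) + 1.
have PK : P 0%N <= P K by rewrite -polyline0 -polyline1; exact: polyline_homo.
have C0 : 0 < C.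
  have h : 0 <= K%:R * (P K - P 0%N) by rewrite mulr_ge0// subr_ge0.
  by rewrite /C; lra.
exists (e / C); first exact: divr_gt0.
move=> k a b ab _; rewrite ltr_pdivlMr// => H.
apply: le_lt_trans H; rewrite mulr_suml; apply: ler_sum => i _.
have [_ [aib _]] := ab i (ltn_ord i).
rewrite ger0_norm; last by rewrite subr_ge0 polyline_homo.
apply: (le_trans (polyline_lip aib)); rewrite mulrC ler_wpM2l ?subr_ge0//.
by rewrite /C; lra.
Qed.

Lemma polyline_derive k x : (k < K)%N -> k%:R / K%:R < x -> x < k.+1%:R / K%:R ->
  derivable (polyline P K) x 1 /\ derive1 (polyline P K) x = K%:R * (P k.+1 - P k).
Proof.
move=> kK kx xk; have K' : 0 < K%:R :> R by rewrite ltr0n.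
pose f z := P k + (K%:R * z - k%:R) * (P k.+1 - P k).
have E : \forall z \near x, f z = polyline P K z.
  near=> z; rewrite /polyline (@pol_piece _ _ k)//.
    have : k%:R / K%:R < z by near: z; exact: lt_nbhsr.
    by rewrite ltr_pdivrMr// mulrC => /ltW.
  have : z < k.+1%:R / K%:R by near: z; exact: lt_nbhsl.
  by rewrite ltr_pdivlMr// mulrC => /ltW.
have fE : f = (fun z => (K%:R * (P k.+1 - P k)) * z + (P k - k%:R * (P k.+1 - P k))).
  by apply/funext => z; rewrite /f; ring.
have df : is_derive x 1 f (K%:R * (P k.+1 - P k)).
  rewrite fE.
  have d2 : is_derive x 1 (fun z => (K%:R * (P k.+1 - P k)) * z) ((K%:R * (P k.+1 - P k)) * 1).
    have := @is_deriveZ _ _ _ id (K%:R * (P k.+1 - P k)) x 1 1 (is_derive_id _ _); exact.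
  have d3 := is_derive_cst (P k - k%:R * (P k.+1 - P k)) x 1.
  have := is_deriveD d2 d3; rewrite mulr1 addr0; exact.
have [d1 d2] := near_eq_is_derive E df.
by split=> //; rewrite derive1E d2.
Unshelve. all: by end_near. Qed.

Lemma piece_exists (w : R) : 0 <= w -> w < K%:R -> exists k, [/\ (k < K)%N, k%:R <= w & w < k.+1%:R].
Proof.
move=> w0 wK; exists (Num.truncn w).
have /andP[h1 h2] := truncn_itv w0.
split=> //; rewrite -(ltr_nat R); exact: le_lt_trans wK.
Qed.

Lemma not_knot_ae : {ae mu, forall x : R, forall k : nat, x != (k%:R / K%:R : R)}.
Proof.
apply: ae_foralln => k; exists [set k%:R / K%:R]; split => //; first exact: lebesgue_measure_set1.
by move=> x /= /negP; rewrite negbK => /eqP.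
Qed.

Lemma knot_piece (x : R) : x \in `[0, 1] -> (forall k : nat, x != k%:R / K%:R) ->
  exists k, [/\ (k < K)%N, k%:R / K%:R < x & x < k.+1%:R / K%:R].
Proof.
rewrite in_itv/= => /andP[x0 x1] nk; have K' : 0 < K%:R :> R by rewrite ltr0n.
have x1' : x < 1.
  by rewrite lt_neqAle x1 andbT; have := nk K; rewrite divff// pnatr_eq0 -lt0n.
have [k [kK h1 h2]] := @piece_exists (K%:R * x) (mulr_ge0 (ltW K') x0) ltac:(rewrite -[ltRHS]mulr1 ltr_pM2l//).
exists k; split=> //; last by rewrite ltr_pdivlMr// mulrC.
by rewrite lt_neqAle eq_sym nk/= ler_pdivrMr// mulrC.
Qed.

Lemma polyline_Gamma_tilde : P 0%N = 0 -> P K = 1 -> Gamma_tilde (polyline P K).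
Proof.
move=> P0 P1; split.
- exact: polyline_ac.
- move=> x; rewrite !in_itv/= => /andP[x0 x1]; apply/andP; split.
    by rewrite -P0 -polyline0 polyline_homo.
  by rewrite -P1 -polyline1 polyline_homo.
- by rewrite polyline0.
- by rewrite polyline1.
- apply: (@filterS _ _ (ae_filter_ringOfSetsType mu)) not_knot_ae => x nk x01.
  have [k [kK k1 k2]] := knot_piece x01 nk.
  have [_ ->] := polyline_derive kK k1 k2.
  by rewrite mulr_ge0// subr_ge0 P_mono.
Qed.

End Mono.
End Polyline1.

(** * The walk through the grid *)

Section Walk.
Variables (m n : nat) (act : nat -> nat -> bool).
Hypothesis act_block : forall i j, act i j -> is_block m n i j.
Hypothesis act_chain : forall i j i' j', act i j -> act i' j' -> cmp_block i j i' j'.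

(* Row j has active blocks on both sides of the gridline s_i, so that the curve
   has to cross that line inside row j. *)
Definition row_straddles i j :=
  (exists2 k, (k <= i)%N & act k j) /\ (exists2 l, (i < l)%N & act l j).
Definition col_straddles i j :=
  (exists2 k, (k <= j)%N & act i k) /\ (exists2 l, (j < l)%N & act i l).

(** An active block further right in row [j] and one further up in column [i] would be
    incomparable. *)
Lemma straddles_excl i j : row_straddles i j -> col_straddles i j -> False.
Proof.
move=> [_ [l li al]] [_ [l' lj al']].
by have := act_chain al al'; rewrite /cmp_block; lia.
Qed.

(** The invariant of the walk: a block met by it is active, or it is crossed straight on between
    active blocks of its row or column. *)
Definition on_run i j := is_block m n i j /\
  [\/ act i j, row_straddles i.-1 j /\ row_straddles i j |
      col_straddles i j.-1 /\ col_straddles i j].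

(** Expresses that a monotone curve through all active blocks can pass through the vertex (s_i,
    t_j). *)
Definition separates i j := [/\ (i <= m)%N, (j <= n)%N &
  forall a b, act a b -> ((a <= i) && (b <= j))%N || ((i < a) && (j < b))%N].

Definition step (b b' : nat * nat) :=
  (row_straddles b.1 b.2 /\ b' = (b.1.+1, b.2)) \/
  (col_straddles b.1 b.2 /\ b' = (b.1, b.2.+1)).

(** A run stops as soon as no further gridline has to be crossed in the current row or column; its
    upper right vertex then separates ([run_end_separates]). *)
Fixpoint run (b : nat * nat) (bs : seq (nat * nat)) : Prop :=
  if bs is b' :: bs' then step b b' /\ run b' bs'
  else [/\ act b.1 b.2, ~ row_straddles b.1 b.2 & ~ col_straddles b.1 b.2].

(** Each step increases one index. No active block is skipped, since one left behind in the current
    column or row would be incomparable with the active block that causes the step. *)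
Lemma run_exists i j : on_run i j -> exists bs, run (i, j) bs /\
  let e := last (i, j) bs in
  forall a b, act a b -> (i <= a)%N -> (j <= b)%N ->
    ((a, b) \in (i, j) :: bs) || ((e.1 < a) && (e.2 < b))%N.
Proof.
have [d] := ubnP ((m - i) + (n - j))%N; elim: d i j => // d IH i j.
rewrite ltnS => hd [ij V].
have right : row_straddles i j -> exists bs, run (i, j) bs /\
  let e := last (i, j) bs in
  forall a b, act a b -> (i <= a)%N -> (j <= b)%N ->
    ((a, b) \in (i, j) :: bs) || ((e.1 < a) && (e.2 < b))%N.
  move=> rij; have [[k ki ak] [l il al]] := rij.
  have bl := act_block al.
  have V' : on_run i.+1 j.
    split; first by move: ij bl; rewrite /is_block; lia.
    have [e|li] := eqVneq l i.+1; first by apply: Or31; rewrite -e.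
    apply: Or32; split => //; split; first by exists k => //; lia.
    by exists l => //; lia.
  have [|bs [rbs H]] := IH i.+1 j _ V'; first by move: bl; rewrite /is_block; lia.
  exists ((i.+1, j) :: bs); split; first by split => //; left.
  move=> /= a b aab ia jb.
  have [[-> ->]|/eqP ne] := pselect ((a, b) = (i, j)); first by rewrite mem_head.
  have ia' : (i < a)%N.
    rewrite ltn_neqAle ia andbT; apply/eqP => e; subst a.
    have := act_chain aab al; rewrite /cmp_block => c.
    by move: ne; rewrite xpair_eqE eqxx /=; lia.
  by have /orP[h|->] := H a b aab ia' jb; rewrite ?orbT// in_cons h orbT.
have up : col_straddles i j -> exists bs, run (i, j) bs /\
  let e := last (i, j) bs in
  forall a b, act a b -> (i <= a)%N -> (j <= b)%N ->
    ((a, b) \in (i, j) :: bs) || ((e.1 < a) && (e.2 < b))%N.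
  move=> rij; have [[k ki ak] [l il al]] := rij.
  have bl := act_block al.
  have V' : on_run i j.+1.
    split; first by move: ij bl; rewrite /is_block; lia.
    have [e|li] := eqVneq l j.+1; first by apply: Or31; rewrite -e.
    apply: Or33; split => //; split; first by exists k => //; lia.
    by exists l => //; lia.
  have [|bs [rbs H]] := IH i j.+1 _ V'; first by move: bl; rewrite /is_block; lia.
  exists ((i, j.+1) :: bs); split; first by split => //; right.
  move=> /= a b aab ia jb.
  have [[-> ->]|/eqP ne] := pselect ((a, b) = (i, j)); first by rewrite mem_head.
  have jb' : (j < b)%N.
    rewrite ltn_neqAle jb andbT; apply/eqP => e; subst b.
    have := act_chain aab al; rewrite /cmp_block => c.
    by move: ne; rewrite xpair_eqE eqxx andbT /=; lia.
  by have /orP[h|->] := H a b aab ia jb'; rewrite ?orbT// in_cons h orbT.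
have [r|nr] := pselect (row_straddles i j); first exact: right.
have [c|nc] := pselect (col_straddles i j); first exact: up.
case: V => [aij|[_ r]|[_ c]] //.
exists [::]; split=> //= a b aab ia jb.
have [[-> ->]|/eqP ne] := pselect ((a, b) = (i, j)); first by rewrite mem_head.
apply/orP; right; apply/andP; split.
  rewrite ltn_neqAle ia andbT; apply/eqP => e; subst a; apply: nc; split; first by exists j.
  by exists b => //; move: ne; rewrite xpair_eqE eqxx /=; lia.
rewrite ltn_neqAle jb andbT; apply/eqP => e; subst b; apply: nr; split; first by exists i.
by exists a => //; move: ne; rewrite xpair_eqE eqxx andbT /=; lia.
Qed.

Lemma run_last b bs : run b bs -> let e := last b bs in
  [/\ act e.1 e.2, ~ row_straddles e.1 e.2 & ~ col_straddles e.1 e.2].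
Proof. by elim: bs b => //= b' bs IH b [_ /IH]. Qed.

Lemma run_end_separates b bs : run b bs -> separates (last b bs).1 (last b bs).2.
Proof.
move=> /run_last /=; move: (last b bs) => e [ae nr nc].
have := act_block ae; rewrite /is_block => be.
split; [lia|lia|move=> a c aac].
have := act_chain aac ae; rewrite /cmp_block => /orP[->//|/andP[h1 h2]].
have [<-|/eqP ne] := pselect ((a, c) = e); first by rewrite !leqnn.
apply/orP; right; apply/andP; split.
  rewrite ltn_neqAle h1 andbT; apply/eqP => ee; subst a; apply: nc; split; first by exists e.2.
  exists c => //; rewrite ltn_neqAle h2 andbT; apply/eqP => e2.
  by move: ne; rewrite -e2 -surjective_pairing eqxx.
rewrite ltn_neqAle h2 andbT; apply/eqP => ee; subst c; apply: nr; split; first by exists e.1.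
exists a => //; rewrite ltn_neqAle h1 andbT; apply/eqP => e1.
by move: ne; rewrite -e1 -surjective_pairing eqxx.
Qed.

(* A segment is given by its first and last vertices together with, for a
   P-segment, the sequence of blocks that it visits ([None] for an N-segment). *)
Definition seg : Type := (nat * nat) * (nat * nat) * option (nat * nat * seq (nat * nat)).

Definition valid_P (v v' : nat * nat) (b : nat * nat) bs :=
  [/\ separates v.1 v.2, b = (v.1.+1, v.2.+1), act b.1 b.2, run b bs & v' = last b bs].

(** The last clause prevents an N-segment from passing over an active block. *)
Definition valid_N (v v' : nat * nat) :=
  [/\ v <> v', (v.1 <= v'.1)%N && (v.2 <= v'.2)%N, separates v.1 v.2, separates v'.1 v'.2 &
   forall a b, act a b -> (v.1 < a)%N -> (v'.1 < a)%N && (v'.2 < b)%N].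

(** The flag [allowN] is false right after an N-segment, which rules out two in a row. *)
Fixpoint itinerary (v : nat * nat) (allowN : bool) (ss : seq seg) : Prop :=
  match ss with
  | [::] => v = (m, n)
  | (v0, v1, Some (b, bs)) :: ss' =>
     [/\ v0 = v, valid_P v0 v1 b bs & itinerary v1 true ss']
  | (v0, v1, None) :: ss' =>
     [/\ v0 = v, valid_N v0 v1, allowN : Prop & itinerary v1 false ss']
  end.

Definition visited (sg : seg) : seq (nat * nat) :=
  if sg.2 is Some (b, bs) then b :: bs else [::].

(** Among the active blocks beyond the vertex, the one with least index sum is smallest in both
    coordinates, because the blocks form a chain. The next run starts there, after an N-segment to
    its lower left vertex if that is a different one. *)
Lemma itinerary_exists i j : separates i j -> exists ss, itinerary (i, j) true ss /\
  forall a b, act a b -> (i < a)%N -> (j < b)%N -> (a, b) \in flatten (map visited ss).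
Proof.
have [d] := ubnP ((m - i) + (n - j))%N; elim: d i j => // d IH i j.
rewrite ltnS => hd sij; have [im jn sep] := sij.
have [[a0 [b0 [ab0 ia0]]]|none] := pselect (exists a b, act a b /\ (i < a)%N); last first.
  have [ij|/eqP ij] := pselect ((i, j) = (m, n)).
    by exists [::]; split => // a b aab ia; exfalso; apply: none; exists a, b.
  exists [:: ((i, j), (m, n), None)]; split; last first.
    by move=> a b aab ia; exfalso; apply: none; exists a, b.
  split => //; split => //=; [exact/eqP|by rewrite im jn| |].
    split => // a b aab; have := act_block aab; rewrite /is_block; lia.
  by move=> a b aab ia; exfalso; apply: none; exists a, b.
have ex : exists k, `[< exists a b, [/\ act a b, (i < a)%N & (a + b)%N = k] >].
  by exists (a0 + b0)%N; apply/asboolP; exists a0, b0.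
have [k /asboolP[a [b [aab ia abk]]] kmin] := ex_minnP ex.
have jb : (j < b)%N by have := sep _ _ aab; lia.
have least a' b' : act a' b' -> (i < a')%N -> ((a <= a') && (b <= b'))%N.
  move=> aab' ia'; have := act_chain aab aab'; rewrite /cmp_block => /orP[//|/andP[h1 h2]].
  have : (k <= a' + b')%N by apply: kmin; apply/asboolP; exists a', b'.
  lia.
have blab := act_block aab.
have sab : separates a.-1 b.-1.
  split; [by move: blab; rewrite /is_block; lia|by move: blab; rewrite /is_block; lia|].
  move=> a' b' aab'; have := sep _ _ aab'; have [ia'|ia'] := ltnP i a'.
    by have := least _ _ aab' ia'; move: blab; rewrite /is_block; lia.
  by move: blab; rewrite /is_block; lia.
have [bs [rbs H]] : exists bs, run (a, b) bs /\
  let e := last (a, b) bs in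
  forall a' b', act a' b' -> (a <= a')%N -> (b <= b')%N ->
    ((a', b') \in (a, b) :: bs) || ((e.1 < a') && (e.2 < b'))%N.
  by apply: run_exists; split => //; exact: Or31.
set e := last (a, b) bs in H.
have se : separates e.1 e.2 by exact: run_end_separates.
have ae : ((a <= e.1) && (b <= e.2))%N.
  rewrite /e; move: (rbs); elim: (bs) (a) (b) => [|[c c'] bs' IHbs] a' b' /=; first by rewrite !leqnn.
  by move=> [[[_ [-> ->]]|[_ [-> ->]]] /IHbs]; lia.
have [|ss [iss Hss]] := IH e.1 e.2 _ se.
  by have := act_block (let: And3 p _ _ := run_last rbs in p); rewrite -/e /is_block; lia.
rewrite -surjective_pairing in iss.
have vP : valid_P (a.-1, b.-1) e (a, b) bs.
  by split=> //=; congr (_, _); move: blab; rewrite /is_block; lia.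
have iP : itinerary (a.-1, b.-1) true (((a.-1, b.-1), e, Some ((a, b), bs)) :: ss) by split.
have cov a' b' : act a' b' -> (i < a')%N -> (j < b')%N ->
    (a', b') \in flatten (map visited (((a.-1, b.-1), e, Some ((a, b), bs)) :: ss)).
  move=> aab' ia' jb'; have /andP[l1 l2] := least _ _ aab' ia'.
  rewrite /= -cat_cons mem_cat; have /orP[->//|/andP[h1 h2]] := H _ _ aab' l1 l2.
  by apply/orP; right; exact: Hss.
have [ij|/eqP ij] := pselect ((i, j) = (a.-1, b.-1)).
  by rewrite ij; exists (((a.-1, b.-1), e, Some ((a, b), bs)) :: ss); split.
exists (((i, j), (a.-1, b.-1), None) :: ((a.-1, b.-1), e, Some ((a, b), bs)) :: ss); split => //.
split => //; split => //=; [exact/eqP|by move: blab; rewrite /is_block; lia|].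
by move=> a' b' aab' ia'; have := least _ _ aab' ia'; move: blab; rewrite /is_block; lia.
Qed.

End Walk.

(** * Where a run crosses the gridlines *)

Section HalfGeometry.
Context {R : realType}.
Variables (m n : nat) (act : nat -> nat -> bool) (x y : nat -> nat -> R) (ds dt : nat -> R).
Hypothesis act_block : forall i j, act i j -> is_block m n i j.
Hypothesis act_chain : forall i j i' j', act i j -> act i' j' -> cmp_block i j i' j'.
Hypothesis act_pos : forall i j, act i j -> 0 < x i j /\ 0 < y i j.
Hypothesis act_zero : forall i j, ~~ act i j -> x i j = 0 /\ y i j = 0.
Hypothesis row_full : forall i j, act i j -> \sum_(1 <= k < m.+1) y k j = dt j.
Hypothesis col_full : forall i j, act i j -> \sum_(1 <= k < n.+1) x i k = ds i.

Local Notation rs := (row_straddles act).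
Local Notation cs := (col_straddles act).

Lemma ally_ge0 i j : 0 <= y i j.
Proof. by have [/act_pos[_ /ltW]|/act_zero[_ ->]] := boolP (act i j). Qed.

(** Together with [straddle_sum_lt]: the curve crosses the line s_i in row [j] strictly between the
    two ends of the edge, hence not at a vertex. *)
Lemma straddle_sum_pos i j : rs i j -> 0 < \sum_(1 <= k < i.+1) y k j.
Proof.
move=> [[k ki ak] _]; have := act_block ak; rewrite /is_block => bk.
rewrite (bigD1_seq k) ?iota_uniq ?mem_index_iota//=; last by lia.
by rewrite ltr_pwDl//; [case: (act_pos ak)|apply: sumr_ge0 => l _; exact: ally_ge0].
Qed.

Lemma straddle_sum_lt i j : rs i j -> \sum_(1 <= k < i.+1) y k j < dt j.
Proof.
move=> [_ [l il al]]; have := act_block al; rewrite /is_block => bl.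
rewrite -(row_full al) (@big_cat_nat _ _ _ i.+1 1 m.+1)//=; [|lia..].
rewrite ltrDl (bigD1_seq l) ?iota_uniq ?mem_index_iota//=; last by lia.
by rewrite ltr_pwDl//; [case: (act_pos al)|apply: sumr_ge0 => k _; exact: ally_ge0].
Qed.

(** An active block of column i + 1 below row [j] would be incomparable with the active block of row
    [j] on the left. Hence the run enters the next column exactly on its left gridline. *)
Lemma straddle_next_zero i j : rs i j -> \sum_(1 <= k < j) x i.+1 k = 0.
Proof.
move=> [[k ki ak] _]; rewrite big_nat big1// => l /andP[l1 lj].
have [a|/act_zero[]//] := boolP (act i.+1 l).
by have := act_chain a ak; rewrite /cmp_block; lia.
Qed.

Lemma col_sum_full i j : act i j -> ~ cs i j -> \sum_(1 <= k < j.+1) x i k = ds i.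
Proof.
move=> a nc; have := act_block a; rewrite /is_block => b.
rewrite -(col_full a) [RHS](@big_cat_nat _ _ _ j.+1 1 n.+1)//=; [|lia].
rewrite [X in _ = _ + X]big_nat [X in _ = _ + X]big1 ?addr0// => l /andP[l1 lj].
have [al|/act_zero[]//] := boolP (act i l).
by exfalso; apply: nc; split; [exists j|exists l].
Qed.

(** An active block in column [i] has to be comparable with active blocks of row [j] on both sides,
    which leaves only (i, j) itself. So [no_dead_column] becomes applicable. *)
Lemma straddled_dead i j : (1 <= i)%N -> rs i.-1 j -> rs i j -> ~~ act i j ->
  (forall k, ~~ act i k) /\ (forall a b, act a b -> cmp_block a b i j).
Proof.
move=> i1 [[k ki ak] _] [_ [l li al]] naij.
have dead b : ~~ act i b.
  apply/negP => a; have := act_chain a ak; have := act_chain a al.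
  rewrite /cmp_block => h1 h2; have e : b = j by lia.
  by rewrite e (negbTE naij) in a.
split=> // a b aab; have h1 := act_chain aab ak; have h2 := act_chain aab al.
have ai : a <> i by move=> e; move: aab; rewrite e (negbTE (dead b)).
by move: h1 h2; rewrite /cmp_block; lia.
Qed.

End HalfGeometry.

Section DiscreteRun.
Context {R : realType}.
Variables (m n : nat) (s t : nat -> R) (W x y : nat -> nat -> R).
Hypotheses (ssub : subdivision 0 1 m s) (tsub : subdivision 0 1 n t).
Hypothesis mx : maximal m n (ds s) (ds t) W x y.
Hypothesis nm : normalized m n W x y.

Local Notation act := (active m n W x y).
Local Notation rs := (row_straddles act).
Local Notation cs := (col_straddles act).

Lemma ds_pos (k : nat) (r : nat -> R) : subdivision 0 1 k r ->
  forall i, (1 <= i <= k)%N -> 0 < ds r i.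
Proof. by move=> sub i ik; rewrite subr_gt0; apply: (sub_lt sub); lia. Qed.

Lemma act_block i j : act i j -> is_block m n i j. Proof. by case/and4P. Qed.
Lemma act_posW i j : act i j -> 0 < W i j. Proof. by case/and4P. Qed.
Lemma act_pos i j : act i j -> 0 < x i j /\ 0 < y i j. Proof. by case/and4P. Qed.
Lemma act_chain i j i' j' : act i j -> act i' j' -> cmp_block i j i' j'.
Proof. exact: (active_cmp mx). Qed.
Lemma act_row_full i j : act i j -> \sum_(1 <= k < m.+1) y k j = ds t j.
Proof. exact: (active_row_full mx). Qed.
Lemma act_col_full i j : act i j -> \sum_(1 <= k < n.+1) x i k = ds s i.
Proof.
by move=> a; apply: (@active_row_full _ n m (ds t) (ds s) (tr W) (tr y) (tr x) (maximal_tr mx) j i); rewrite active_tr.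
Qed.
Lemma act_row_prop i k j : act i j -> act k j ->
  W i j ^+ 2 * x i j * y k j = W k j ^+ 2 * x k j * y i j.
Proof. exact: (active_row_prop mx). Qed.
Lemma act_col_prop i j k : act i j -> act i k ->
  W i j ^+ 2 * y i j * x i k = W i k ^+ 2 * y i k * x i j.
Proof.
move=> a1 a2; apply: (@active_row_prop _ n m (ds t) (ds s) (tr W) (tr y) (tr x) (maximal_tr mx) j k i);
  by rewrite active_tr.
Qed.

Lemma dead_column_W i j : is_block m n i j -> (forall k, ~~ act i k) ->
  (forall a b, act a b -> cmp_block a b i j) -> W i j <= 0.
Proof.
move=> ij dead cmp; rewrite leNgt; apply/negP => w0.
exact: (no_dead_column mx nm (ds_pos ssub) (ds_pos tsub) ij w0).
Qed.

Lemma dead_row_W i j : is_block m n i j -> (forall k, ~~ act k j) ->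
  (forall a b, act a b -> cmp_block a b i j) -> W i j <= 0.
Proof.
move=> ij dead cmp; rewrite leNgt; apply/negP => w0.
apply: (@no_dead_column _ n m (ds t) (ds s) (tr W) (tr y) (tr x) (maximal_tr mx) j i
  (normalized_tr nm) (ds_pos tsub) (ds_pos ssub)) => //.
- by move: ij; rewrite /is_block; lia.
- by move=> k; rewrite active_tr.
- by move=> a b; rewrite active_tr => /cmp; rewrite /cmp_block; lia.
Qed.

Definition vertex (b : nat * nat) : R * R := (s b.1, t b.2).
(* Where the curve enters the block b: the part of column b.1 already used up lies
   in the lower blocks of that column, and similarly for row b.2. *)
Definition block_entry (b : nat * nat) : R * R :=
  (s b.1.-1 + \sum_(1 <= k < b.2) x b.1 k, t b.2.-1 + \sum_(1 <= k < b.1) y k b.2).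

(** An active block is crossed along its increments, a block of weight at most 0 along a line
    parallel to an axis, off the vertices. In the latter case the neighbours are recorded in order
    to trace back the last active block, as P5 and P6 demand. *)
Inductive piece_spec (b : nat * nat) (p q : R * R) (prev next : nat * nat) : Prop :=
| PieceActive of act b.1 b.2 & q.1 = p.1 + x b.1 b.2 & q.2 = p.2 + y b.1 b.2 &
    s b.1.-1 <= p.1 & q.1 <= s b.1 & t b.2.-1 <= p.2 & q.2 <= t b.2
| PieceHoriz of W b.1 b.2 <= 0 & p.1 = s b.1.-1 & q.1 = s b.1 & q.2 = p.2 &
    t b.2.-1 < p.2 & p.2 < t b.2 & b = (prev.1.+1, prev.2) & next = (b.1.+1, b.2)
| PieceVert of W b.1 b.2 <= 0 & p.2 = t b.2.-1 & q.2 = t b.2 & q.1 = p.1 &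
    s b.1.-1 < p.1 & p.1 < s b.1 & b = (prev.1, prev.2.+1) & next = (b.1, b.2.+1).

Inductive step_spec (b b' : nat * nat) (q : R * R) : Prop :=
| StepRight of b' = (b.1.+1, b.2) & q.1 = s b.1 & t b.2.-1 < q.2 & q.2 < t b.2
| StepUp of b' = (b.1, b.2.+1) & q.2 = t b.2 & s b.1.-1 < q.1 & q.1 < s b.1.

(* At the two ends of the run the conventions [be (0.-1) = be 0] and
   [be L] arbitrary are harmless, since the first and last blocks are active. *)
Record disc_run (f : nat -> R * R) (be : nat -> nat * nat) (L : nat) : Prop := {
  dr_pos : (0 < L)%N;
  dr_block : forall k, (k < L)%N -> is_block m n (be k).1 (be k).2;
  dr_start : f 0%N = vertex ((be 0%N).1.-1, (be 0%N).2.-1);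
  dr_end : f L = vertex (be L.-1);
  dr_act0 : act (be 0%N).1 (be 0%N).2;
  dr_act1 : act (be L.-1).1 (be L.-1).2;
  dr_piece : forall k, (k < L)%N -> piece_spec (be k) (f k) (f k.+1) (be k.-1) (be k.+1);
  dr_step : forall k, (k.+1 < L)%N -> step_spec (be k) (be k.+1) (f k.+1)
}.

Lemma step_spec_of b b' : step act b b' -> step_spec b b' (block_entry b').
Proof.
move=> [[r ->]|[c ->]].
  have z := straddle_next_zero act_chain nm r.
  have p := straddle_sum_pos act_block act_pos nm r.
  have l := straddle_sum_lt act_block act_pos nm act_row_full r.
  apply: StepRight => //=; rewrite ?z ?addr0//; first by lra.
  by move: l; rewrite /ds; lra.
(* The upward step is the step to the right for the transposed data. *)
have nm' i j : ~~ tr act i j -> (tr y) i j = 0 /\ (tr x) i j = 0.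
  by move=> /nm[].
have pos' i j : tr act i j -> 0 < (tr y) i j /\ 0 < (tr x) i j.
  by move=> /act_pos[].
have chain' i j i' j' : tr act i j -> tr act i' j' -> cmp_block i j i' j'.
  by move=> a1 a2; have := act_chain a1 a2; rewrite /cmp_block; lia.
have block' i j : tr act i j -> is_block n m i j.
  by move=> /act_block; rewrite /is_block; lia.
have z := @straddle_next_zero _ (tr act) (tr y) (tr x) chain' nm' b.2 b.1 c.
have p := @straddle_sum_pos _ n m (tr act) (tr y) (tr x) block' pos' nm' b.2 b.1 c.
have l := @straddle_sum_lt _ n m (tr act) (tr y) (tr x) (ds s) block' pos' nm'
  (fun i j a => act_col_full a) b.2 b.1 c.
rewrite /tr in z p l.
apply: StepUp => //=; rewrite ?z ?addr0//; first by lra.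
by move: l; rewrite /ds; lra.
Qed.

End DiscreteRun.

Section DiscreteRun2.
Context {R : realType}.
Variables (m n : nat) (s t : nat -> R) (W x y : nat -> nat -> R).
Hypotheses (ssub : subdivision 0 1 m s) (tsub : subdivision 0 1 n t).
Hypothesis mx : maximal m n (ds s) (ds t) W x y.
Hypothesis nm : normalized m n W x y.

Local Notation act := (active m n W x y).
Local Notation rs := (row_straddles act).
Local Notation cs := (col_straddles act).
Local Notation pt := (block_entry s t x y).
Local Notation vtx := (vertex s t).

Let chainH := act_chain mx.
Let blockH := @act_block R m n W x y.
Let posH := @act_pos R m n W x y.

Let nm' i j : ~~ tr act i j -> (tr y) i j = 0 /\ (tr x) i j = 0.
Proof. by move=> /nm[]. Qed.
Let pos' i j : tr act i j -> 0 < (tr y) i j /\ 0 < (tr x) i j.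
Proof. by move=> /posH[]. Qed.
Let chain' i j i' j' : tr act i j -> tr act i' j' -> cmp_block i j i' j'.
Proof. by move=> a1 a2; have := chainH a1 a2; rewrite /cmp_block; lia. Qed.
Let block' i j : tr act i j -> is_block n m i j.
Proof. by move=> /blockH; rewrite /is_block; lia. Qed.

Lemma act_col_sum i j : act i j -> ~ cs i j -> \sum_(1 <= k < j.+1) x i k = ds s i.
Proof. exact: (col_sum_full blockH nm (act_col_full mx)). Qed.

Lemma act_row_sum i j : act i j -> ~ rs i j -> \sum_(1 <= k < i.+1) y k j = ds t j.
Proof.
move=> a nr; apply: (@col_sum_full _ n m (tr act) (tr y) (tr x) (ds t) block' nm' _ j i) => //.
by move=> i' j' a'; exact: (@act_row_full _ m n s t W x y mx j' i' a').
Qed.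

Lemma x_ge0 i j : 0 <= x i j.
Proof.
have [a|a] := boolP (act i j); first by case: (posH a) => /ltW.
by case: (nm a) => ->.
Qed.
Lemma y_ge0 i j : 0 <= y i j.
Proof.
have [a|a] := boolP (act i j); first by case: (posH a) => _ /ltW.
by case: (nm a) => _ ->.
Qed.

Lemma row_dead i j : (1 <= i)%N -> rs i.-1 j -> rs i j -> ~~ act i j ->
  (forall k, ~~ act i k) /\ (forall a b, act a b -> cmp_block a b i j).
Proof. exact: (straddled_dead chainH). Qed.

Lemma col_dead i j : (1 <= j)%N -> cs i j.-1 -> cs i j -> ~~ act i j ->
  (forall k, ~~ act k j) /\ (forall a b, act a b -> cmp_block a b i j).
Proof.
move=> j1 c1 c2 na.
have [h1 h2] := @straddled_dead (tr act) chain' j i j1 c1 c2 na.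
split=> [k|a b aab]; first exact: h1.
by have := h2 b a aab; rewrite /cmp_block; lia.
Qed.

Lemma zero_right i j : rs i j -> \sum_(1 <= k < j) x i.+1 k = 0.
Proof. exact: (straddle_next_zero chainH nm). Qed.

Lemma zero_up i j : cs i j -> \sum_(1 <= k < i) y k j.+1 = 0.
Proof. by move=> c; exact: (@straddle_next_zero _ (tr act) (tr y) (tr x) chain' nm' j i c). Qed.

Section OneRun.
Variables (b0 : nat * nat) (bs : seq (nat * nat)).
Hypothesis start : separates m n act b0.1.-1 b0.2.-1.
Hypothesis act0 : act b0.1 b0.2.
Hypothesis runH : run act b0 bs.

Let L := (size bs).+1.
Definition run_block k := nth (0%N, 0%N) (b0 :: bs) k.
Definition run_node k := if (k < (size bs).+1)%N then pt (run_block k) else vtx (last b0 bs).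
Local Notation be := run_block.
Local Notation f := run_node.

Lemma run_step k : (k.+1 < L)%N -> step act (be k) (be k.+1).
Proof.
rewrite /L /run_block; move: runH; elim: (bs) (b0) k => [|b' bs' IH] b k //= [st r].
by case: k => [|k] //= kl; exact: IH.
Qed.

Lemma run_block_last : be L.-1 = last b0 bs.
Proof. exact: (nth_last (0%N, 0%N) (b0 :: bs)). Qed.

Lemma run_lastP : [/\ act (last b0 bs).1 (last b0 bs).2,
  ~ rs (last b0 bs).1 (last b0 bs).2 & ~ cs (last b0 bs).1 (last b0 bs).2].
Proof. exact: run_last runH. Qed.

Definition visit_spec k :=
  [\/ act (be k).1 (be k).2,
    [/\ (0 < k)%N /\ (k.+1 < L)%N, be k = ((be k.-1).1.+1, (be k.-1).2) /\ be k.+1 = ((be k).1.+1, (be k).2),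
        rs (be k.-1).1 (be k.-1).2, rs (be k).1 (be k).2 & ~~ act (be k).1 (be k).2] |
    [/\ (0 < k)%N /\ (k.+1 < L)%N, be k = ((be k.-1).1, (be k.-1).2.+1) /\ be k.+1 = ((be k).1, (be k).2.+1),
        cs (be k.-1).1 (be k.-1).2, cs (be k).1 (be k).2 & ~~ act (be k).1 (be k).2]].

(** The active block ahead that justified the step into an inactive block lies beyond this block, so
    the row or column is straddled again; by [straddles_excl] the run goes straight on. *)
Lemma run_visit k : (k < L)%N -> visit_spec k.
Proof.
case: k => [_|k kL]; first by apply: Or31.
have [a|na] := boolP (act (be k.+1).1 (be k.+1).2); first by apply: Or31.
have kL' : (k.+2 < L)%N.
  rewrite ltn_neqAle kL andbT; apply/eqP => e; move: na.
  have -> : k.+1 = L.-1 by rewrite -e.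
  by rewrite run_block_last; case: run_lastP => ->.
have st := run_step kL; have st' := run_step kL'.
move: st; case=> [[r E]|[c E]].
  have r' : rs (be k.+1).1 (be k.+1).2.
    have [[k0 k0i ak] [l il al]] := r; rewrite E /=; split; first by exists k0 => //; lia.
    exists l => //; rewrite ltn_neqAle il andbT; apply/eqP => e.
    by move: na; rewrite E /= e al.
  apply: Or32; split => //.
  split => //.
  by case: st' => [[_ E']|[c' _]] //; case: (straddles_excl chainH r' c').
have c' : cs (be k.+1).1 (be k.+1).2.
  have [[k0 k0i ak] [l il al]] := c; rewrite E /=; split; first by exists k0 => //; lia.
  exists l => //; rewrite ltn_neqAle il andbT; apply/eqP => e.
  by move: na; rewrite E /= e al.
apply: Or33; split => //.
split => //.
by case: st' => [[r' _]|[_ E']] //; case: (straddles_excl chainH r' c').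
Qed.

Lemma run_is_block k : (k < L)%N -> is_block m n (be k).1 (be k).2.
Proof.
move=> kL; case: (run_visit kL) => [/blockH//|[[k0 _] [E _] [[a ha aa] _] [_ [l hl al]] _]|
   [[k0 _] [E _] [[a ha aa] _] [_ [l hl al]] _]].
  have := blockH aa; have := blockH al; rewrite E /= in hl *; rewrite /is_block; lia.
have := blockH aa; have := blockH al; rewrite E /= in hl *; rewrite /is_block; lia.
Qed.

Lemma node_next k : (k.+1 < L)%N -> f k.+1 = pt (be k.+1).
Proof. by move=> kL; rewrite /run_node -/L kL. Qed.

Lemma node_at k : (k < L)%N -> f k = pt (be k).
Proof. by move=> kL; rewrite /run_node -/L kL. Qed.

Lemma sum_recr (z : nat -> R) i : (1 <= i)%N ->
  \sum_(1 <= k < i.+1) z k = \sum_(1 <= k < i) z k + z i.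
Proof. by move=> i1; rewrite big_nat_recr. Qed.

Lemma run_piece k : (k < L)%N -> piece_spec m n s t W x y (be k) (f k) (f k.+1) (be k.-1) (be k.+1).
Proof.
move=> kL; have bk := run_is_block kL; rewrite (node_at kL).
have b1 : (1 <= (be k).1)%N by move: bk; rewrite /is_block; lia.
have b2 : (1 <= (be k).2)%N by move: bk; rewrite /is_block; lia.
case: (run_visit kL) => [a|[[k0 kL'] [E E'] r r' na]|[[k0 kL'] [E E'] c c' na]].
(* If the run leaves to the right, no block further up in this column is active; the column is then
   exactly used up and the exit point lies on its right gridline. Upwards likewise, and at the end
   of the run both hold. *)
- have [q1 q2] : (f k.+1).1 = (pt (be k)).1 + x (be k).1 (be k).2 /\
      (f k.+1).2 = (pt (be k)).2 + y (be k).1 (be k).2.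
    have [kL'|kL'] := ltnP k.+1 L.
      rewrite node_next//; case: (run_step kL') => [[r ->]|[c ->]].
        have nc : ~ cs (be k).1 (be k).2 by move=> c; exact: (straddles_excl chainH r c).
        have := act_col_sum a nc; rewrite sum_recr// /block_entry /ds /= zero_right// sum_recr// => h.
        by split; lra.
      have nr : ~ rs (be k).1 (be k).2 by move=> r; exact: (straddles_excl chainH r c).
      have := act_row_sum a nr; rewrite sum_recr// /block_entry /ds /= zero_up// sum_recr// => h.
      by split; lra.
    have kE : k = L.-1 by lia.
    have -> : f k.+1 = vtx (last b0 bs) by rewrite /run_node -/L ltnNge kL'.
    have EL : be k = last b0 bs by rewrite kE run_block_last.
    have [al nr nc] := run_lastP; rewrite -EL in al nr nc *.
    have := act_row_sum al nr; have := act_col_sum al nc.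
    by rewrite !sum_recr// /block_entry /vertex /ds /= => h1 h2; split; lra.
  have rsum : \sum_(1 <= k1 < (be k).1) y k1 (be k).2 + y (be k).1 (be k).2 <= ds t (be k).2.
    rewrite -sum_recr// -(act_row_full mx a) [leRHS](@big_cat_nat _ _ _ (be k).1.+1)//=; last first.
      by move: bk; rewrite /is_block; lia.
    by rewrite lerDl; apply: sumr_ge0 => l _; exact: y_ge0.
  have csum : \sum_(1 <= k1 < (be k).2) x (be k).1 k1 + x (be k).1 (be k).2 <= ds s (be k).1.
    rewrite -sum_recr// -(act_col_full mx a) [leRHS](@big_cat_nat _ _ _ (be k).2.+1)//=; last first.
      by move: bk; rewrite /is_block; lia.
    by rewrite lerDl; apply: sumr_ge0 => l _; exact: x_ge0.
  rewrite /ds in rsum csum.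
  apply: PieceActive => //.
  + by rewrite /block_entry /= lerDl; apply: sumr_ge0 => l _; exact: x_ge0.
  + by rewrite q1 /block_entry /=; lra.
  + by rewrite /block_entry /= lerDl; apply: sumr_ge0 => l _; exact: y_ge0.
  + by rewrite q2 /block_entry /=; lra.
- have [dead cmp] : (forall k1, ~~ act (be k).1 k1) /\ (forall a b, act a b -> cmp_block a b (be k).1 (be k).2).
    by apply: row_dead => //; rewrite E /=.
  have z1 : \sum_(1 <= k1 < (be k).2) x (be k).1 k1 = 0.
    by rewrite big1// => l _; have [] := nm (dead l).
  have z2 : y (be k).1 (be k).2 = 0 by have [] := nm na.
  have p := straddle_sum_pos blockH posH nm r'.
  have l := straddle_sum_lt blockH posH nm (act_row_full mx) r'.
  have zr := zero_right r'.
  rewrite sum_recr// z2 addr0 in p l.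
  rewrite node_next// E'; apply: PieceHoriz => //=.
  + exact: (dead_column_W ssub tsub mx nm).
  + by rewrite z1 addr0.
  + by rewrite zr addr0.
  + by rewrite sum_recr// z2 addr0.
  + by lra.
  + by move: l; rewrite /ds; lra.
- have [dead cmp] : (forall k1, ~~ act k1 (be k).2) /\ (forall a b, act a b -> cmp_block a b (be k).1 (be k).2).
    by apply: col_dead => //; rewrite E /=.
  have z1 : \sum_(1 <= k1 < (be k).1) y k1 (be k).2 = 0.
    by rewrite big1// => l _; have [] := nm (dead l).
  have z2 : x (be k).1 (be k).2 = 0 by have [] := nm na.
  have p := @straddle_sum_pos _ n m (tr act) (tr y) (tr x) block' pos' nm' _ _ c'.
  have l := @straddle_sum_lt _ n m (tr act) (tr y) (tr x) (ds s) block' pos' nm' (fun i j a => act_col_full mx a) _ _ c'.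
  have zr := zero_up c'.
  rewrite /tr sum_recr// z2 addr0 in p l.
  rewrite node_next// E'; apply: PieceVert => //=.
  + exact: (dead_row_W ssub tsub mx nm).
  + by rewrite z1 addr0.
  + by rewrite zr addr0.
  + by rewrite sum_recr// z2 addr0.
  + by lra.
  + by move: l; rewrite /ds; lra.
Qed.

(** As the vertex separates, no active block precedes [b0] in its column or row, and both partial
    sums vanish. *)
Lemma pt_start : pt b0 = vtx (b0.1.-1, b0.2.-1).
Proof.
have [_ _ sep] := start; rewrite /block_entry /vertex /=; have := blockH act0; rewrite /is_block => b.
congr (_, _); rewrite big_nat big1 ?addr0// => k /andP[k1 kb].
  have [a|/nm[]//] := boolP (act b0.1 k).
  by have := sep _ _ a; lia.
have [a|/nm[]//] := boolP (act k b0.2).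
by have := sep _ _ a; lia.
Qed.

Lemma run_disc : disc_run m n s t W x y f be L.
Proof.
split => //.
- exact: run_is_block.
- by rewrite node_at// -pt_start.
- by rewrite run_block_last /run_node -/L ltnn.
- by rewrite run_block_last; case: run_lastP.
- exact: run_piece.
- move=> k kL; rewrite node_next//.
  exact: (step_spec_of mx nm (run_step kL)).
Qed.

End OneRun.
End DiscreteRun2.

(** * P-segments *)

Section MonotonePolygon.
Context {R : realType}.
Variables (nd : nat -> R * R) (K : nat).

Definition polygon (z : R) : R * R :=
  (polyline (fun k => (nd k).1) K z, polyline (fun k => (nd k).2) K z).
Definition knot (k : nat) : R := k%:R / K%:R.

(** The strict growth of the sum of the coordinates makes the polygon injective. *)
Definition monotone_nodes := [/\ (0 < K)%N, nd 0%N = (0, 0), nd K = (1, 1) &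
  forall k, (k < K)%N -> [/\ (nd k).1 <= (nd k.+1).1, (nd k).2 <= (nd k.+1).2 &
     (nd k).1 + (nd k).2 < (nd k.+1).1 + (nd k.+1).2]].
Hypothesis nodes : monotone_nodes.

Let K0 : (0 < K)%N. Proof. by case: nodes. Qed.
Let m1 k : (k < K)%N -> (nd k).1 <= (nd k.+1).1.
Proof. by case: nodes => _ _ _ H /H[]. Qed.
Let m2 k : (k < K)%N -> (nd k).2 <= (nd k.+1).2.
Proof. by case: nodes => _ _ _ H /H[]. Qed.
Let m3 k : (k < K)%N -> (nd k).1 + (nd k).2 < (nd k.+1).1 + (nd k.+1).2.
Proof. by case: nodes => _ _ _ H /H[]. Qed.
Let KR : 0 < K%:R :> R. Proof. by rewrite ltr0n. Qed.

Lemma knot_lt k l : (knot k < knot l) = (k < l)%N.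
Proof. by rewrite /knot ltr_pM2r ?invr_gt0// ltr_nat. Qed.
Lemma knot_le k l : (knot k <= knot l) = (k <= l)%N.
Proof. by rewrite /knot ler_pM2r ?invr_gt0// ler_nat. Qed.
Lemma knot_ge0 k : 0 <= knot k. Proof. by rewrite /knot divr_ge0. Qed.
Lemma knot_le1 k : (k <= K)%N -> knot k <= 1.
Proof. by move=> kK; rewrite /knot ler_pdivrMr// mul1r ler_nat. Qed.

Lemma polygon_knot k : (k <= K)%N -> polygon (knot k) = nd k.
Proof. by move=> kK; rewrite /polygon /knot !polyline_node// -surjective_pairing. Qed.

Lemma polygon_homo1 x y : x <= y -> (polygon x).1 <= (polygon y).1.
Proof. by move=> xy; exact: polyline_homo. Qed.
Lemma polygon_homo2 x y : x <= y -> (polygon x).2 <= (polygon y).2.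
Proof. by move=> xy; exact: polyline_homo. Qed.

Lemma polygon_piece k z : (k < K)%N -> knot k <= z -> z <= knot k.+1 ->
  exists2 r : R, r = K%:R * z - k%:R & [/\ 0 <= r, r <= 1,
    (polygon z).1 = (nd k).1 + r * ((nd k.+1).1 - (nd k).1) &
    (polygon z).2 = (nd k).2 + r * ((nd k.+1).2 - (nd k).2)].
Proof.
rewrite /knot ler_pdivrMr// ler_pdivlMr// mulrC => kK kz zk.
exists (K%:R * z - k%:R) => //; split.
- by lra.
- by move: zk; rewrite -natr1; lra.
- by rewrite /polygon /= /polyline (@pol_piece _ _ _ k).
- by rewrite /polygon /= /polyline (@pol_piece _ _ _ k).
Qed.

Lemma polygon_piece_oo k z : (k < K)%N -> knot k < z -> z < knot k.+1 ->
  exists2 r : R, 0 < r /\ r < 1 & [/\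
    (polygon z).1 = (nd k).1 + r * ((nd k.+1).1 - (nd k).1) &
    (polygon z).2 = (nd k).2 + r * ((nd k.+1).2 - (nd k).2)].
Proof.
move=> kK kz zk; have [r rE [_ _ h1 h2]] := polygon_piece kK (ltW kz) (ltW zk).
exists r => //; move: kz zk; rewrite /knot ltr_pdivrMr// ltr_pdivlMr// mulrC rE -natr1; lra.
Qed.

Lemma knot_find z : 0 <= z -> z < 1 -> exists k, [/\ (k < K)%N, knot k <= z & z < knot k.+1].
Proof.
move=> z0 z1; have w1 : K%:R * z < K%:R by rewrite -[ltRHS]mulr1 ltr_pM2l.
have [k [kK h1 h2]] := piece_exists (mulr_ge0 (ltW KR) z0) w1.
by exists k; split; rewrite // /knot ?ler_pdivrMr ?ltr_pdivlMr// mulrC.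
Qed.

Lemma polygon_strict x y : 0 <= x -> x < y -> y <= 1 ->
  (polygon x).1 + (polygon x).2 < (polygon y).1 + (polygon y).2.
Proof.
move=> x0 xy y1; have [k [kK kx xk]] := knot_find x0 (lt_le_trans xy y1).
pose y' := Num.min y (knot k.+1).
have xy' : x < y' by rewrite lt_min xy xk.
have y'k : y' <= knot k.+1 by rewrite ge_min lexx orbT.
have y'y : y' <= y by rewrite ge_min lexx.
have [r rE [_ _ h1 h2]] := polygon_piece kK kx (ltW xk).
have [r' rE' [_ _ h1' h2']] := polygon_piece kK (le_trans kx (ltW xy')) y'k.
have rr : r < r' by rewrite rE rE' ltrD2r ltr_pM2l.
have p1 := polygon_homo1 y'y; have p2 := polygon_homo2 y'y.
suff : (polygon x).1 + (polygon x).2 < (polygon y').1 + (polygon y').2 by lra.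
rewrite h1 h2 h1' h2'; have := m3 kK.
set a := (nd k).1; set b := (nd k).2; set c := (nd k.+1).1; set d := (nd k.+1).2 => h.
have : 0 < (r' - r) * (c + d - (a + b)) by rewrite mulr_gt0//; lra.
lra.
Qed.

Lemma polygon_inj x y : 0 <= x -> x <= 1 -> 0 <= y -> y <= 1 -> polygon x = polygon y -> x = y.
Proof.
move=> x0 x1 y0 y1 e; case: (ltgtP x y) => // xy.
  by have := polygon_strict x0 xy y1; rewrite e ltxx.
by have := polygon_strict y0 xy x1; rewrite e ltxx.
Qed.

Lemma polygon_linear k : (k < K)%N -> linear_on polygon `[knot k, knot k.+1].
Proof.
move=> kK; exists (nd k - k%:R *: (nd k.+1 - nd k)), (K%:R *: (nd k.+1 - nd k)).
move=> z; rewrite /= in_itv/= => /andP[kz zk].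
have [r rE [_ _ h1 h2]] := polygon_piece kK kz zk.
by apply: injective_projections; rewrite ?h1 ?h2 rE /= /GRing.scale/=; ring.
Qed.

Lemma polygon_Gamma : Gamma_tilde (fun z => (polygon z).1) /\ Gamma_tilde (fun z => (polygon z).2).
Proof.
case: (nodes) => _ n0 nK _.
split; apply: polyline_Gamma_tilde => //; by rewrite ?n0 ?nK.
Qed.

Section Block.
Variables (m n : nat) (s t : nat -> R).
Hypotheses (ssub : subdivision 0 1 m s) (tsub : subdivision 0 1 n t).

Lemma cell_closed i i' (k : nat) (r : nat -> R) (w : R) : subdivision 0 1 k r ->
  (1 <= i <= k)%N -> (1 <= i' <= k)%N -> r i.-1 <= w -> w <= r i -> r i'.-1 < w -> w < r i' -> i = i'.
Proof.
move=> sub ik ik' h1 h2 h3 h4.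
have a1 : (i.-1 < i')%N by apply: (sub_lt_idx sub); [lia|lia|lra].
have a2 : (i'.-1 < i)%N by apply: (sub_lt_idx sub); [lia|lia|lra].
lia.
Qed.

Lemma preimage_convex i j x y z : block_preimage s t polygon i j x ->
  block_preimage s t polygon i j y -> x <= z -> z <= y -> block_preimage s t polygon i j z.
Proof.
move=> [x01 [h1 h2 h3 h4]] [y01 [h1' h2' h3' h4']] xz zy.
have a1 := polygon_homo1 xz; have a2 := polygon_homo1 zy.
have b1 := polygon_homo2 xz; have b2 := polygon_homo2 zy.
move: x01 y01; rewrite !in_itv/= => /andP[x0 x1] /andP[y0 y1].
split; first by rewrite in_itv/=; apply/andP; split; lra.
by split; lra.
Qed.

Variables (W x y : nat -> nat -> R).
Hypothesis mx : maximal m n (ds s) (ds t) W x y.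
Variables (f : nat -> R * R) (be : nat -> nat * nat) (L c : nat).
Hypothesis dr : disc_run m n s t W x y f be L.
Hypothesis cL : (c + L <= K)%N.
Hypothesis fE : forall k, (k <= L)%N -> nd (c + k)%N = f k.

Local Notation a := (knot c).
Local Notation b := (knot (c + L)).
Local Notation pre := (block_preimage s t polygon).
Local Notation Hs := (H s t polygon).

Let ck k : (k < L)%N -> (c + k < K)%N. Proof. by move: cL; lia. Qed.

Lemma run_block_range k : (k < L)%N -> ((1 <= (be k).1 <= m) && (1 <= (be k).2 <= n))%N.
Proof. by move/(dr_block dr); rewrite /is_block; lia. Qed.

Lemma run_open k z : (k < L)%N -> knot (c + k) < z -> z < knot (c + k).+1 ->
  [/\ s (be k).1.-1 < (polygon z).1, (polygon z).1 < s (be k).1,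
      t (be k).2.-1 < (polygon z).2 & (polygon z).2 < t (be k).2].
Proof.
move=> kL kz zk; have [r [r0 r1] [-> ->]] := polygon_piece_oo (ck kL) kz zk.
rewrite -addnS !fE//; last exact: ltnW.
have /andP[bi bj] := run_block_range kL.
have sl : s (be k).1.-1 < s (be k).1 by apply: (sub_lt ssub); lia.
have tl : t (be k).2.-1 < t (be k).2 by apply: (sub_lt tsub); lia.
case: (dr_piece dr kL) => [aa h1 h2 h3 h4 h5 h6|w h1 h2 h3 h4 h5 _ _|w h1 h2 h3 h4 h5 _ _].
- have [x0 y0] := act_pos aa; rewrite h1 h2 in h4 h6 *.
  have q1 : 0 < r * x (be k).1 (be k).2 by rewrite mulr_gt0.
  have q2 : 0 < r * y (be k).1 (be k).2 by rewrite mulr_gt0.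
  have q3 : 0 < (1 - r) * x (be k).1 (be k).2 by rewrite mulr_gt0//; lra.
  have q4 : 0 < (1 - r) * y (be k).1 (be k).2 by rewrite mulr_gt0//; lra.
  by split; lra.
- rewrite h1 h2 h3 subrr mulr0 addr0.
  have q1 : 0 < r * (s (be k).1 - s (be k).1.-1) by rewrite mulr_gt0//; lra.
  have q3 : 0 < (1 - r) * (s (be k).1 - s (be k).1.-1) by rewrite mulr_gt0//; lra.
  by split; lra.
- rewrite h1 h2 h3 subrr mulr0 addr0.
  have q1 : 0 < r * (t (be k).2 - t (be k).2.-1) by rewrite mulr_gt0//; lra.
  have q3 : 0 < (1 - r) * (t (be k).2 - t (be k).2.-1) by rewrite mulr_gt0//; lra.
  by split; lra.
Qed.

Lemma run_open_block k z i j : (k < L)%N -> knot (c + k) < z -> z < knot (c + k).+1 ->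
  is_block m n i j -> pre i j z -> (i, j) = be k.
Proof.
move=> kL kz zk ij [_ [h1 h2 h3 h4]]; have [g1 g2 g3 g4] := run_open kL kz zk.
have /andP[bi bj] := run_block_range kL; rewrite [be k]surjective_pairing.
congr (_, _).
  by apply: (cell_closed ssub _ bi h1 h2 g1 g2); case/and4P: ij => *; apply/andP.
by apply: (cell_closed tsub _ bj h3 h4 g3 g4); case/and4P: ij => *; apply/andP.
Qed.

Lemma run_closed k z : (k < L)%N -> knot (c + k) <= z -> z <= knot (c + k).+1 ->
  pre (be k).1 (be k).2 z.
Proof.
move=> kL kz zk.
have z01 : z \in `[0, 1].
  rewrite in_itv/= (le_trans (knot_ge0 _) kz)/= (le_trans zk)//; apply: knot_le1.
  by have := ck kL; lia.
split => //; have [r rE [r0 r1 e1 e2]] := polygon_piece (ck kL) kz zk.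
have /andP[bi bj] := run_block_range kL.
have sl : s (be k).1.-1 < s (be k).1 by apply: (sub_lt ssub); lia.
have tl : t (be k).2.-1 < t (be k).2 by apply: (sub_lt tsub); lia.
move: e1 e2; rewrite -addnS !fE//; last exact: ltnW.
case: (dr_piece dr kL) => [aa h1 h2 h3 h4 h5 h6|w h1 h2 h3 h4 h5 _ _|w h1 h2 h3 h4 h5 _ _] e1 e2.
- have [x0 y0] := act_pos aa; rewrite h1 h2 in h4 h6 e1 e2.
  have q1 : 0 <= r * x (be k).1 (be k).2 by rewrite mulr_ge0// ltW.
  have q2 : 0 <= r * y (be k).1 (be k).2 by rewrite mulr_ge0// ltW.
  have q3 : 0 <= (1 - r) * x (be k).1 (be k).2 by rewrite mulr_ge0//; lra.
  have q4 : 0 <= (1 - r) * y (be k).1 (be k).2 by rewrite mulr_ge0//; lra.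
  by split; lra.
- rewrite h1 h2 h3 subrr mulr0 addr0 in e1 e2.
  have q1 : 0 <= r * (s (be k).1 - s (be k).1.-1) by rewrite mulr_ge0//; lra.
  have q3 : 0 <= (1 - r) * (s (be k).1 - s (be k).1.-1) by rewrite mulr_ge0//; lra.
  by split; lra.
- rewrite h1 h2 h3 subrr mulr0 addr0 in e1 e2.
  have q1 : 0 <= r * (t (be k).2 - t (be k).2.-1) by rewrite mulr_ge0//; lra.
  have q3 : 0 <= (1 - r) * (t (be k).2 - t (be k).2.-1) by rewrite mulr_ge0//; lra.
  by split; lra.
Qed.

Lemma step_neq k : (k.+1 < L)%N -> be k <> be k.+1.
Proof.
move=> kL; case: (dr_step dr kL) => [-> _ _ _|-> _ _ _].
  by move=> /(congr1 fst) /=; lia.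
by move=> /(congr1 snd) /=; lia.
Qed.

(** Preimages of blocks are convex. If this one were larger, it would contain a time in the interior
    of an adjacent piece, where the curve is in another open block. *)
Lemma run_preimage k : (k < L)%N ->
  pre (be k).1 (be k).2 = `[knot (c + k), knot (c + k).+1]%classic.
Proof.
move=> kL; apply/seteqP; split=> z; last first.
  by rewrite /= in_itv/= => /andP[kz zk]; exact: run_closed.
move=> pz; rewrite /= in_itv/=; apply/andP.
have kk : knot (c + k) < knot (c + k).+1 by rewrite knot_lt.
have bk := dr_block dr kL.
have z01 : 0 <= z /\ z <= 1 by case: pz; rewrite in_itv/= => /andP.
split; rewrite leNgt; apply/negP => lt.
  (* Before the first block there is no adjacent piece of the run: monotonicity and membership in
     the block put the curve at the starting vertex, against injectivity. *)
  case: (k) kL pz lt kk bk => [|k'] kL pz lt kk bk.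
    rewrite addn0 in lt.
    have e : polygon z = polygon (knot c).
      have h1 := polygon_homo1 (ltW lt); have h2 := polygon_homo2 (ltW lt).
      case: pz => _ [g1 _ g2 _]; move: h1 h2.
      rewrite polygon_knot; last by move: cL; lia.
      have := fE (leq0n L); rewrite addn0 (dr_start dr) => -> /= h1 h2.
      by rewrite [polygon z]surjective_pairing; congr (_, _); apply/le_anti/andP; split.
    have c1 : knot c <= 1 by apply: knot_le1; move: cL; lia.
    by have := polygon_inj z01.1 z01.2 (knot_ge0 c) c1 e; lra.
  have kL' : (k' < L)%N by lia.
  pose w := (Num.max z (knot (c + k')) + knot (c + k'.+1)) / 2.
  have kk' : knot (c + k') < knot (c + k'.+1) by rewrite knot_lt; lia.
  have mxlt : Num.max z (knot (c + k')) < knot (c + k'.+1) by rewrite gt_max lt.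
  have mx1 : z <= Num.max z (knot (c + k')) by rewrite le_max lexx.
  have mx2 : knot (c + k') <= Num.max z (knot (c + k')) by rewrite le_max lexx orbT.
  have pw : pre (be k'.+1).1 (be k'.+1).2 w.
    apply: (preimage_convex pz (run_closed kL (lexx _) (ltW kk))); rewrite /w; lra.
  have := @run_open_block k' w _ _ kL' _ _ bk pw; rewrite -surjective_pairing => H.
  apply: (step_neq kL); apply/esym/H; rewrite -?addnS /w; lra.
have [kL'|kL'] := ltnP k.+1 L; last first.
  have kE : k = L.-1 by lia.
  have e : polygon (knot (c + k).+1) = polygon z.
    have h1 := polygon_homo1 (ltW lt); have h2 := polygon_homo2 (ltW lt).
    case: pz => _ [_ g1 _ g2]; move: h1 h2.
    rewrite polygon_knot; last by move: cL; lia.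
    have -> : (c + k).+1 = (c + L)%N by lia.
    rewrite fE// (dr_end dr) -kE /= => h1 h2.
    by rewrite [polygon z]surjective_pairing; congr (_, _); apply/le_anti/andP; split.
  have c1 : knot (c + k).+1 <= 1 by apply: knot_le1; move: cL; lia.
  by have := polygon_inj (knot_ge0 _) c1 z01.1 z01.2 e; lra.
pose w := (knot (c + k).+1 + Num.min z (knot (c + k).+2)) / 2.
have kk' : knot (c + k).+1 < knot (c + k).+2 by rewrite knot_lt.
have mnlt : knot (c + k).+1 < Num.min z (knot (c + k).+2) by rewrite lt_min lt.
have mn1 : Num.min z (knot (c + k).+2) <= z by rewrite ge_min lexx.
have mn2 : Num.min z (knot (c + k).+2) <= knot (c + k).+2 by rewrite ge_min lexx orbT.
have pw : pre (be k).1 (be k).2 w.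
  apply: (preimage_convex (run_closed kL (ltW kk) (lexx _)) pz); rewrite /w; lra.
have := @run_open_block k.+1 w _ _ kL' _ _ bk pw; rewrite -surjective_pairing => H.
apply: (step_neq kL'); apply: H; rewrite ?addnS /w; lra.
Qed.

Lemma run_H k : (k < L)%N -> Hs (be k).1 (be k).2 = slope polygon (knot (c + k)) (knot (c + k).+1).
Proof.
move=> kL; rewrite /H run_preimage//.
have kk : knot (c + k) <= knot (c + k).+1 by rewrite knot_le.
by rewrite inf_itv ?sup_itv//= bnd_simp.
Qed.

Lemma run_H_active k : (k < L)%N -> active m n W x y (be k).1 (be k).2 ->
  Hs (be k).1 (be k).2 = (y (be k).1 (be k).2 / x (be k).1 (be k).2)%:E.
Proof.
move=> kL aa; have [x0 y0] := act_pos aa; rewrite run_H// /slope.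
rewrite !polygon_knot; [|by have := ck kL; lia|by have := ck kL; lia].
rewrite -addnS !fE//; last exact: ltnW.
case: (dr_piece dr kL) => [_ h1 h2 _ _ _ _|w _ _ _ _ _ _ _|w _ _ _ _ _ _ _].
- rewrite h1 h2 -subr_eq0.
  have -> : forall p q : R, p + q - p = q by move=> p q; ring.
  have -> : forall p q : R, p + q - p = q by move=> p q; ring.
  by rewrite gt_eqF.
- by exfalso; have := act_posW aa; lra.
- by exfalso; have := act_posW aa; lra.
Qed.

Lemma run_active k : (k < L)%N -> 0 < W (be k).1 (be k).2 -> active m n W x y (be k).1 (be k).2.
Proof.
move=> kL W0; case: (dr_piece dr kL) => // w; by move: (lt_le_trans W0 w); rewrite ltxx.
Qed.

Lemma run_horiz k : (k < L)%N -> W (be k).1 (be k).2 <= 0 ->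
  f k.+1 = (s (be k).1, (f k).2) -> t (be k).2.-1 < (f k).2 -> (f k).1 = s (be k).1.-1 ->
  Hs (be k).1 (be k).2 = 0%E.
Proof.
move=> kL w0 fk tk fk1; rewrite run_H// /slope.
rewrite !polygon_knot; [|by have := ck kL; lia|by have := ck kL; lia].
rewrite -addnS !fE//; last exact: ltnW.
rewrite fk fk1 /= subrr mul0r ifF//.
have /andP[bi bj] := run_block_range kL.
by apply/gt_eqF/(sub_lt ssub); lia.
Qed.

Lemma run_vert k : (k < L)%N -> (f k.+1).1 = (f k).1 ->
  Hs (be k).1 (be k).2 = +oo%E.
Proof.
move=> kL fk; rewrite run_H// /slope.
rewrite !polygon_knot; [|by have := ck kL; lia|by have := ck kL; lia].
by rewrite -addnS !fE ?fk ?eqxx//; exact: ltnW.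
Qed.

Lemma run_interior a' b' : a <= a' -> a' < b' -> b' <= b ->
  exists k z, [/\ (k < L)%N, knot (c + k) < z, z < knot (c + k).+1, a' < z & z < b'].
Proof.
move=> aa ab bb.
have b1 : b <= 1 by exact: knot_le1.
have [k [kK h1 h2]] := knot_find (le_trans (knot_ge0 c) aa) (lt_le_trans ab (le_trans bb b1)).
have ck1 : (c < k.+1)%N by rewrite -knot_lt; exact: le_lt_trans h2.
have kcL : (k < c + L)%N by rewrite -knot_lt; apply: le_lt_trans h1 (lt_le_trans ab bb).
exists (k - c)%N, ((a' + Num.min b' (knot k.+1)) / 2).
have -> : (c + (k - c))%N = k by lia.
have mn : a' < Num.min b' (knot k.+1) by rewrite lt_min ab.
have mn1 : Num.min b' (knot k.+1) <= b' by rewrite ge_min lexx.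
have mn2 : Num.min b' (knot k.+1) <= knot k.+1 by rewrite ge_min lexx orbT.
by split; [lia|lra|lra|lra|lra].
Qed.

Lemma interior_visit i j a' b' : is_block m n i j -> a <= a' -> a' < b' -> b' <= b ->
  pre i j a' -> pre i j b' -> exists2 k, (k < L)%N & (i, j) = be k.
Proof.
move=> ij aa ab bb pa pb; have [k [z [kL h1 h2 h3 h4]]] := run_interior aa ab bb.
exists k => //; apply: (run_open_block kL h1 h2 ij).
exact: preimage_convex pa pb (ltW h3) (ltW h4).
Qed.

Lemma ratio_ereal (p q : R) : 0 < q -> (p%:E / q%:E)%E = (p / q)%:E.
Proof. by move=> q0; rewrite inver gt_eqF// -EFinM. Qed.

(** The blocks need not be adjacent: the same formula serves a passage over blocks of weight at most
    0. *)
Lemma row_ratio k l : (k < L)%N -> (l < L)%N -> (be k).2 = (be l).2 ->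
  0 < W (be k).1 (be k).2 -> 0 < W (be l).1 (be l).2 ->
  (Hs (be l).1 (be l).2 / Hs (be k).1 (be k).2)%E =
  ((W (be l).1 (be l).2 / W (be k).1 (be k).2) ^+ 2)%:E.
Proof.
move=> kL lL jj wk wl.
have ak := run_active kL wk; have al := run_active lL wl.
rewrite (run_H_active kL ak) (run_H_active lL al).
have [xk yk] := act_pos ak; have [xl yl] := act_pos al.
rewrite ratio_ereal ?divr_gt0//; congr EFin.
rewrite -jj in al wl xl yl *.
have := act_row_prop mx ak al.
set p := W _ _ in wk ak *; set q := W _ _ in wl al *.
move: (x _ _) (y _ _) (x _ _) (y _ _) xk yk xl yl => X' Y' X Y X0 Y0 X'0 Y'0 e.
have q2 : q ^+ 2 = p ^+ 2 * X * Y' / (X' * Y).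
  by rewrite e -[q ^+ 2 * _ * _]mulrA mulfK// mulf_neq0// gt_eqF.
rewrite expr_div_n q2; field; rewrite !gt_eqF//.
Qed.

Lemma col_ratio k l : (k < L)%N -> (l < L)%N -> (be k).1 = (be l).1 ->
  0 < W (be k).1 (be k).2 -> 0 < W (be l).1 (be l).2 ->
  (Hs (be l).1 (be l).2 / Hs (be k).1 (be k).2)%E =
  ((W (be k).1 (be k).2 / W (be l).1 (be l).2) ^+ 2)%:E.
Proof.
move=> kL lL jj wk wl.
have ak := run_active kL wk; have al := run_active lL wl.
rewrite (run_H_active kL ak) (run_H_active lL al).
have [xk yk] := act_pos ak; have [xl yl] := act_pos al.
rewrite ratio_ereal ?divr_gt0//; congr EFin.
rewrite -jj in al wl xl yl *.
have := act_col_prop mx ak al.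
set p := W _ _ in wk ak *; set q := W _ _ in wl al *.
move: (x _ _) (y _ _) (x _ _) (y _ _) xk yk xl yl => X' Y' X Y X0 Y0 X'0 Y'0 e.
have p2 : p ^+ 2 = q ^+ 2 * Y' * X / (Y * X').
  by rewrite -e -[p ^+ 2 * _ * _]mulrA mulfK// mulf_neq0// gt_eqF.
rewrite expr_div_n p2; field; rewrite !gt_eqF//.
Qed.

(** A block of weight at most 0 that is left to the right was entered from the left, so one goes
    back along the row until an active block; the first block of the run is active. *)
Lemma last_active_left k : (k.+1 < L)%N -> W (be k).1 (be k).2 <= 0 ->
  be k.+1 = ((be k).1.+1, (be k).2) ->
  exists l, [/\ (l < k)%N, (be l).2 = (be k).2, 0 < W (be l).1 (be l).2,
    (1 <= (be l).1 <= (be k).1)%N &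
    forall i, ((be l).1 < i <= (be k).1)%N -> W i (be k).2 <= 0].
Proof.
elim: k => [|k IH] kL w0 nx; first by have := act_posW (dr_act0 dr); lra.
have kL' : (k.+1 < L)%N by lia.
case: (dr_piece dr kL') => [aa|_ _ _ _ _ _ pv _|_ _ _ _ _ _ _ nx'].
- by have := act_posW aa; lra.
- rewrite /= in pv; have [wk|wk] := ltP 0 (W (be k).1 (be k).2).
    exists k; rewrite pv /=; split=> //.
    + by have := run_block_range (ltnW kL'); lia.
    + move=> i ik; have -> : i = (be k).1.+1 by lia.
      by rewrite pv in w0.
  have [l [lk l2 wl l1 H]] := IH kL' wk pv.
  exists l; rewrite pv /=; split => //; [lia|lia|].
  move=> i ii; have [->|ine] := eqVneq i (be k).1.+1; first by rewrite pv in w0.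
  by apply: H; lia.
- by move: nx'; rewrite nx => /(congr1 fst) /=; lia.
Qed.

Lemma last_active_below k : (k.+1 < L)%N -> W (be k).1 (be k).2 <= 0 ->
  be k.+1 = ((be k).1, (be k).2.+1) ->
  exists l, [/\ (l < k)%N, (be l).1 = (be k).1, 0 < W (be l).1 (be l).2,
    (1 <= (be l).2 <= (be k).2)%N &
    forall j, ((be l).2 < j <= (be k).2)%N -> W (be k).1 j <= 0].
Proof.
elim: k => [|k IH] kL w0 nx; first by have := act_posW (dr_act0 dr); lra.
have kL' : (k.+1 < L)%N by lia.
case: (dr_piece dr kL') => [aa|_ _ _ _ _ _ _ nx'|_ _ _ _ _ _ pv _].
- by have := act_posW aa; lra.
- by move: nx'; rewrite nx => /(congr1 fst) /=; lia.
- rewrite /= in pv; have [wk|wk] := ltP 0 (W (be k).1 (be k).2).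
    exists k; rewrite pv /=; split=> //.
    + by have := run_block_range (ltnW kL'); lia.
    + move=> i ik; have -> : i = (be k).2.+1 by lia.
      by rewrite pv in w0.
  have [l [lk l2 wl l1 H]] := IH kL' wk pv.
  exists l; rewrite pv /=; split => //; [lia|lia|].
  move=> i ii; have [->|ine] := eqVneq i (be k).2.+1; first by rewrite pv in w0.
  by apply: H; lia.
Qed.

Lemma run_order k l z1 z2 : (k < L)%N -> (l < L)%N ->
  pre (be k).1 (be k).2 z1 -> pre (be l).1 (be l).2 z2 -> z1 < z2 -> (k <= l)%N.
Proof.
move=> kL lL; rewrite !run_preimage// /= !in_itv/= => /andP[h1 _] /andP[_ h2] zz.
have : knot (c + k) < knot (c + l).+1 by exact: le_lt_trans h1 (lt_le_trans zz h2).
by rewrite knot_lt; lia.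
Qed.

Lemma run_passes k l z : (k < L)%N -> (l < L)%N -> be k <> be l -> (k <= l)%N ->
  pre (be k).1 (be k).2 z -> pre (be l).1 (be l).2 z -> l = k.+1.
Proof.
move=> kL lL ne kl; rewrite !run_preimage// /= !in_itv/= => /andP[_ h1] /andP[h2 _].
have : knot (c + l) <= knot (c + k).+1 by exact: le_trans h2 h1.
rewrite knot_le => h; have : k <> l by move=> e; apply: ne; rewrite e.
lia.
Qed.

Lemma run_range : (0 <= a) /\ (b <= 1).
Proof. by split; [exact: knot_ge0|exact: knot_le1]. Qed.

Lemma in01 z : a <= z -> z <= b -> z \in `[0, 1].
Proof. by have [h1 h2] := run_range => az zb; rewrite in_itv/=; apply/andP; split; lra. Qed.

(** Translates the passages of P5 and P6 into the run: both preimages contain the time [z], so they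
    are adjacent knot intervals. *)
Lemma passes_visits i j i' j' z0 z z1 : is_block m n i j -> is_block m n i' j' -> (i, j) <> (i', j') ->
  a <= z0 -> z1 <= b -> z0 < z -> z < z1 ->
  (forall w, w \in `[z0, z] -> block s t i j (polygon w)) ->
  (forall w, w \in `[z, z1] -> block s t i' j' (polygon w)) ->
  exists k, [/\ (k.+1 < L)%N, be k = (i, j) & be k.+1 = (i', j')].
Proof.
move=> ij ij' ne az zb z0z zz1 B1 B2.
have P1 w : z0 <= w -> w <= z -> pre i j w.
  by move=> h1 h2; split; [apply: in01; lra|apply: B1; rewrite in_itv/= h1].
have P2 w : z <= w -> w <= z1 -> pre i' j' w.
  by move=> h1 h2; split; [apply: in01; lra|apply: B2; rewrite in_itv/= h1].
have zb' : z <= b by lra.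
have az' : a <= z by lra.
have [k kL ek] := interior_visit ij az z0z zb' (P1 _ (lexx _) (ltW z0z)) (P1 _ (ltW z0z) (lexx _)).
have [l lL el] := interior_visit ij' az' zz1 zb (P2 _ (lexx _) (ltW zz1)) (P2 _ (ltW zz1) (lexx _)).
have kl : (k <= l)%N.
  by apply: (@run_order k l z0 z1) => //; [rewrite -ek; apply: P1; lra|rewrite -el; apply: P2; lra|lra].
have lk : l = k.+1.
  apply: (@run_passes k l z) => //; first by rewrite -ek -el.
    by rewrite -ek; apply: P1; lra.
  by rewrite -el; apply: P2; lra.
by exists k; rewrite -lk -ek -el.
Qed.

Lemma run_P_segment : P_segment m n s t W polygon a b.
Proof.
have [a0 b1] := run_range.
have ab : a < b by rewrite knot_lt; have := dr_pos dr; lia.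
split.
- by [].
- exists L, (fun k => knot (c + k)); split.
    by split; rewrite ?addn0// => i iL; rewrite knot_lt; lia.
  by move=> i iL; rewrite addnS; apply: polygon_linear; exact: ck.
- move=> z z'; rewrite !in_itv/= => /andP[h1 h2] /andP[h3 h4].
  by apply: polygon_inj; lra.
- exists (be 0%N).1, (be 0%N).2, (be L.-1).1, (be L.-1).2.
  have L0 := dr_pos dr.
  have L1 : (L.-1 < L)%N by lia.
  have B0 := dr_block dr L0; have B1 := dr_block dr L1.
  have gb : polygon b = vertex s t (be L.-1).
    by rewrite polygon_knot// fE// (dr_end dr).
  have ga : polygon a = vertex s t ((be 0%N).1.-1, (be 0%N).2.-1).
    rewrite polygon_knot; last by move: cL; lia.
    by have := fE (leq0n L); rewrite addn0 (dr_start dr).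
  split=> //; last by split; [exact: (act_posW (dr_act0 dr))|exact: (act_posW (dr_act1 dr))].
  have h1 := polygon_homo1 (ltW ab); have h2 := polygon_homo2 (ltW ab).
  move: h1 h2; rewrite ga gb /vertex /= => h1 h2.
  have mono k : (k < L)%N -> ((be 0%N).1 <= (be k).1)%N /\ ((be 0%N).2 <= (be k).2)%N.
    elim: k => // k IH kL; have [i1 i2] := IH (ltnW kL).
    by case: (dr_step dr kL) => -> _ _ _ /=; lia.
  exact: mono.
- move=> z i j; rewrite in_itv/= => /andP[az zb] im jn e.
  have [k [kK h1 h2]] := knot_find (le_trans a0 (ltW az)) (lt_le_trans zb b1).
  have ck1 : (c < k.+1)%N by rewrite -knot_lt; exact: lt_trans h2.
  have kcL : (k < c + L)%N by rewrite -knot_lt; apply: le_lt_trans h1 zb.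
  have kE : k = (c + (k - c))%N by lia.
  have kL : (k - c < L)%N by lia.
  (* At a knot the curve crosses an edge strictly between its ends ([step_spec]); between knots it
     lies in an open block. *)
  move: h1; rewrite le_eqVlt => /orP[/eqP h1|h1].
    have k0 : (0 < k - c)%N.
      have : knot c < knot k by rewrite h1.
      by rewrite knot_lt; lia.
    move: e; rewrite -h1 polygon_knot; last by lia.
    rewrite kE fE; last exact: ltnW.
    have kL' : ((k - c).-1.+1 < L)%N by lia.
    have /andP[bi bj] := run_block_range (ltnW kL').
    case: (dr_step dr kL'); rewrite prednK// => _ _ g1 g2 e; rewrite e /= in g1 g2.
      by have := @cell_grid _ n t tsub _ _ bj jn; rewrite /cell g1 g2.
    by have := @cell_grid _ m s ssub _ _ bi im; rewrite /cell g1 g2.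
  rewrite kE in h1 h2; have [g1 g2 _ _] := run_open kL h1 h2.
  rewrite e /= in g1 g2; have /andP[bi bj] := run_block_range kL.
  by have := @cell_grid _ m s ssub _ _ bi im; rewrite /cell g1 g2.
- move=> i j ij sub.
  (* A block may be met in a single time or not at all; linearity is then trivial. *)
  have [[z1 [z2 [p1 p2 z12]]]|single] := pselect (exists z1 z2, [/\ pre i j z1, pre i j z2 & z1 < z2]).
    have := sub _ p1; have := sub _ p2; rewrite /= !in_itv/= => /andP[_ h2] /andP[h1 _].
    have [k kL ek] := interior_visit ij h1 z12 h2 p1 p2.
    have -> : pre i j = pre (be k).1 (be k).2 by rewrite -ek.
    by rewrite run_preimage//; apply: polygon_linear; exact: ck.
  have [[z pz]|none] := pselect (exists z, pre i j z).
    exists (polygon z), 0 => w pw; rewrite scaler0 addr0.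
    by congr polygon; case: (ltgtP w z) => // h; exfalso; apply: single;
      [exists w, z|exists z, w].
  by exists 0, 0 => w pw; exfalso; apply: none; exists w.
- move=> i j c' d' ij cd E sub.
  have pc : pre i j c' by rewrite E /= in_itv/= lexx ltW.
  have pd : pre i j d' by rewrite E /= in_itv/= lexx ltW.
  have := sub _ pc; have := sub _ pd; rewrite /= !in_itv/= => /andP[_ h2] /andP[h1 _].
  have [k kL ek] := interior_visit ij h1 cd h2 pc pd.
  have cE : c' = knot (c + k).
    have := run_preimage kL; rewrite -ek /= E => /(congr1 inf).
    by rewrite !inf_itv ?bnd_simp ?(ltW cd) ?knot_le //; lia.
  have gc : polygon c' = f k.
    by rewrite cE polygon_knot ?fE//; [exact: ltnW|exact: ltnW (ck kL)].
  have [bi bj] : (be k).1 = i /\ (be k).2 = j by rewrite -ek.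
  split=> [w0|w0]; last first.
    have aa : active m n W x y (be k).1 (be k).2 by apply: run_active => //; rewrite bi bj.
    rewrite -bi -bj (run_H_active kL aa); have [x0 y0] := act_pos aa.
    by split=> // -[] /eqP; rewrite gt_eqF// divr_gt0.
  case: (dr_piece dr kL); rewrite bi bj.
  + by move=> /act_posW; rewrite /= => aw; exfalso; lra.
  (* A horizontal piece starts strictly above the lower edge, so entering from below is impossible;
     the vertical case is symmetric. *)
  + move=> _ e1 e2 e3 e4 e5 _ _; split=> [_|[]]; last by rewrite gc => e; exfalso; lra.
    rewrite -{1}bi -{1}bj; apply: run_horiz => //; rewrite ?bi ?bj//.
    by rewrite [f k.+1]surjective_pairing e2 e3.
  + move=> _ e1 e2 e3 e4 e5 _ _; split=> [[]|_]; first by rewrite gc => e; exfalso; lra.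
    by rewrite -{1}bi -{1}bj; apply: run_vert.
- move=> i j [ij ij' [z0 [z [z1 [[h1 h2] [h3 h4] B1 B2 _]]]]].
  have ne : (i, j) <> (i.+1, j) by move=> /(congr1 fst) /n_Sn.
  have [k [kL e1 e2]] := passes_visits ij ij' ne h1 h2 h3 h4 B1 B2.
  have kL' := ltnW kL.
  split.
  + move=> w1 w2; have := @row_ratio k k.+1 kL' kL; rewrite e1 e2 /=; exact.
  + move=> w2; case: (dr_piece dr kL); rewrite e2 /=.
    * by move=> /act_posW aw; exfalso; lra.
    * move=> _ g1 g2 g3 g4 g5 _ _.
      have := @run_horiz k.+1 kL; rewrite e2 /=; apply => //.
      by rewrite [f k.+2]surjective_pairing g2 g3.
    * by move=> _ _ _ _ _ _ /(congr1 fst); rewrite e1 /= => /esym /n_Sn.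
  + move=> w1 w2; have := @last_active_left k kL; rewrite e1 e2 /= => /(_ w1 erefl).
    move=> [l [lk l2 wl l1 HW]]; exists (be l).1; split => //.
    * by rewrite -l2.
    * have lL : (l < L)%N := ltn_trans lk kL'.
      have := @row_ratio l k.+1 lL kL; rewrite e2 /= l2; apply => //.
      by rewrite -l2.
- move=> i j [ij ij' [z0 [z [z1 [[h1 h2] [h3 h4] B1 B2 _]]]]].
  have ne : (i, j) <> (i, j.+1) by move=> /(congr1 snd) /n_Sn.
  have [k [kL e1 e2]] := passes_visits ij ij' ne h1 h2 h3 h4 B1 B2.
  have kL' := ltnW kL.
  split.
  + move=> w1 w2; have := @col_ratio k k.+1 kL' kL; rewrite e1 e2 /=; exact.
  + move=> w2; case: (dr_piece dr kL); rewrite e2 /=.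
    * by move=> /act_posW aw; exfalso; lra.
    * by move=> _ _ _ _ _ _ /(congr1 snd); rewrite e1 /= => /esym /n_Sn.
    * move=> _ g1 g2 g3 g4 g5 _ _.
      by have := @run_vert k.+1 kL; rewrite e2 /=; apply.
  + move=> w1 w2; have := @last_active_below k kL; rewrite e1 e2 /= => /(_ w1 erefl).
    move=> [l [lk l2 wl l1 HW]]; exists (be l).2; split => //.
    * by rewrite -l2.
    * have lL : (l < L)%N := ltn_trans lk kL'.
      have := @col_ratio l k.+1 lL kL; rewrite e2 /= l2; apply => //.
      by rewrite -l2.
Qed.

End Block.
End MonotonePolygon.

(** * The itinerary as a polygon *)

Section Assembly.
Context {R : realType}.
Variables (m n : nat) (s t : nat -> R) (W x y : nat -> nat -> R).
Hypotheses (ssub : subdivision 0 1 m s) (tsub : subdivision 0 1 n t).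
Hypothesis mx : maximal m n (ds s) (ds t) W x y.
Hypothesis nm : normalized m n W x y.
Local Notation act := (active m n W x y).
Local Notation itin := (itinerary m n act).
Local Notation pt := (block_entry s t x y).
Local Notation vtx := (vertex s t).

(** The end vertex of a segment is left out, being the first node of the next one; [nodes] appends
    the very last vertex. *)
Definition seg_nodes (sg : seg) : seq (R * R) :=
  let v := sg.1.1 in let v' := sg.1.2 in
  if sg.2 is Some (b, bs) then map pt (b :: bs)
  else if (v.1 == v'.1) || (v.2 == v'.2) then [:: vtx v] else [:: vtx v; (s v'.1, t v.2)].

Definition offset (ss : seq seg) : nat := size (flatten (map seg_nodes ss)).
Definition nodes (ss : seq seg) := flatten (map seg_nodes ss) ++ [:: vtx (m, n)].
Definition nd ss k := nth (0, 0) (nodes ss) k.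

Definition valid_seg (sg : seg) : Prop :=
  if sg.2 is Some (b, bs) then valid_P m n act sg.1.1 sg.1.2 b bs
  else valid_N m n act sg.1.1 sg.1.2.

Lemma seg_nodes_gt0 sg : (0 < size (seg_nodes sg))%N.
Proof. by rewrite /seg_nodes; case: sg => vv' [[b bs]|//]; case: ifP. Qed.

Lemma offset_cat ss1 ss2 : offset (ss1 ++ ss2) = (offset ss1 + offset ss2)%N.
Proof. by rewrite /offset map_cat flatten_cat size_cat. Qed.

Lemma offset_cons sg ss : offset (sg :: ss) = (size (seg_nodes sg) + offset ss)%N.
Proof. by rewrite /offset /= size_cat. Qed.

Lemma itinerary_split v al ss1 sg ss2 : itin v al (ss1 ++ sg :: ss2) ->
  [/\ valid_seg sg, exists al', itin sg.1.2 al' ss2 &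
      ss1 = [::] -> v = sg.1.1].
Proof.
elim: ss1 v al => [|[[v0 v1] [[b bs]|]] ss1 IH] v al.
- case: sg => -[v0 v1] [[b bs]|] /=.
    by move=> [<- vP it]; split => //; exists true.
  by move=> [<- vP _ it]; split => //; exists false.
- by move=> [_ _ /IH[h1 h2 _]]; split.
- by move=> [_ _ _ /IH[h1 h2 _]]; split.
Qed.

Lemma itinerary_alternates v al ss1 sg sg' ss2 : itin v al (ss1 ++ sg :: sg' :: ss2) ->
  sg.2 || sg'.2.
Proof.
elim: ss1 v al => [|[[v0 v1] [[b bs]|]] ss1 IH] v al.
- case: sg => -[v0 v1] [[b bs]|] //=.
  by case: sg' => -[v0' v1'] [[b bs]|] //= [_ _ _ []].
- by move=> [_ _ /IH].
- by move=> [_ _ _ /IH].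
Qed.

Lemma seg_nodes_head sg : valid_seg sg -> nth (0, 0) (seg_nodes sg) 0 = vtx sg.1.1.
Proof.
case: sg => -[v v'] [[b bs]|]; rewrite /valid_seg /seg_nodes /=.
  move=> [sep bE ab _ _]; rewrite bE in ab *.
  by rewrite (@pt_start _ m n s t W x y nm (v.1.+1, v.2.+1) bs).
by move=> _; case: ifP.
Qed.

Lemma nodes_head v al ss : itin v al ss -> nth (0, 0) (nodes ss) 0 = vtx v.
Proof.
case: ss => [->//|sg ss] it; have [vs _ /(_ erefl) ->] := @itinerary_split v al [::] sg ss it.
by rewrite /nodes /= -catA nth_cat seg_nodes_gt0 seg_nodes_head.
Qed.

Lemma seg_node v al ss1 sg ss2 k : itin v al (ss1 ++ sg :: ss2) -> (k <= size (seg_nodes sg))%N ->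
  nd (ss1 ++ sg :: ss2) (offset ss1 + k) =
  if (k < size (seg_nodes sg))%N then nth (0, 0) (seg_nodes sg) k else vtx sg.1.2.
Proof.
move=> it kle; rewrite /nd /nodes map_cat flatten_cat -catA nth_cat /offset.
rewrite -[X in (_ < X)%N]addn0 ltn_add2l ltn0 addKn /= -catA nth_cat.
case: ifP => // kge; have -> : k = size (seg_nodes sg) by lia.
have [_ [al' it'] _] := itinerary_split it.
by rewrite subnn -(nodes_head it').
Qed.

Lemma find_seg (ss : seq seg) k : (k < offset ss)%N -> exists ss1 sg ss2 k',
  [/\ ss = ss1 ++ sg :: ss2, k = (offset ss1 + k')%N & (k' < size (seg_nodes sg))%N].
Proof.
elim: ss k => // sg ss IH k; rewrite offset_cons => kl.
have [h|h] := ltnP k (size (seg_nodes sg)).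
  by exists [::], sg, ss, k; split.
have [ss1 [sg' [ss2 [k' [-> kE kl']]]]] := IH (k - size (seg_nodes sg))%N ltac:(lia).
exists (sg :: ss1), sg', ss2, k'; split=> //; rewrite offset_cons.
lia.
Qed.

Lemma seg_run v al ss1 v0 v1 b bs ss2 : itin v al (ss1 ++ (v0, v1, Some (b, bs)) :: ss2) ->
  disc_run m n s t W x y (run_node s t x y b bs) (run_block b bs) (size bs).+1 /\
  forall k, (k <= (size bs).+1)%N ->
    nd (ss1 ++ (v0, v1, Some (b, bs)) :: ss2) (offset ss1 + k) = run_node s t x y b bs k.
Proof.
move=> it; have [[/= sep bE ab rb v1E] _ _] := itinerary_split it.
split; first by apply: run_disc => //; rewrite bE.
move=> k kl; rewrite (seg_node it) /seg_nodes /= size_map// /run_node v1E.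
case: ifP => // kl'; rewrite -[_ :: _]/(map pt (b :: bs)).
by rewrite (nth_map (0%N, 0%N)).
Qed.

Inductive increment (p q : R * R) : Prop :=
| IncrActive i j of act i j & q = (p.1 + x i j, p.2 + y i j) &
    s i.-1 <= p.1 & q.1 <= s i & t j.-1 <= p.2 & q.2 <= t j
| IncrHoriz of q.2 = p.2 & p.1 < q.1
| IncrVert of q.1 = p.1 & p.2 < q.2.

Lemma vtx_increment (v v' : nat * nat) : (v'.1 <= m)%N -> (v'.2 <= n)%N ->
  (v.1 == v'.1) || (v.2 == v'.2) -> (v.1 <= v'.1)%N && (v.2 <= v'.2)%N -> v <> v' ->
  increment (vtx v) (vtx v').
Proof.
move=> m' n' e /andP[l1 l2] ne; have [e1|ne1] := eqVneq v.1 v'.1.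
  apply: IncrVert; rewrite /vtx /= ?e1//; apply: (sub_lt tsub) => //.
  rewrite ltn_neqAle l2 andbT; apply/eqP => e2; apply: ne.
  by rewrite [v]surjective_pairing [v']surjective_pairing e1 e2.
have e2 : v.2 = v'.2 by move: e; rewrite (negbTE ne1) => /eqP.
apply: IncrHoriz; rewrite /vtx /= ?e2//; apply: (sub_lt ssub) => //.
by rewrite ltn_neqAle ne1.
Qed.

Lemma nd_increment v al ss k : itin v al ss -> (k < offset ss)%N ->
  increment (nd ss k) (nd ss k.+1).
Proof.
move=> it /find_seg[ss1 [[[v0 v1] [[b bs]|]] [ss2 [k' [E -> kl]]]]]; rewrite E in it *.
  have [dr H] := seg_run it; rewrite /seg_nodes /= size_map in kl.
  rewrite -addnS !H//; last exact: ltnW.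
  have bk := dr_block dr kl.
  case: (dr_piece dr kl) => [a h1 h2 h3 h4 h5 h6|w h1 h2 h3 h4 h5 _ _|w h1 h2 h3 h4 h5 _ _].
  - by apply: IncrActive a _ h3 h4 h5 h6; rewrite -h1 -h2 -surjective_pairing.
  - apply: IncrHoriz => //; rewrite h1 h2; apply: (sub_lt ssub); by move: bk; rewrite /is_block; lia.
  - apply: IncrVert => //; rewrite h1 h2; apply: (sub_lt tsub); by move: bk; rewrite /is_block; lia.
have [[/= ne le sep [m' n' _] _] _ _] := itinerary_split it.
rewrite -addnS !(seg_node it)//; last exact: ltnW.
rewrite kl; move: kl; rewrite /seg_nodes /=; case: ifPn => c.
  by case: k' => // _; apply: vtx_increment.
move: c; rewrite negb_or => /andP[c1 c2]; case: k' => [|[|//]] _ /=.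
  apply: (@vtx_increment v0 (v1.1, v0.2)) => //=.
  - by case/andP: le => _ /leq_trans; apply.
  - by rewrite eqxx orbT.
  - by rewrite leqnn andbT; case/andP: le.
  - by move=> e; rewrite e eqxx in c1.
apply: (@vtx_increment (v1.1, v0.2) v1) => //=.
- by rewrite eqxx.
- by rewrite leqnn; case/andP: le.
- by move=> e; rewrite -e eqxx in c2.
Qed.

Lemma nodes_monotone al ss : itin (0, 0)%N al ss -> monotone_nodes (nd ss) (offset ss).
Proof.
move=> it; have s0 : s 0%N = 0 by case: ssub. have s1 : s m = 1 by case: ssub.
have t0 : t 0%N = 0 by case: tsub. have t1 : t n = 1 by case: tsub.
have e0 : nd ss 0 = (0, 0) by rewrite /nd (nodes_head it) /vtx /= s0 t0.
have eK : nd ss (offset ss) = (1, 1).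
  by rewrite /nd /nodes nth_cat ltnn subnn /= /vtx /= s1 t1.
split=> //.
  rewrite lt0n; apply/eqP => o0; move: eK; rewrite o0 e0 => /(congr1 fst) /= /esym/eqP.
  by rewrite oner_eq0.
move=> k kl; case: (nd_increment it kl) => [i j a -> _ _ _ _|-> h|-> h] /=.
- by have [x0 y0] := act_pos a; split; lra.
- by split; lra.
- by split; lra.
Qed.

End Assembly.

Section Gridlines.
Context {R : realType}.
Variables (m n : nat) (s t : nat -> R) (W : nat -> nat -> R) (gam : R -> R * R).

Lemma linear_const1 a b : a < b -> linear_on gam `[a, b] -> (gam a).1 = (gam b).1 ->
  forall z, z \in `[a, b] -> (gam z).1 = (gam b).1.
Proof.
move=> ab [p [v lin]] e z zab; move: e.
rewrite !lin//=; try by rewrite in_itv/= ?lexx ?ltW.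
move=> e; have /eqP : (b - a) * v.1 = 0 by move: e; rewrite /GRing.scale/=; lra.
rewrite mulf_eq0 subr_eq0 gt_eqF//= => /eqP ->.
by rewrite /GRing.scale/= !mulr0.
Qed.

Lemma linear_const2 a b : a < b -> linear_on gam `[a, b] -> (gam a).2 = (gam b).2 ->
  forall z, z \in `[a, b] -> (gam z).2 = (gam a).2.
Proof.
move=> ab [p [v lin]] e z zab; move: e.
rewrite !lin//=; try by rewrite in_itv/= ?lexx ?ltW.
move=> e; have /eqP : (b - a) * v.2 = 0 by move: e; rewrite /GRing.scale/=; lra.
rewrite mulf_eq0 subr_eq0 gt_eqF//= => /eqP ->.
by rewrite /GRing.scale/= !mulr0.
Qed.

(** An N-segment never meets the interior of a block. This distinguishes it from a P-segment and
    controls an arbitrary optimal curve between two P-segments. *)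
Lemma N_segment_gridlines a b : N_segment m n s t W gam a b ->
  exists i0 j0 i1 j1, [/\ (i0 <= i1 <= m)%N /\ (j0 <= j1 <= n)%N,
    gam a = (s i0, t j0), gam b = (s i1, t j1) &
    forall z, z \in `[a, b] -> (gam z).2 = t j0 \/ (gam z).1 = s i1].
Proof.
move=> [a0 ab b1 [i0 [j0 [i1 [j1 [ij ga gb lin _]]]]]].
exists i0, j0, i1, j1; split=> // z zab; move: lin.
have [i01|i01] /= := eqVneq i0 i1.
  by move=> /linear_const1 h; right; rewrite h ?gb// ga i01.
have [j01|j01] /= := eqVneq j0 j1.
  by move=> /linear_const2 h; left; rewrite h ?ga// gb j01.
move=> [l1 l2 gm]; set c := (a + b) / 2 in l1 l2 gm.
have ac : a < c by rewrite /c; lra.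
have cb : c < b by rewrite /c; lra.
move: zab; rewrite in_itv/= => /andP[az zb]; have [zc|/ltW cz] := leP z c.
  left; rewrite (linear_const2 ac l1) ?ga ?gm//.
  by rewrite in_itv/= az.
right; rewrite (linear_const1 cb l2) ?gb ?gm//.
by rewrite in_itv/= cz.
Qed.

End Gridlines.

Section Segmentation.
Context {R : realType}.
Variables (m n : nat) (s t : nat -> R) (W x y : nat -> nat -> R).
Hypotheses (ssub : subdivision 0 1 m s) (tsub : subdivision 0 1 n t).
Hypothesis mx : maximal m n (ds s) (ds t) W x y.
Hypothesis nm : normalized m n W x y.
Local Notation act := (active m n W x y).

Variable ss : seq seg.
Hypothesis it : itinerary m n act (0, 0)%N true ss.

Local Notation nd := (nd m n s t x y ss).
Local Notation off := (offset s t x y).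
Local Notation K := (off ss).
Local Notation gam := (polygon nd K).
Local Notation kn := (knot (R := R) K).

Let nodes := nodes_monotone ssub tsub mx nm it.

Lemma seg_P ss1 v0 v1 b bs ss2 : ss = ss1 ++ (v0, v1, Some (b, bs)) :: ss2 ->
  P_segment m n s t W gam (kn (off ss1)) (kn (off ss1 + (size bs).+1)).
Proof.
move=> E; have it' := it; rewrite E in it'.
have [dr H] := seg_run ssub tsub mx nm it'.
apply: (run_P_segment nodes ssub tsub mx dr); last by move=> k kl; rewrite -H// E.
by rewrite E offset_cat offset_cons /seg_nodes /= size_map; lia.
Qed.

(** The alternation claim concerns all segments that satisfy [N_segment], not only those so
    labelled. A run has a time in an open block, which no N-segment has. *)
Lemma seg_P_not_N ss1 v0 v1 b bs ss2 : ss = ss1 ++ (v0, v1, Some (b, bs)) :: ss2 ->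
  ~ N_segment m n s t W gam (kn (off ss1)) (kn (off ss1 + (size bs).+1)).
Proof.
move=> E /N_segment_gridlines[i0 [j0 [i1 [j1 [[ij1 ij2] _ _ H]]]]].
have it' := it; rewrite E in it'; have [dr HE] := seg_run ssub tsub mx nm it'.
have cL : (off ss1 + (size bs).+1 <= K)%N.
  by rewrite E offset_cat offset_cons /seg_nodes /= size_map; lia.
have fE k : (k <= (size bs).+1)%N -> nd (off ss1 + k) = run_node s t x y b bs k.
  by move=> kl; rewrite -HE// E.
have k1 : kn (off ss1 + 0) < kn (off ss1 + 0).+1 by rewrite (knot_lt nodes).
have k2 : kn (off ss1 + 0).+1 <= kn (off ss1 + (size bs).+1) by rewrite (knot_le nodes); lia.
have k0 : kn (off ss1) = kn (off ss1 + 0) by rewrite addn0.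
pose z := (kn (off ss1 + 0) + kn (off ss1 + 0).+1) / 2.
have z1 : kn (off ss1 + 0) < z by rewrite /z; lra.
have z2 : z < kn (off ss1 + 0).+1 by rewrite /z; lra.
have [g1 g2 g3 g4] := run_open nodes ssub tsub dr cL fE (ltn0Sn _) z1 z2.
have /andP[b1 b2] := run_block_range nodes dr cL (ltn0Sn _).
have zab : z \in `[kn (off ss1), kn (off ss1 + (size bs).+1)].
  by rewrite in_itv/= k0 (ltW z1)/= (le_trans (ltW z2)).
case: (H _ zab) => e.
  have /andP[/leq_trans + jn1] := ij2 => /(_ _ jn1) jn.
  by have := @cell_grid _ n t tsub _ _ b2 jn; rewrite /cell -e g3 g4.
have /andP[_ im] := ij1.
by have := @cell_grid _ m s ssub _ _ b1 im; rewrite /cell -e g1 g2.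
Qed.

Lemma seg_N ss1 v0 v1 ss2 : ss = ss1 ++ (v0, v1, None) :: ss2 ->
  N_segment m n s t W gam (kn (off ss1)) (kn (off ss1 + size (seg_nodes s t x y (v0, v1, None)))).
Proof.
move=> E; have it' := it; rewrite E in it'.
have [[/= ne le sep [m' n' sep'] H] _ _] := itinerary_split it'.
set q := seg_nodes _ _ _ _ _.
have q0 : (0 < size q)%N by exact: seg_nodes_gt0.
have cL : (off ss1 + size q <= K)%N by rewrite E offset_cat offset_cons leq_add2l leq_addr.
have nodeE k : (k <= size q)%N -> gam (kn (off ss1 + k)) =
    if (k < size q)%N then nth (0, 0) q k else vertex s t v1.
  move=> kq; rewrite (polygon_knot nodes); last by rewrite (leq_trans _ cL)// leq_add2l.
  by rewrite {1}E (seg_node nm it').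
have g0 : gam (kn (off ss1)) = vertex s t v0.
  by rewrite -[off ss1]addn0 nodeE// q0 /q /seg_nodes /=; case: ifP.
have g1 : gam (kn (off ss1 + size q)) = vertex s t v1 by rewrite nodeE// ltnn.
split; [exact: knot_ge0|by rewrite (knot_lt nodes) -[ltnLHS]addn0 ltn_add2l|exact: (knot_le1 nodes cL)|].
exists v0.1, v0.2, v1.1, v1.2; split => //.
- by case/andP: le => -> ->.
- case: ifPn => c.
    have qE : q = [:: vertex s t v0] by rewrite /q /seg_nodes /= c.
    by rewrite qE /= addn1; apply: (polygon_linear nodes); move: cL; rewrite qE /=; lia.
  have qE : q = [:: vertex s t v0; (s v1.1, t v0.2)] by rewrite /q /seg_nodes /= (negbTE c).
  (* All pieces last equally long, so the corner falls on the midpoint in time that N2 demands. *)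
  have mid : (kn (off ss1) + kn (off ss1 + 2)) / 2 = kn (off ss1).+1.
    by rewrite /knot -mulrDl -!natr1 natrD; field; case: nodes => K0 _ _ _; rewrite pnatr_eq0; lia.
  rewrite qE /= mid; split.
  + by apply: (polygon_linear nodes); move: cL; rewrite qE /=; lia.
  + by rewrite addn2; apply: (polygon_linear nodes); move: cL; rewrite qE /=; lia.
  + by have := nodeE 1%N; rewrite qE addn1; exact.
- case/andP: le => le1 le2.
  have sepE := sep; case: sep => _ _ sep.
  (* In the first case column [i] contains no active block, in the second case row [j]; a positive
     weight would contradict maximality. *)
  move=> i j ij /orP[/andP[/andP[i0 i1] /andP[j0 j1]]|/andP[/andP[i0 i1] /andP[j0 j1]]].
    apply: (dead_column_W ssub tsub mx nm ij).
      by move=> k; apply/negP => a; have := H _ _ a i0; lia.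
    by move=> a b ab; have := sep _ _ ab; have := H _ _ ab; rewrite /cmp_block; lia.
  apply: (dead_row_W ssub tsub mx nm ij).
    by move=> k; apply/negP => a; have := sep _ _ a; have := H _ _ a; lia.
  by move=> a b ab; have := sep _ _ ab; have := H _ _ ab; rewrite /cmp_block; lia.
Qed.

Definition cutpoint l := kn (off (take l ss)).

Lemma cut_subdivision : subdivision 0 1 (size ss) cutpoint.
Proof.
split.
- by rewrite /cutpoint take0 /knot /offset /= mul0r.
- by rewrite /cutpoint take_size /knot divff// pnatr_eq0; case: nodes => K0 _ _ _; lia.
- move=> l ls; rewrite /cutpoint (take_nth ((0, 0), (0, 0), None)%N ls) (knot_lt nodes).
  rewrite -cats1 offset_cat offset_cons -[ltnLHS]addn0 ltn_add2l.
  exact: leq_trans (seg_nodes_gt0 _ _ _ _ _) (leq_addr _ _).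
Qed.

Lemma cut_split l : (l < size ss)%N -> exists sg ss2, [/\ ss = take l ss ++ sg :: ss2,
  sg = nth ((0, 0), (0, 0), None)%N ss l,
  ss2 = drop l.+1 ss & cutpoint l.+1 = kn (off (take l ss) + size (seg_nodes s t x y sg))].
Proof.
move=> ls; exists (nth ((0, 0), (0, 0), None)%N ss l), (drop l.+1 ss); split=> //.
  by rewrite -drop_nth// cat_take_drop.
by rewrite /cutpoint (take_nth ((0, 0), (0, 0), None)%N ls) -cats1 offset_cat offset_cons addn0.
Qed.

Lemma cut_segment l : (l < size ss)%N ->
  P_segment m n s t W gam (cutpoint l) (cutpoint l.+1) \/ N_segment m n s t W gam (cutpoint l) (cutpoint l.+1).
Proof.
move=> ls; have [[[v0 v1] [[b bs]|]] [ss2 [E _ _ ->]]] := cut_split ls.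
  by left; rewrite /seg_nodes /= size_map; exact: (seg_P E).
by right; exact: (seg_N E).
Qed.

Lemma cut_alternates l : (l.+1 < size ss)%N ->
  ~ (N_segment m n s t W gam (cutpoint l) (cutpoint l.+1) /\ N_segment m n s t W gam (cutpoint l.+1) (cutpoint l.+2)).
Proof.
move=> ls [N1 N2].
have [[[v0 v1] [[b bs]|]] [ss2 [E _ E2 cE]]] := cut_split (ltnW ls).
  by apply: (seg_P_not_N E); move: N1; rewrite cE /seg_nodes /= size_map.
have [[[v0' v1'] [[b' bs']|]] [ss2' [E' sE' E2' cE']]] := cut_split ls.
  by apply: (seg_P_not_N E'); move: N2; rewrite cE' /seg_nodes /= size_map.
have it' := it; rewrite E E2 (drop_nth ((0, 0), (0, 0), None)%N ls) -sE' in it'.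
by have := itinerary_alternates it'.
Qed.

End Segmentation.

Lemma Rint_ae_const {R : realType} (A : set R) (k : R -> R) (c : R) :
  measurable A -> measurable_fun A k ->
  {ae @lebesgue_measure R, forall x, A x -> k x = c} ->
  \int[@lebesgue_measure R]_(x in A) k x = c * fine (@lebesgue_measure R A).
Proof.
move=> mA mk H; rewrite -Rintegral_cst// /Rintegral; congr fine.
apply: ae_eq_integral => //; first exact/measurable_EFinP.
apply: (@filterS _ _ (ae_filter_ringOfSetsType (@lebesgue_measure R))) H => x H Ax.
by rewrite H.
Qed.

Lemma visited_split (ss : seq seg) b : b \in flatten (map visited ss) ->
  exists ss1 sg ss2, ss = ss1 ++ sg :: ss2 /\ b \in visited sg.
Proof.
elim: ss => // sg ss IH; rewrite /= mem_cat => /orP[h|/IH[ss1 [sg' [ss2 [-> h]]]]].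
  by exists [::], sg, ss.
by exists (sg :: ss1), sg', ss2.
Qed.

(** * The polygon attains the maximum *)

Section Attainment.
Context {R : realType} {N : nat}.
Local Notation mu := (@lebesgue_measure R).
Variables (m n : nat) (s t : nat -> R) (u v : nat -> 'rV[R]_N) (x y : nat -> nat -> R).
Local Notation W := (weight u v).
Hypotheses (ssub : subdivision 0 1 m s) (tsub : subdivision 0 1 n t).
Hypothesis mx : maximal m n (ds s) (ds t) W x y.
Hypothesis nm : normalized m n W x y.
Local Notation act := (active m n W x y).
Variable ss : seq seg.
Hypothesis it : itinerary m n act (0, 0)%N true ss.
Hypothesis all_visited : forall i j, act i j -> (i, j) \in flatten (map visited ss).

Local Notation nd := (nd m n s t x y ss).
Local Notation K := (offset s t x y ss).
Local Notation gam := (polygon nd K).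
Local Notation kn := (knot (R := R) K).
Local Notation g1 := (fun z => (gam z).1).
Local Notation g2 := (fun z => (gam z).2).

Let nodes := nodes_monotone ssub tsub mx nm it.
Let K0 : (0 < K)%N. Proof. by case: nodes. Qed.

Variables h1 h2 : R -> R.
Hypotheses (d1 : density g1 h1) (d2 : density g2 h2).

Lemma polygon_density : {ae mu, forall z, z \in `[0, 1] -> exists k, [/\ (k < K)%N,
  kn k < z /\ z < kn k.+1, h1 z = K%:R * ((nd k.+1).1 - (nd k).1) &
  h2 z = K%:R * ((nd k.+1).2 - (nd k).2)]}.
Proof.
case: d1 => _ _ _ /ae_itvoo H1; case: d2 => _ _ _ /ae_itvoo H2.
have H3 := @not_knot_ae R K.
apply: (@filterS3 _ _ (ae_filter_ringOfSetsType mu) _ _ _ _ _ H1 H2 H3) => z {}H1 {}H2 {}H3 z01.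
have [k [kK k1 k2]] := knot_piece K0 z01 H3.
exists k; split=> //.
  by have [_ <-] := H1 z01; have [_ ->] := @polyline_derive _ (fun k => (nd k).1) _ K0 k z kK k1 k2.
by have [_ <-] := H2 z01; have [_ ->] := @polyline_derive _ (fun k => (nd k).2) _ K0 k z kK k1 k2.
Qed.

Lemma piece_visit k : (k < K)%N ->
  (nd k.+1).1 = (nd k).1 \/ (nd k.+1).2 = (nd k).2 \/
  exists i j, [/\ act i j, nd k.+1 = ((nd k).1 + x i j, (nd k).2 + y i j) &
    forall z, kn k < z -> z < kn k.+1 ->
      [/\ s i.-1 < (gam z).1, (gam z).1 < s i, t j.-1 < (gam z).2 & (gam z).2 < t j]].
Proof.
move=> kK; case: (nd_increment ssub tsub mx nm it kK) => [i j a E p1 p2 p3 p4|-> _|-> _];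
  [right; right|by right; left|by left].
exists i, j; split => // z kz zk.
have [x0 y0] := act_pos a; have [r [r0 r1] [-> ->]] := polygon_piece_oo nodes kK kz zk.
move: p2 p4; rewrite E /= => p2 p4.
have rx : 0 < r * x i j by rewrite mulr_gt0.
have ry : 0 < r * y i j by rewrite mulr_gt0.
have rx' : 0 < (1 - r) * x i j by rewrite mulr_gt0//; lra.
have ry' : 0 < (1 - r) * y i j by rewrite mulr_gt0//; lra.
by split; lra.
Qed.

Lemma visit_piece i j : act i j -> exists k, [/\ (k < K)%N,
  nd k.+1 = ((nd k).1 + x i j, (nd k).2 + y i j) &
  forall z, kn k < z -> z < kn k.+1 ->
    [/\ s i.-1 < (gam z).1, (gam z).1 < s i, t j.-1 < (gam z).2 & (gam z).2 < t j]].
Proof.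
move=> a; have [ss1 [[[v0 v1] o] [ss2 []]]] := visited_split (all_visited a).
case: o => [[b bs]|//] E ijb.
have it' := it; rewrite E in it'; have [dr HE] := seg_run ssub tsub mx nm it'.
have cL : (offset s t x y ss1 + (size bs).+1 <= K)%N.
  by rewrite E offset_cat offset_cons /seg_nodes /= size_map; lia.
have fE k : (k <= (size bs).+1)%N -> nd (offset s t x y ss1 + k) = run_node s t x y b bs k.
  by move=> kl; rewrite -HE// E.
pose k := index (i, j) (b :: bs).
have kL : (k < (size bs).+1)%N by rewrite -index_mem in ijb.
have kE : run_block b bs k = (i, j) by exact: nth_index.
exists (offset s t x y ss1 + k)%N; split.
- by apply: leq_trans cL; rewrite ltn_add2l.
- rewrite -addnS !fE//; last exact: ltnW.
  have aw := act_posW a; case: (dr_piece dr kL); rewrite kE /=.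
  + by move=> _ <- <- _ _ _ _; rewrite -surjective_pairing.
  + by move=> w0; have := lt_le_trans aw w0; rewrite ltxx.
  + by move=> w0; have := lt_le_trans aw w0; rewrite ltxx.
- by move=> z kz zk; have := run_open nodes ssub tsub dr cL fE kL kz zk; rewrite kE.
Qed.

Lemma openblockE i j z : z \in `[0, 1] -> openblock s t g1 g2 i j z <->
  [/\ s i.-1 < (gam z).1, (gam z).1 < s i, t j.-1 < (gam z).2 & (gam z).2 < t j].
Proof.
move=> z01; split; first by move=> [[_ /=] + [_ /=]]; rewrite !in_itv/= => /andP[? ?] /andP[? ?].
by move=> [? ? ? ?]; split; split=> //=; rewrite in_itv/=; apply/andP.
Qed.

Lemma speed_piece i j k : (k < K)%N -> nd k.+1 = ((nd k).1 + x i j, (nd k).2 + y i j) ->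
  0 <= x i j -> 0 <= y i j -> forall z, h1 z = K%:R * ((nd k.+1).1 - (nd k).1) ->
  h2 z = K%:R * ((nd k.+1).2 - (nd k).2) -> speed h1 h2 z = K%:R * Num.sqrt (x i j * y i j).
Proof.
move=> kK E x0 y0 z e1 e2; rewrite /speed e1 e2 E /=.
have c (a b : R) : a + b - a = b by rewrite addrAC subrr add0r.
rewrite !c !sqrtrM ?ler0n// mulrACA -expr2 sqr_sqrtr ?ler0n//.
Qed.

(** On an active block the speed is constant along one piece, so the Cauchy-Schwarz bound is
    attained. On the other blocks the speed vanishes almost everywhere, so that negative weights
    cost nothing. *)
Lemma gain_le i j : is_block m n i j ->
  gain W x y i j <= W i j * \int[mu]_(z in openblock s t g1 g2 i j) speed h1 h2 z.
Proof.
move=> ij; have mO : measurable (openblock s t g1 g2 i j) := openblock_meas _ _ d1 d2 i j.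
have O0 : 0 <= \int[mu]_(z in openblock s t g1 g2 i j) speed h1 h2 z.
  by apply: Rintegral_ge0 => z _; exact: speed_ge0.
have [a|na] := boolP (act i j).
  have w0 := act_posW a; have [x0 y0] := act_pos a.
  rewrite /gain (max_r (ltW w0)) ler_pM2l//.
  have [k [kK kE kO]] := visit_piece a.
  have kk : kn k < kn k.+1 by rewrite (knot_lt nodes).
  have k1 : kn k.+1 <= 1 by exact: (knot_le1 nodes).
  have k0 : 0 <= kn k by exact: knot_ge0.
  have sub : `]kn k, kn k.+1[%classic `<=` openblock s t g1 g2 i j.
    move=> z /=; rewrite in_itv/= => /andP[z1 z2]; apply/openblockE; last exact: kO.
    by rewrite in_itv/=; apply/andP; split; lra.
  (* The piece lasts 1 / K, and its speed is K times the root. *)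
  have -> : Num.sqrt (x i j * y i j) = \int[mu]_(z in `]kn k, kn k.+1[) speed h1 h2 z.
    rewrite (@Rint_ae_const _ _ _ (K%:R * Num.sqrt (x i j * y i j)))//.
    - rewrite lebesgue_measure_itv/= lte_fin kk -EFinB/= /knot -mulrBl -natrB//.
      by rewrite subSnn mul1r mulrAC divff ?mul1r// pnatr_eq0 -lt0n.
    - apply: measurable_funS (rint_meas (speed_rint d1 d2)) => //.
      by move=> z /=; rewrite !in_itv/= => /andP[z1 z2]; apply/andP; split; lra.
    - apply: (@filterS _ _ (ae_filter_ringOfSetsType mu)) polygon_density => z + zk.
      move: (zk); rewrite /= in_itv/= => /andP[z1 z2].
      have z01 : z \in `[0, 1] by rewrite in_itv/=; apply/andP; split; lra.
      move=> /(_ z01)[k' [k'K [z1' z2'] e1 e2]].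
      have le1 : (k' < k.+1)%N by rewrite -(knot_lt nodes) (lt_trans z1').
      have le2 : (k < k'.+1)%N by rewrite -(knot_lt nodes) (lt_trans z1).
      have ek : k' = k by apply/eqP; rewrite eqn_leq -ltnS le1.
      by rewrite ek in e1 e2; apply: (speed_piece kK kE) => //; exact: ltW.
  apply: Rint_sub_mono => //; [exact: openblock_sub|exact: (speed_rint d1 d2)|exact: speed_ge0].
have [x0 y0] := nm na; rewrite /gain x0 mul0r sqrtr0 mulr0.
have [w0|w0] := leP 0 (W i j); first exact: mulr_ge0.
rewrite (@Rint_ae_const _ _ _ 0) ?mul0r ?mulr0//.
- by apply: measurable_funS (rint_meas (speed_rint d1 d2)) => //; exact: openblock_sub.
- apply: (@filterS _ _ (ae_filter_ringOfSetsType mu)) polygon_density => z + zO.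
  have z01 : z \in `[0, 1] by exact: openblock_sub zO.
  move=> /(_ z01)[k [kK [z1 z2] e1 e2]]; rewrite /speed.
  have [E|[E|[i' [j' [a _ H]]]]] := piece_visit kK.
  + by rewrite e1 E subrr mulr0 sqrtr0 mul0r.
  + by rewrite e2 E subrr mulr0 sqrtr0 mulr0.
  + have [c1 c2 c3 c4] := H z z1 z2; have [c1' c2' c3' c4'] := (openblockE i j z01).1 zO.
    have [/andP[i1 im] /andP[j1 jn]] : (1 <= i <= m)%N /\ (1 <= j <= n)%N.
      by case/and4P: ij => -> -> -> ->.
    have [/andP[i1' im'] /andP[j1' jn']] : (1 <= i' <= m)%N /\ (1 <= j' <= n)%N.
      by case/and4P: (act_block a) => -> -> -> ->.
    have ei : i = i'.
      by apply: (@cell_uniq _ m s ssub i i' (gam z).1); rewrite ?i1 ?i1' ?im//= /cell ?c1 ?c1'.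
    have ej : j = j'.
      by apply: (@cell_uniq _ n t tsub j j' (gam z).2); rewrite ?j1 ?j1' ?jn//= /cell ?c3 ?c3'.
    by move: na; rewrite ei ej a.
Qed.

Lemma polygon_attains : value m n W x y <= correlation m n s t u v g1 g2 h1 h2.
Proof.
rewrite (@correlationE _ _ m n s t u v _ _ _ _ d1 d2) /value.
apply: ler_sum_nat => i im; apply: ler_sum_nat => j jn; apply: gain_le.
by case/andP: im => *; case/andP: jn => *; apply/and4P.
Qed.

End Attainment.

(** * Slopes of consecutive P-segments *)

Section Boxes.
Context {R : realType}.

(** Weaker than membership in [Gamma_tilde] and stable under [mono_cont_reflect], so that statements
    about leaving a box follow from those about entering one. *)
Definition mono_cont (g : R -> R) :=
  (forall x y, 0 <= x -> x <= y -> y <= 1 -> g x <= g y) /\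
  (forall e, 0 < e -> exists2 d, 0 < d &
     forall x y, 0 <= x -> x <= y -> y <= 1 -> y - x < d -> g y - g x < e).

Lemma mono_cont_Gamma g h : Gamma_tilde g -> density g h -> mono_cont g.
Proof.
move=> [ac _ _ _ _] d; split; first exact: density_mono d.
move=> e e0; have [r r0 H] := ac_unif ac e0; exists r => // x y x0 xy y1 yx.
exact: le_lt_trans (ler_norm _) (H _ _ x0 xy y1 yx).
Qed.

Lemma mono_cont_reflect g : mono_cont g -> mono_cont (fun z => - g (1 - z)).
Proof.
move=> [mono cont]; split=> [x y x0 xy y1|e e0]; first by rewrite lerN2; apply: mono; lra.
have [d d0 H] := cont e e0; exists d => // x y x0 xy y1 yx.
have : g (1 - x) - g (1 - y) < e by apply: H; lra.
lra.
Qed.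

Definition box (g1 g2 : R -> R) (l1 r1 l2 r2 : R) : set R := [set z | z \in `[0, 1] /\
  [/\ l1 <= g1 z, g1 z <= r1, l2 <= g2 z & g2 z <= r2]].

Lemma box_reflect g1 g2 l1 r1 l2 r2 z :
  box (fun z => - g1 (1 - z)) (fun z => - g2 (1 - z)) (- r1) (- l1) (- r2) (- l2) z <->
  box g1 g2 l1 r1 l2 r2 (1 - z).
Proof.
rewrite /box /=; split=> -[]; rewrite !in_itv/= => z01 [h1 h2 h3 h4]; split;
  by [lra|rewrite !lerN2 in h1 h2 h3 h4 *; split|rewrite !lerN2; split].
Qed.

Definition least (Q : set R) a := Q a /\ forall z, Q z -> a <= z.

Section OneBox.
Variables (g1 g2 : R -> R) (l1 r1 l2 r2 : R).
Hypotheses (G1 : mono_cont g1) (G2 : mono_cont g2).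
Local Notation Q := (box g1 g2 l1 r1 l2 r2).

Lemma box_least z0 : Q z0 -> exists a, least Q a.
Proof.
move=> Qz; have lb : lbound Q 0 by move=> z [+ _]; rewrite in_itv/= => /andP[].
have iQ : has_inf Q by split; [exists z0|exists 0].
have a0 : 0 <= inf Q by apply: lb_le_inf => //; exists z0.
have aQ z : Q z -> inf Q <= z by move=> Qz'; apply: ge_inf => //; exists 0.
exists (inf Q); split=> //.
have z01 : z0 <= 1 by case: Qz => + _; rewrite in_itv/= => /andP[].
have a1 : inf Q <= 1 by exact: le_trans (aQ _ Qz) _.
have near (d : R) : 0 < d -> exists2 z, Q z & z - inf Q < d.
  by move=> d0; have [z Qz' zd] := inf_adherent d0 iQ; exists z => //; lra.
have low g l : mono_cont g -> (forall z, Q z -> l <= g z) -> l <= g (inf Q).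
  move=> [mono cont] lQ; rewrite leNgt; apply/negP => gl.
  have [d d0 H] := cont (l - g (inf Q)) ltac:(lra); have [z Qz' zd] := near d d0.
  have := H _ z a0 (aQ _ Qz') _ zd; have := lQ z Qz'.
  by case: Qz' => + _; rewrite in_itv/= => /andP[_ z1] h /(_ z1); lra.
split; first by rewrite in_itv/= a0.
have [z01' [h1 h2 h3 h4]] := Qz; split.
- by apply: low => // z [_ []].
- by apply: le_trans h2; apply: G1.1 => //; exact: aQ.
- by apply: low => // z [_ []].
- by apply: le_trans h4; apply: G2.1 => //; exact: aQ.
Qed.

(** Otherwise, by continuity, the curve would be in the box slightly earlier. *)
Lemma box_entry a : least Q a -> 0 < a -> g1 a = l1 \/ g2 a = l2.
Proof.
move=> [[a01 [h1 h2 h3 h4]] aQ] a0.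
have a1 : a <= 1 by move: a01; rewrite in_itv/= => /andP[].
have [e1|e1] := eqVneq (g1 a) l1; first by left.
have [e2|e2] := eqVneq (g2 a) l2; first by right.
have p1 : 0 < g1 a - l1 by rewrite subr_gt0 lt_neqAle eq_sym e1.
have p2 : 0 < g2 a - l2 by rewrite subr_gt0 lt_neqAle eq_sym e2.
have [d1 d10 H1] := G1.2 _ p1; have [d2 d20 H2] := G2.2 _ p2.
pose d := Num.min a (Num.min d1 d2).
have d0 : 0 < d by rewrite /d !lt_min a0 d10.
have da : d <= a by rewrite /d ge_min lexx.
have dd1 : d <= d1 by rewrite /d !ge_min lexx orbT.
have dd2 : d <= d2 by rewrite /d !ge_min lexx !orbT.
pose z := a - d / 2.
have z0 : 0 <= z by rewrite /z; lra.
have za : z <= a by rewrite /z; lra.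
have m1 := G1.1 _ _ z0 za a1; have m2 := G2.1 _ _ z0 za a1.
have b1 : g1 a - g1 z < g1 a - l1 by apply: H1 => //; rewrite /z; lra.
have b2 : g2 a - g2 z < g2 a - l2 by apply: H2 => //; rewrite /z; lra.
have Qz : Q z by split; [rewrite in_itv/=; apply/andP; split; lra|split; lra].
by have := aQ z Qz; rewrite /z; lra.
Qed.

(** Entering at the far end of the left or lower edge would mean passing a vertex in the interior of
    a P-segment, which [nv] excludes. Hence both coordinates still grow inside the box. *)
Lemma box_entry_corner c1 c2 a : 0 <= c1 -> c1 < c2 -> c2 <= 1 -> l1 < r1 -> l2 < r2 ->
  g1 c1 <= l1 -> g2 c1 <= l2 -> g1 c2 = r1 -> g2 c2 = r2 ->
  (forall z, c1 < z -> z < c2 -> ~ (g1 z = r1 /\ g2 z = l2) /\ ~ (g1 z = l1 /\ g2 z = r2)) ->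
  least Q a -> g1 a < r1 /\ g2 a < r2.
Proof.
move=> c10 c12 c21 lr1 lr2 p1 p2 q1 q2 nv la; have [[a01 [h1 h2 h3 h4]] aQ] := la.
move: (a01); rewrite in_itv/= => /andP[a0 a1].
have Qc2 : Q c2 by split; [rewrite in_itv/=; apply/andP; split; lra|rewrite q1 q2; split; lra].
have ac2 := aQ _ Qc2.
have big g l r : mono_cont g -> l < r -> g c1 <= l -> g a = r -> c1 < a.
  move=> G lr gl gr; rewrite ltNge; apply/negP => ac1.
  by have := G.1 _ _ a0 ac1 (ltW (lt_le_trans c12 c21)); rewrite gr; lra.
split; rewrite lt_neqAle ?h2 ?h4 andbT; apply/eqP => e.
  have ca := big _ _ _ G1 lr1 p1 e; have [|e'|e'] := box_entry la; [lra|lra|].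
  have ac : a < c2 by rewrite lt_neqAle ac2 andbT; apply/eqP => ac; rewrite ac in e'; lra.
  by have [[]] := nv _ ca ac.
have ca := big _ _ _ G2 lr2 p2 e; have [|e'|e'] := box_entry la; [lra| |lra].
have ac : a < c2 by rewrite lt_neqAle ac2 andbT; apply/eqP => ac; rewrite ac in e'; lra.
by have [_ []] := nv _ ca ac.
Qed.

Lemma box_convex x y z : Q x -> Q y -> x <= z -> z <= y -> Q z.
Proof.
move=> [x01 [p1 p2 p3 p4]] [y01 [q1 q2 q3 q4]] xz zy.
move: x01 y01; rewrite !in_itv/= => /andP[x0 x1] /andP[y0 y1].
have z0 : 0 <= z by lra. have z1 : z <= 1 by lra.
have := G1.1 _ _ x0 xz z1; have := G1.1 _ _ z0 zy y1.
have := G2.1 _ _ x0 xz z1; have := G2.1 _ _ z0 zy y1 => *.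
by split; [rewrite in_itv/= z0|split; lra].
Qed.

(** Both increments are positive, so the slope of the block is a positive real number. *)
Definition proper_box a b := [/\ Q = `[a, b]%classic, 0 <= a /\ b <= 1, a < b, g1 a < g1 b & g2 a < g2 b].

End OneBox.

Lemma proper_box_of g1 g2 l1 r1 l2 r2 a b : mono_cont g1 -> mono_cont g2 ->
  box g1 g2 l1 r1 l2 r2 a -> box g1 g2 l1 r1 l2 r2 b ->
  (forall z, box g1 g2 l1 r1 l2 r2 z -> a <= z /\ z <= b) ->
  g1 a < g1 b -> g2 a < g2 b -> proper_box g1 g2 l1 r1 l2 r2 a b.
Proof.
move=> G1 G2 Qa Qb H i1 i2; split=> //.
- apply/seteqP; split=> z /=; rewrite in_itv/=.
    by move=> /H[-> ->].
  by move=> /andP[]; exact: box_convex.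
- by case: Qa Qb => + _ [+ _]; rewrite !in_itv/= => /andP[-> _] /andP[_ ->].
- have [_ ab] := H _ Qa; rewrite lt_neqAle ab andbT; apply/eqP => e.
  by rewrite e ltxx in i1.
Qed.

Lemma box_greatest g1 g2 l1 r1 l2 r2 z0 : mono_cont g1 -> mono_cont g2 ->
  box g1 g2 l1 r1 l2 r2 z0 -> exists b, [/\ box g1 g2 l1 r1 l2 r2 b,
    forall z, box g1 g2 l1 r1 l2 r2 z -> z <= b &
    least (box (fun z => - g1 (1 - z)) (fun z => - g2 (1 - z)) (- r1) (- l1) (- r2) (- l2)) (1 - b)].
Proof.
move=> G1 G2 Qz; pose Q' := box (fun z => - g1 (1 - z)) (fun z => - g2 (1 - z)) (- r1) (- l1) (- r2) (- l2).
have c (z : R) : 1 - (1 - z) = z by ring.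
have Qz' : Q' (1 - z0) by apply/box_reflect; rewrite c.
have [a la] := box_least (mono_cont_reflect G1) (mono_cont_reflect G2) Qz'.
exists (1 - a); split; last by rewrite c.
- by case: la => /box_reflect.
- move=> z Qz1; have : a <= 1 - z by case: la => _; apply; apply/box_reflect; rewrite c.
  lra.
Qed.

Lemma end_box g1 g2 l1 r1 l2 r2 c1 c2 : mono_cont g1 -> mono_cont g2 ->
  0 <= c1 -> c1 < c2 -> c2 <= 1 -> l1 < r1 -> l2 < r2 ->
  g1 c1 <= l1 -> g2 c1 <= l2 -> g1 c2 = r1 -> g2 c2 = r2 ->
  (forall z, c1 < z -> z < c2 -> ~ (g1 z = r1 /\ g2 z = l2) /\ ~ (g1 z = l1 /\ g2 z = r2)) ->
  exists a b, proper_box g1 g2 l1 r1 l2 r2 a b.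
Proof.
move=> G1 G2 c10 c12 c21 lr1 lr2 p1 p2 q1 q2 nv.
have Qc2 : box g1 g2 l1 r1 l2 r2 c2.
  by split; [rewrite in_itv/=; apply/andP; split; lra|rewrite q1 q2; split; lra].
have [a la] := box_least G1 G2 Qc2.
have [b [Qb bQ _]] := box_greatest G1 G2 Qc2.
have [i1 i2] := box_entry_corner G1 G2 c10 c12 c21 lr1 lr2 p1 p2 q1 q2 nv la.
have c20 : 0 <= c2 by lra.
have b1 : b <= 1 by case: Qb => + _; rewrite in_itv/= => /andP[].
have := G1.1 _ _ c20 (bQ _ Qc2) b1; have := G2.1 _ _ c20 (bQ _ Qc2) b1.
rewrite q1 q2 => m2 m1; exists a, b; case: la => Qa aQ.
by apply: proper_box_of => // [z Qz||]; [split; [exact: aQ|exact: bQ]|lra|lra].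
Qed.

Lemma start_box g1 g2 l1 r1 l2 r2 c1 c2 : mono_cont g1 -> mono_cont g2 ->
  0 <= c1 -> c1 < c2 -> c2 <= 1 -> l1 < r1 -> l2 < r2 ->
  g1 c1 = l1 -> g2 c1 = l2 -> r1 <= g1 c2 -> r2 <= g2 c2 ->
  (forall z, c1 < z -> z < c2 -> ~ (g1 z = r1 /\ g2 z = l2) /\ ~ (g1 z = l1 /\ g2 z = r2)) ->
  exists a b, proper_box g1 g2 l1 r1 l2 r2 a b.
Proof.
move=> G1 G2 c10 c12 c21 lr1 lr2 p1 p2 q1 q2 nv.
have Qc1 : box g1 g2 l1 r1 l2 r2 c1.
  by split; [rewrite in_itv/=; apply/andP; split; lra|rewrite p1 p2; split; lra].
have [a [Qa aQ]] := box_least G1 G2 Qc1.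
have [b [Qb bQ lb]] := box_greatest G1 G2 Qc1.
have c (z : R) : 1 - (1 - z) = z by ring.
(* The last time in the box is the first time for the reversed curve. *)
have [] := @box_entry_corner _ _ (- r1) (- l1) (- r2) (- l2) (mono_cont_reflect G1) (mono_cont_reflect G2)
  (1 - c2) (1 - c1) (1 - b); rewrite ?c ?p1 ?p2 //; try lra.
  move=> z z1 z2; have [|| n1 n2] := nv (1 - z); [lra|lra|].
  by split=> -[/oppr_inj e1 /oppr_inj e2]; [apply: n2|apply: n1].
move=> i1 i2.
have c11 : c1 <= 1 by lra.
have a0 : 0 <= a by case: Qa => + _; rewrite in_itv/= => /andP[].
have := G1.1 _ _ a0 (aQ _ Qc1) c11; have := G2.1 _ _ a0 (aQ _ Qc1) c11.
rewrite p1 p2 => m2 m1; exists a, b.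
by apply: proper_box_of => // [z Qz||]; [split; [exact: aQ|exact: bQ]|lra|lra].
Qed.

End Boxes.

Lemma gap_cmp iA jA iB jB p q i j : (iA <= p <= iB)%N -> (jA <= q <= jB)%N ->
  ((i <= iA) && (j <= jA))%N || ((iB <= i) && (jB <= j))%N -> cmp_block i j p q.
Proof. rewrite /cmp_block; lia. Qed.

(** * First order conditions for an arbitrary optimal curve *)

Section Exchange.
Context {R : realType} {N : nat}.
Local Notation mu := (@lebesgue_measure R).
Variables (m n : nat) (s t : nat -> R) (u v : nat -> 'rV[R]_N).
Hypotheses (ssub : subdivision 0 1 m s) (tsub : subdivision 0 1 n t).
Local Notation W := (weight u v).
Variables (g1 g2 h1 h2 : R -> R).
Hypotheses (G1 : Gamma_tilde g1) (d1 : density g1 h1).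
Hypotheses (G2 : Gamma_tilde g2) (d2 : density g2 h2).
Variables xM yM : nat -> nat -> R.
Hypothesis mx : maximal m n (ds s) (dt t) W xM yM.
Hypothesis opt : value m n W xM yM <= correlation m n s t u v g1 g2 h1 h2.

Variables (iA jA iB jB : nat) (aA eA aB eB : R).
Hypotheses (bA : is_block m n iA jA) (bB : is_block m n iB jB).
Hypotheses (wA : 0 < W iA jA) (wB : 0 < W iB jB).
Hypotheses (iAB : (iA < iB)%N) (jAB : (jA < jB)%N).
Hypothesis PA : proper_box g1 g2 (s iA.-1) (s iA) (t jA.-1) (t jA) aA eA.
Hypothesis PB : proper_box g1 g2 (s iB.-1) (s iB) (t jB.-1) (t jB) aB eB.
Hypothesis gap : forall i j z, is_block m n i j -> openblock s t g1 g2 i j z ->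
  ((i <= iA) && (j <= jA))%N || ((iB <= i) && (jB <= j))%N.

Definition special i j := ((i, j) == (iA, jA)) || ((i, j) == (iB, jB)).
(* The increments over the closed preimages of A and B are those which define
   their slopes; they may exceed the ones over the open blocks as long as the
   optimality of the curve is not known. *)
Definition pieces i j : set R :=
  if is_block m n i j then
    if special i j then closedblock s t g1 g2 i j else openblock s t g1 g2 i j
  else set0.
Local Notation X := (incr_s h1 pieces).
Local Notation Y := (incr_t h2 pieces).

Lemma closedblock_proper i j a b :
  proper_box g1 g2 (s i.-1) (s i) (t j.-1) (t j) a b -> closedblock s t g1 g2 i j = `[a, b]%classic.
Proof.
move=> [<- _ _ _ _]; apply/seteqP; split=> z.
  by move=> [[z01 /= +] [_ /=]]; rewrite !in_itv/= => /andP[? ?] /andP[? ?].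
by move=> [z01 [? ? ? ?]]; split; split=> //=; rewrite in_itv/=; apply/andP.
Qed.

Lemma pieces_in i j z : pieces i j z -> [/\ is_block m n i j,
  closedblock s t g1 g2 i j z, ~~ special i j -> openblock s t g1 g2 i j z &
  ((i <= iA) && (j <= jA))%N || ((iB <= i) && (jB <= j))%N].
Proof.
rewrite /pieces; case: (boolP (is_block m n i j)) => // ij; case: (boolP (special i j)) => sp.
  move=> cl; split=> //; by case/orP: sp => /eqP[-> ->]; rewrite !leqnn ?orbT.
move=> op; split=> //; last exact: gap op.
by case: op => [[z01 /= a] [_ /= b]]; split; split=> //=; move: a b; rewrite !in_itv/= => /andP[? ?] /andP[? ?]; rewrite !ltW.
Qed.

Lemma openblock_cells i j z : openblock s t g1 g2 i j z -> [/\ z \in `[0, 1], cell s i (g1 z) & cell t j (g2 z)].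
Proof. by move=> [[z01 a] [_ b]]. Qed.

(** A block with closed preimage is compared by [gap], which puts every visited block before A or
    after B; two blocks with open preimages are compared by monotonicity. *)
Lemma pieces_chain i j i' j' z z' : pieces i j z -> pieces i' j' z' -> cmp_block i j i' j'.
Proof.
move=> /pieces_in[ij _ op gp] /pieces_in[ij' _ op' gp'].
have [sp|/op/openblock_cells[z1 z2 z3]] := boolP (special i j).
  rewrite cmp_blockC; apply: gap_cmp gp'; have li := ltnW iAB; have lj := ltnW jAB.
    by case/orP: sp => /eqP[-> _]; rewrite leqnn ?andbT.
  by case/orP: sp => /eqP[_ ->]; rewrite leqnn ?andbT.
have [sp|/op'/openblock_cells[z1' z2' z3']] := boolP (special i' j').
  apply: gap_cmp gp; have li := ltnW iAB; have lj := ltnW jAB.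
    by case/orP: sp => /eqP[-> _]; rewrite leqnn ?andbT.
  by case/orP: sp => /eqP[_ ->]; rewrite leqnn ?andbT.
exact: (cell_chain d1 d2 ssub tsub ij ij' z1 z1' z2 z3 z2' z3').
Qed.

Lemma closed_cell (k : nat) (r : nat -> R) i i' w : subdivision 0 1 k r ->
  (1 <= i <= k)%N -> (1 <= i' <= k)%N -> r i.-1 <= w <= r i -> cell r i' w -> i = i'.
Proof.
move=> sub /andP[i0 ik] /andP[i0' ik'] /andP[h1' h2'] /andP[h3 h4].
have a1 := sub_lt_idx sub (leq_trans (leq_pred _) ik) ik' (le_lt_trans h1' h4).
have a2 := sub_lt_idx sub (leq_trans (leq_pred _) ik') ik (lt_le_trans h3 h2').
by apply/eqP; rewrite eqn_leq; case: (i) (i') i0 i0' a1 a2 => [|p] [|q] //= _ _ -> ->.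
Qed.

Lemma closedblock_bounds i j z : closedblock s t g1 g2 i j z ->
  s i.-1 <= g1 z <= s i /\ t j.-1 <= g2 z <= t j.
Proof. by move=> [[_ a] [_ b]]. Qed.

Lemma pieces_row i j j' z : is_block m n i j -> is_block m n i j' ->
  pieces i j z -> pieces i j' z -> j = j'.
Proof.
move=> ij ij' /pieces_in[_ /closedblock_bounds[_ c] op gp] /pieces_in[_ /closedblock_bounds[_ c'] op' gp'].
have r : (1 <= j <= n)%N by case/and4P: ij => _ _ -> ->.
have r' : (1 <= j' <= n)%N by case/and4P: ij' => _ _ -> ->.
have [sp|/op/openblock_cells[_ _ z3]] := boolP (special i j); last first.
  by symmetry; exact: (closed_cell tsub r' r c' z3).
have [sp'|/op'/openblock_cells[_ _ z3]] := boolP (special i j'); last exact: (closed_cell tsub r r' c z3).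
have lt := iAB; case/orP: sp => /eqP[e1 e2]; case/orP: sp' => /eqP[e3 e4]; rewrite ?e2 ?e4//.
  by rewrite -e1 -e3 ltnn in lt.
by rewrite -e1 -e3 ltnn in lt.
Qed.

Lemma pieces_col i i' j z : is_block m n i j -> is_block m n i' j ->
  pieces i j z -> pieces i' j z -> i = i'.
Proof.
move=> ij ij' /pieces_in[_ /closedblock_bounds[c _] op gp] /pieces_in[_ /closedblock_bounds[c' _] op' gp'].
have r : (1 <= i <= m)%N by case/and4P: ij => -> ->.
have r' : (1 <= i' <= m)%N by case/and4P: ij' => -> ->.
have [sp|/op/openblock_cells[_ z3 _]] := boolP (special i j); last first.
  by symmetry; exact: (closed_cell ssub r' r c' z3).
have [sp'|/op'/openblock_cells[_ z3 _]] := boolP (special i' j); last exact: (closed_cell ssub r r' c z3).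
have lt := jAB; case/orP: sp => /eqP[e1 e2]; case/orP: sp' => /eqP[e3 e4]; rewrite ?e1 ?e3//.
  by rewrite -e2 -e4 ltnn in lt.
by rewrite -e2 -e4 ltnn in lt.
Qed.

Lemma pieces_meas i j : measurable (pieces i j).
Proof.
rewrite /pieces; case: ifP => // _; case: ifP => _; last exact: (openblock_meas _ _ d1 d2).
by apply: measurableI; [exact: (mpre d1)|exact: (mpre d2)].
Qed.

(** The value of these increments is at least the correlation of the optimal curve, hence maximal.
    This makes the exchange inequality available for every optimal curve, not just for the
    polygon. *)
Lemma pieces_maximal : maximal m n (ds s) (dt t) W X Y.
Proof.
have cl i j : is_block m n i j -> pieces i j `<=` closedblock s t g1 g2 i j.
  by move=> _ z /pieces_in[].
split.
  exact: (@feasible_sets _ m n s t ssub tsub g1 g2 h1 h2 G1 d1 G2 d2 _ pieces_meas cl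
    pieces_row pieces_col pieces_chain).
move=> x' y' /mx.2 le; apply: (le_trans le); apply: (le_trans opt).
apply: (correlation_le_value u v d1 d2) => //; first exact: pieces_meas.
move=> i j ij z op; rewrite /pieces ij; case: ifP => // _.
by case: op => [[z01 /= a] [_ /= b]]; split; split=> //=; move: a b; rewrite !in_itv/= => /andP[? ?] /andP[? ?]; rewrite !ltW.
Qed.

Lemma density_cc g h a b : density g h -> 0 <= a -> a <= b -> b <= 1 ->
  \int[mu]_(x in `[a, b]) h x = g b - g a.
Proof.
move=> d a0 ab b1; case: (d) => _ _ -> // _; symmetry.
by apply: (@Rintegral_itv_obnd_cbnd R a (BRight b) h); exact: (density_ih d).
Qed.

Lemma pieces_proper i j a b : is_block m n i j -> special i j ->
  proper_box g1 g2 (s i.-1) (s i) (t j.-1) (t j) a b ->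
  X i j = g1 b - g1 a /\ Y i j = g2 b - g2 a.
Proof.
move=> ij sp P; have [_ [a0 b1] ab _ _] := P.
rewrite /incr_s /incr_t /pieces ij sp (closedblock_proper P).
by rewrite (density_cc d1) ?(density_cc d2)// ltW.
Qed.

Lemma pieces_active i j a b : is_block m n i j -> special i j -> 0 < W i j ->
  proper_box g1 g2 (s i.-1) (s i) (t j.-1) (t j) a b -> active m n W X Y i j.
Proof.
move=> ij sp w P; have [XE YE] := pieces_proper ij sp P.
by have [_ _ _ i1 i2] := P; rewrite /active ij w XE YE !subr_gt0 i1 i2.
Qed.

Lemma pieces_support i j : X i j * Y i j != 0 ->
  ((i <= iA) && (j <= jA))%N || ((iB <= i) && (jB <= j))%N.
Proof.
move=> ne; have [[z]|] := pselect (exists z, pieces i j z); first by case/pieces_in.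
move=> e; exfalso; move: ne; have e0 : pieces i j = set0.
  by apply/seteqP; split=> // z pz; case: e; exists z.
by rewrite /incr_s e0 Rintegral_set0 mul0r eqxx.
Qed.

Lemma pieces_gap i j : (iA < i)%N || (jA < j)%N -> (i < iB)%N || (j < jB)%N -> X i j = 0 /\ Y i j = 0.
Proof.
move=> h1' h2'; have e0 : pieces i j = set0.
  apply/seteqP; split=> // z /pieces_in[_ _ _]; clear -h1' h2'; lia.
by rewrite /incr_s /incr_t e0 !Rintegral_set0.
Qed.

Let spA : special iA jA. Proof. by rewrite /special eqxx. Qed.
Let spB : special iB jB. Proof. by rewrite /special eqxx orbT. Qed.
Let actA := pieces_active bA spA wA PA.
Let actB := pieces_active bB spB wB PB.

Lemma exchange_upper : 0 < W iA jB ->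
  W iA jB ^+ 2 <= (W iA jA * Num.sqrt ((g2 eA - g2 aA) / (g1 eA - g1 aA))) *
                  (W iB jB * Num.sqrt ((g1 eB - g1 aB) / (g2 eB - g2 aB))).
Proof.
move=> w; have [XA YA] := pieces_proper bA spA PA; have [XB YB] := pieces_proper bB spB PB.
have [z1 z2] : X iA jB = 0 /\ Y iA jB = 0 by apply: pieces_gap; rewrite ?iAB ?jAB ?orbT.
rewrite -XA -YA -XB -YB; apply: (maximal_exchange pieces_maximal) => // i j /pieces_support.
by apply: gap_cmp; rewrite leqnn ltnW.
Qed.

Lemma exchange_lower : 0 < W iB jA ->
  W iB jA ^+ 2 <= (W iA jA * Num.sqrt ((g1 eA - g1 aA) / (g2 eA - g2 aA))) *
                  (W iB jB * Num.sqrt ((g2 eB - g2 aB) / (g1 eB - g1 aB))).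
Proof.
move=> w; have [XA YA] := pieces_proper bA spA PA; have [XB YB] := pieces_proper bB spB PB.
have [z1 z2] : X iB jA = 0 /\ Y iB jA = 0 by apply: pieces_gap; rewrite ?iAB ?jAB ?orbT.
rewrite -XA -YA -XB -YB.
(* After transposition the corner block (iB, jA) takes the place of (iA, jB). *)
apply: (@maximal_exchange _ n m (dt t) (ds s) (tr W) (tr Y) (tr X) (maximal_tr pieces_maximal) jA iA jB iB) => //.
- by rewrite active_tr.
- by rewrite active_tr.
- move=> j i; rewrite /tr mulrC => /pieces_support h.
  have lI : (iA <= iB <= iB)%N by rewrite leqnn (ltnW iAB).
  have lJ : (jA <= jA <= jB)%N by rewrite leqnn (ltnW jAB).
  by have := gap_cmp lI lJ h; rewrite /cmp_block => /orP[|] /andP[-> ->]; rewrite ?orbT.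
Qed.

End Exchange.

Section Consecutive.
Context {R : realType} {N : nat}.
Variables (m n : nat) (s t : nat -> R) (u v : nat -> 'rV[R]_N).
Hypotheses (ssub : subdivision 0 1 m s) (tsub : subdivision 0 1 n t).
Local Notation W := (weight u v).
Variable gam : R -> R * R.
Local Notation g1 := (fun z => (gam z).1).
Local Notation g2 := (fun z => (gam z).2).
Variables h1 h2 : R -> R.
Hypotheses (G1 : Gamma_tilde g1) (d1 : density g1 h1).
Hypotheses (G2 : Gamma_tilde g2) (d2 : density g2 h2).

Let mc1 := mono_cont_Gamma G1 d1.
Let mc2 := mono_cont_Gamma G2 d2.

Lemma H_proper i j a b : proper_box g1 g2 (s i.-1) (s i) (t j.-1) (t j) a b ->
  H s t gam i j = (((gam b).2 - (gam a).2) / ((gam b).1 - (gam a).1))%:E.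
Proof.
move=> [E [a0 b1] ab i1 i2]; rewrite /H -[block_preimage _ _ _ _ _]/(box g1 g2 _ _ _ _) E.
by rewrite inf_itv ?sup_itv ?bnd_simp//= ?ltW// /slope gt_eqF.
Qed.

Lemma no_vertex a b z i j k l : P_segment m n s t W gam a b -> a < z -> z < b ->
  is_block m n i j -> is_block m n k l ->
  ~ (g1 z = s i /\ g2 z = t l.-1) /\ ~ (g1 z = s i.-1 /\ g2 z = t l).
Proof.
move=> P az zb /and4P[_ im _ _] /and4P[_ _ _ ln].
have zab : z \in `]a, b[ by rewrite in_itv/= az.
split=> -[e1 e2].
  by apply: (P2_interior P zab im (leq_trans (leq_pred _) ln)); rewrite [gam z]surjective_pairing e1 e2.
by apply: (P2_interior P zab (leq_trans (leq_pred _) im) ln); rewrite [gam z]surjective_pairing e1 e2.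
Qed.

Lemma P_end_box c1 c2 i j : P_segment m n s t W gam c1 c2 -> (i <= m)%N -> (j <= n)%N ->
  gam c2 = (s i, t j) -> [/\ is_block m n i j, 0 < W i j &
    exists a b, proper_box g1 g2 (s i.-1) (s i) (t j.-1) (t j) a b].
Proof.
move=> P im jn e; have [i0 [j0 [i1 [j1 [b0 b1 [i01 j01] [ga gb] [_ w1]]]]]] := P2_ends P.
have [_ i1m _ j1n] := and4P b1; have [_ i0m _ j0n] := and4P b0.
move: gb; rewrite e => -[/(sub_inj ssub im i1m) ei /(sub_inj tsub jn j1n) ej]; subst i1 j1.
split=> //; have [c10 c12 c21] := P_itv P.
have [i1' _ j1' _] := and4P b1.
apply: (@end_box _ g1 g2 _ _ _ _ c1 c2 mc1 mc2 c10 c12 c21) => //=.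
- by apply: (sub_lt ssub) => //; rewrite ltn_predL.
- by apply: (sub_lt tsub) => //; rewrite ltn_predL.
- by rewrite ga /=; apply: (sub_le ssub); [rewrite -!subn1 leq_sub2r|exact: leq_trans (leq_pred _) im].
- by rewrite ga /=; apply: (sub_le tsub); [rewrite -!subn1 leq_sub2r|exact: leq_trans (leq_pred _) jn].
- by rewrite e.
- by rewrite e.
- by move=> z z1 z2; exact: (no_vertex P z1 z2 b1 b1).
Qed.

Lemma P_start_box c1 c2 i j : P_segment m n s t W gam c1 c2 -> (i <= m)%N -> (j <= n)%N ->
  gam c1 = (s i, t j) -> [/\ is_block m n i.+1 j.+1, 0 < W i.+1 j.+1 &
    exists a b, proper_box g1 g2 (s i) (s i.+1) (t j) (t j.+1) a b].
Proof.
move=> P im jn e; have [i0 [j0 [i1 [j1 [b0 b1 [i01 j01] [ga gb] [w0 _]]]]]] := P2_ends P.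
have [_ i1m _ j1n] := and4P b1; have [i00 i0m j00 j0n] := and4P b0.
move: ga; rewrite e => -[/(sub_inj ssub im (leq_trans (leq_pred _) i0m)) ei
  /(sub_inj tsub jn (leq_trans (leq_pred _) j0n)) ej].
have ei' : i0 = i.+1 by rewrite ei prednK.
have ej' : j0 = j.+1 by rewrite ej prednK.
subst i0 j0; split=> //; have [c10 c12 c21] := P_itv P.
apply: (@start_box _ g1 g2 _ _ _ _ c1 c2 mc1 mc2 c10 c12 c21) => //=.
- exact: (sub_lt ssub).
- exact: (sub_lt tsub).
- by rewrite e.
- by rewrite e.
- by rewrite gb; exact: (sub_le ssub).
- by rewrite gb; exact: (sub_le tsub).
- by move=> z z1 z2; exact: (no_vertex P z1 z2 b0 b0).
Qed.

(** Before [c2] and after [c3] monotonicity decides; in between the curve stays on gridlines and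
    meets no open block. *)
Lemma consecutive_gap c2 c3 i1 j1 i2 j2 i j z : 0 <= c2 -> c2 <= c3 -> c3 <= 1 ->
  (i1 <= m)%N -> (j1 <= n)%N -> (i2 <= m)%N -> (j2 <= n)%N ->
  c2 = c3 \/ N_segment m n s t W gam c2 c3 ->
  gam c2 = (s i1, t j1) -> gam c3 = (s i2, t j2) ->
  is_block m n i j -> openblock s t g1 g2 i j z ->
  ((i <= i1) && (j <= j1))%N || ((i2 < i) && (j2 < j))%N.
Proof.
move=> c20 c23 c31 i1m j1n i2m j2n NS e2 e3 ij [[z01 /= +] [_ /=]].
rewrite !in_itv/= => /andP[a1 a2] /andP[b1 b2].
have [i0 im j0 jn] := and4P ij; move: z01; rewrite in_itv/= => /andP[z0 z1].
have [zc|cz] := leP z c2.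
  have m1 := mc1.1 _ _ z0 zc (le_trans c23 c31); have m2 := mc2.1 _ _ z0 zc (le_trans c23 c31).
  rewrite e2 /= in m1 m2.
  have l1 := sub_lt_idx ssub (leq_trans (leq_pred _) im) i1m (lt_le_trans a1 m1).
  have l2 := sub_lt_idx tsub (leq_trans (leq_pred _) jn) j1n (lt_le_trans b1 m2).
  by apply/orP; left; rewrite -(prednK i0) -(prednK j0) l1 l2.
have [zc'|cz'] := leP c3 z.
  have m1 := mc1.1 _ _ (le_trans c20 c23) zc' z1; have m2 := mc2.1 _ _ (le_trans c20 c23) zc' z1.
  rewrite e3 /= in m1 m2.
  by rewrite (sub_lt_idx ssub i2m im (le_lt_trans m1 a2)) (sub_lt_idx tsub j2n jn (le_lt_trans m2 b2)) orbT.
case: NS => [e|/N_segment_gridlines[k0 [l0 [k1 [l1 [[/andP[k01 k1m] /andP[l01 l1n]] _ _ grid]]]]]].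
  by move: (lt_trans cz cz'); rewrite e ltxx.
have zc : z \in `[c2, c3] by rewrite in_itv/= !ltW.
case: (grid z zc) => e.
  have := @cell_grid _ n t tsub j l0; rewrite j0 jn (leq_trans l01 l1n) /cell -e b1 b2 => /(_ isT isT) //.
by have := @cell_grid _ m s ssub i k1; rewrite i0 im k1m /cell -e a1 a2 => /(_ isT isT).
Qed.

Variables xM yM : nat -> nat -> R.
Hypothesis mx : maximal m n (ds s) (dt t) W xM yM.
Hypothesis opt : value m n W xM yM <= correlation m n s t u v g1 g2 h1 h2.

Lemma consecutive_slopes c1 c2 c3 c4 i1 j1 i2 j2 :
  consecutive_P m n s t W gam c1 c2 c3 c4 i1 j1 i2 j2 ->
  let A := W i1 j1 in let B := W i2.+1 j2.+1 in
  let C := W i1 j2.+1 in let D := W i2.+1 j1 in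
  0 < A /\ 0 < B /\ exists hA hB : R, [/\ 0 < hA /\ 0 < hB,
    H s t gam i1 j1 = hA%:E /\ H s t gam i2.+1 j2.+1 = hB%:E,
    0 < C -> C ^+ 2 <= (A * Num.sqrt hA) * (B * Num.sqrt hB^-1) &
    0 < D -> D ^+ 2 <= (A * Num.sqrt hA^-1) * (B * Num.sqrt hB)].
Proof.
move=> [P Q NS [i1m j1n i2m j2n] [e2 e3]] A B C D.
have [bA wA [aA [eA PA]]] := P_end_box P i1m j1n e2.
have [bB wB [aB [eB PB]]] := P_start_box Q i2m j2n e3.
have [c10 c12 c21] := P_itv P; have [c30 c34 c41] := P_itv Q.
have c23 : c2 <= c3 by case: NS => [->|[_ /ltW]].
have c20 : 0 <= c2 := le_trans c10 (ltW c12).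
have c31 : c3 <= 1 := le_trans (ltW c34) c41.
have i12 : (i1 < i2.+1)%N.
  by have := mc1.1 _ _ c20 c23 c31; rewrite e2 e3 /= ltnS; exact: (sub_le_idx ssub).
have j12 : (j1 < j2.+1)%N.
  by have := mc2.1 _ _ c20 c23 c31; rewrite e2 e3 /= ltnS; exact: (sub_le_idx tsub).
have gap i j z := @consecutive_gap c2 c3 i1 j1 i2 j2 i j z c20 c23 c31 i1m j1n i2m j2n NS e2 e3.
split=> //; split=> //.
exists (((gam eA).2 - (gam aA).2) / ((gam eA).1 - (gam aA).1)),
  (((gam eB).2 - (gam aB).2) / ((gam eB).1 - (gam aB).1)).
split.
- by case: PA PB => _ _ _ p1 p2 [_ _ _ q1 q2]; rewrite !divr_gt0// subr_gt0.
- by rewrite (H_proper PA) (@H_proper i2.+1 j2.+1 _ _ PB).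
- move=> C0; rewrite invf_div.
  exact: (exchange_upper ssub tsub G1 d1 G2 d2 mx opt bA bB wA wB i12 j12 PA PB gap C0).
- move=> D0; rewrite invf_div.
  exact: (exchange_lower ssub tsub G1 d1 G2 d2 mx opt bA bB wA wB i12 j12 PA PB gap D0).
Qed.

Lemma slope_ratio c1 c2 c3 c4 i1 j1 i2 j2 :
  consecutive_P m n s t W gam c1 c2 c3 c4 i1 j1 i2 j2 ->
  let A := W i1 j1 in let B := W i2.+1 j2.+1 in
  let C := W i1 j2.+1 in let D := W i2.+1 j1 in
  (exists2 mu : \bar R, mu_range A B C D mu &
     H s t gam i2.+1 j2.+1 = (mu ^+ 2 * H s t gam i1 j1)%E) /\
  (0 < C -> 0 < D -> ~ (A * B < C * D)).
Proof.
move=> cP A B C D.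
have [A0 [B0 [hA [hB [[a0 b0] [eA eB] up lo]]]]] := consecutive_slopes cP.
rewrite -/A -/B -/C -/D in A0 B0 up lo.
(* The required mu. In terms of [r] the exchange inequalities read [C ^ 2 * r <= A * B] and
   [D ^ 2 <= A * B * r]. *)
pose r := Num.sqrt (hB / hA).
have r0 : 0 < r by rewrite sqrtr_gt0 divr_gt0.
have rE : Num.sqrt hA^-1 * Num.sqrt hB = r by rewrite -sqrtrM ?invr_ge0 1?ltW// mulrC.
have rVE : Num.sqrt hA * Num.sqrt hB^-1 = r^-1.
  by rewrite -sqrtrM 1?ltW// /r -sqrtrV ?invf_div// divr_ge0// ltW.
have AB0 : 0 < A * B by rewrite mulr_gt0.
have up' : 0 < C -> r <= A * B / C ^+ 2.
  move=> C0; rewrite ler_pdivlMr ?exprn_gt0// mulrC -ler_pdivlMr//.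
  by apply: (le_trans (up C0)); rewrite mulrACA rVE.
have lo' : 0 < D -> D ^+ 2 / (A * B) <= r.
  move=> D0; rewrite ler_pdivrMr// mulrC.
  by apply: (le_trans (lo D0)); rewrite mulrACA rE.
split; last first.
  (* The interval contains [r], so its end points are in order, which means [C * D <= A * B]. *)
  move=> C0 D0 lt; have h := le_trans (lo' D0) (up' C0).
  move: h; rewrite ler_pdivrMr// mulrAC ler_pdivlMr ?exprn_gt0// -expr2 -exprMn.
  by rewrite ler_sqr ?nnegrE ?(ltW AB0) ?mulr_ge0 ?(ltW C0) ?(ltW D0)// => h; move: lt; rewrite [C * D]mulrC ltNge h.
exists r%:E; last first.
  rewrite eA eB -EFin_expe -EFinM; congr EFin; rewrite sqr_sqrtr ?divr_ge0// ?ltW//.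
  by rewrite divfK// gt_eqF.
rewrite /mu_range; case: ltP => C0; case: ltP => D0 /=; rewrite in_itv/= ?lee_fin ?leey ?andbT.
- by rewrite lo'// up'.
- by rewrite ltW// up'.
- exact: lo'.
- exact: ltW.
Qed.

End Consecutive.

Lemma separates_origin (R : realType) (m n : nat) (W x y : nat -> nat -> R) :
  separates m n (active m n W x y) 0 0.
Proof. by split=> // a b /act_block/and4P[a0 _ b0 _]; rewrite a0 b0 orbT. Qed.

Unset Implicit Arguments.
Theorem theorem6 (R : realType) (N : nat) (f1 f2 : R -> 'rV[R]_N)
  (f1_cont : {within `[0, 1], continuous f1})
  (f2_cont : {within `[0, 1], continuous f2})
  (f1_pl : piecewise_linear f1 0 1)
  (f2_pl : piecewise_linear f2 0 1)
  (q1_neq0 : {ae lebesgue_measure, forall x : R, x \in `[0, 1] -> srvf f1 x != 0})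
  (q2_neq0 : {ae lebesgue_measure, forall x : R, x \in `[0, 1] -> srvf f2 x != 0})
  (m n : nat) (s t : nat -> R)
  (s_sub : subdivision 0 1 m s) (t_sub : subdivision 0 1 n t)
  (f1_lin : forall i, (1 <= i <= m)%N -> linear_on f1 `[s i.-1, s i])
  (f2_lin : forall j, (1 <= j <= n)%N -> linear_on f2 `[t j.-1, t j])
  (u v : nat -> 'rV[R]_N)
  (q1_u : forall i, (1 <= i <= m)%N ->
     forall x, x \in `]s i.-1, s i[ -> srvf f1 x = u i)
  (q2_v : forall j, (1 <= j <= n)%N ->
     forall x, x \in `]t j.-1, t j[ -> srvf f2 x = v j) :
  let W := weight u v in
  (exists gam : R -> R * R,
     [/\ optimal_matching f1 f2 gam,
         (exists (k : nat) (p : nat -> R),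
            [/\ subdivision 0 1 k p,
                (forall i, (1 <= i <= k)%N ->
                   P_segment m n s t W gam (p i.-1) (p i) \/
                   N_segment m n s t W gam (p i.-1) (p i)) &
                (forall i, (1 <= i < k)%N ->
                   ~ (N_segment m n s t W gam (p i.-1) (p i) /\
                      N_segment m n s t W gam (p i) (p i.+1)))]) &
         (forall (c1 c2 c3 c4 : R) (i1 j1 i2 j2 : nat),
            consecutive_P m n s t W gam c1 c2 c3 c4 i1 j1 i2 j2 ->
            let A := W i1 j1 in
            let B := W i2.+1 j2.+1 in
            let C := W i1 j2.+1 in
            let D := W i2.+1 j1 in
            exists2 mu : \bar R, mu_range A B C D mu &
              H s t gam i2.+1 j2.+1 = (mu ^+ 2 * H s t gam i1 j1)%E)]) /\
  (forall gam : R -> R * R, optimal_matching f1 f2 gam ->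
     forall (c1 c2 c3 c4 : R) (i1 j1 i2 j2 : nat),
       consecutive_P m n s t W gam c1 c2 c3 c4 i1 j1 i2 j2 ->
       let A := W i1 j1 in
       let B := W i2.+1 j2.+1 in
       let C := W i1 j2.+1 in
       let D := W i2.+1 j1 in
       0 < C -> 0 < D -> ~ (A * B < C * D)).
Proof.
move=> W.
have ds01 (k : nat) (r : nat -> R) : subdivision 0 1 k r ->
    forall i, (1 <= i <= k)%N -> 0 <= ds r i <= 1.
  move=> sub i ik; rewrite (ltW (ds_pos sub ik)) /ds; case/andP: ik => i1 ik.
  by have := sub_le1 sub ik; have := sub_ge0 sub (leq_trans (leq_pred i) ik); lra.
have [x [y [mx nm]]] := maximal_exists W (ds01 m s s_sub) (ds01 n t t_sub).
have [ss [it vis]] := itinerary_exists (fun i j => @act_block R m n W x y i j)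
  (act_chain mx) (separates_origin m n W x y).
have nodes := nodes_monotone s_sub t_sub mx nm it.
pose gam := polygon (nd m n s t x y ss) (offset s t x y ss).
have [G1 G2] := polygon_Gamma nodes.
have [h1 d1] := Gamma_tilde_density G1; have [h2 d2] := Gamma_tilde_density G2.
have vis' i j : active m n W x y i j -> (i, j) \in flatten (map visited ss).
  by move=> a; have /and4P[i0 _ j0 _] := act_block a; exact: vis.
have att := polygon_attains s_sub t_sub mx nm it vis' d1 d2.
(* Since the polygon attains the maximum, optimality of any matching becomes an inequality for its
   correlation. It is read in one direction for the polygon and in the other for an arbitrary
   optimal matching. *)
have opt g k1 k2 : Gamma_tilde (fun z => (g z).1) -> density (fun z => (g z).1) k1 ->
    Gamma_tilde (fun z => (g z).2) -> density (fun z => (g z).2) k2 ->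
    L2dist (act (srvf f1) (fun z => (g z).1)) (act (srvf f2) (fun z => (g z).2)) =
      orbit_dist (srvf f1) (srvf f2) <->
    value m n W x y <= correlation m n s t u v (fun z => (g z).1) (fun z => (g z).2) k1 k2.
  exact: (optimal_iff s_sub t_sub q1_u q2_v mx G1 d1 G2 d2 att).
split.
- exists gam; split.
  + by split=> //; apply/(opt gam h1 h2).
  + exists (size ss), (cutpoint s t x y ss); split.
    * exact: (cut_subdivision s_sub t_sub mx nm it).
    * by case=> // i /andP[_ im]; exact: (cut_segment s_sub t_sub mx nm it).
    * by case=> // i /andP[_ im]; exact: (cut_alternates s_sub t_sub mx nm it).
  + move=> c1 c2 c3 c4 i1 j1 i2 j2 cP.
    by have [] := slope_ratio s_sub t_sub G1 d1 G2 d2 mx att cP.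
- move=> g [H1 H2 H3] c1 c2 c3 c4 i1 j1 i2 j2 cP.
  have [k1 e1] := Gamma_tilde_density H1; have [k2 e2] := Gamma_tilde_density H2.
  have op := (opt g k1 k2 H1 e1 H2 e2).1 H3.
  by have [] := slope_ratio s_sub t_sub H1 e1 H2 e2 mx op cP.
Qed.
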